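(* Assume conditions (A1), (A3), (A4) listed in the context. Let $T>0$ and, for $i=1,2$, let $b_i\in W^{1,2}(0,T)$ be a function satisfying (A2), let $a<s_{0i}<r_\varphi$, let $u_{0i}\in H^1(a,s_{0i})$ with $\varphi(a)\le u_{0i}\le b^*H^{-1}$ on $[a,s_{0i}]$, and let $(s_i,u_i)$ be a solution of $(\mathrm{P})_{u_{0i},s_{0i},b_i}$ on $[0,T]$ satisfying $\varphi(a)\le u_i\le b^*H^{-1}$ on $Q_{s_i}(T)$. Then there exists a positive constant $M_T$ depending on $T$ such that for all $t\in[0,T]$ $$|s_1(t)-s_2(t)|^2+|\tilde u_1(t)-\tilde u_2(t)|^2_{L^2(0,1)}+\int_0^t|\tilde u_{1y}(\tau)-\tilde u_{2y}(\tau)|^2_{L^2(0,1)}\,d\tau$$ $$\le M_T\left(|s_{01}-s_{02}|^2+|\tilde u_{01}-\tilde u_{02}|^2_{L^2(0,1)}+\int_0^t|b_1(\tau)-b_2(\tau)|^2\,d\tau\right),$$ where $\tilde u_i(t,y)=u_i(t,(1-y)a+ys_i(t))$ for $(t,y)\in(0,T)\times(0,1)$ and $\tilde u_{0i}(y)=u_{0i}((1-y)a+ys_{0i})$ for $y\in[0,1]$.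
   Context: Assumptions: (A1) $a,a_0,H,k,T$ are positive constants. (A2) (for a function $b$) $b\in W^{1,2}(0,T)\cap L^\infty(0,T)$ with $0<b_*\le b\le b^*$ on $(0,T)$, where $b_*,b^*$ are fixed positive constants (the same for $b_1$ and $b_2$). (A3) $\beta\in C^1(\mathbb{R})\cap W^{1,\infty}(\mathbb{R})$, $\beta=0$ on $(-\infty,0]$, and there exists $r_\beta>0$ such that $\beta'>0$ on $(0,r_\beta)$ and $\beta=k_0$ on $[r_\beta,+\infty)$, where $k_0$ is a positive constant. (A4) $\varphi\in C^1(\mathbb{R})\cap W^{1,\infty}(\mathbb{R})$, $\varphi=0$ on $(-\infty,0]$, and there exists $r_\varphi>0$ such that $\varphi'>0$ on $(0,r_\varphi)$ and $\varphi=c_0$ on $[r_\varphi,+\infty)$, where $c_0$ is a positive constant satisfying $0<c_0<\min\{2\varphi(a),\,b^*H^{-1}\}$. For a function $s$ on $[0,T]$ with $s>a$, put $Q_s(T)=\{(t,z): 0<t<T,\ a<z<s(t)\}$. Problem $(\mathrm{P})_{u_0,s_0,b}$ and its solutions: a pair $(s,u)$, with $s$ a function on $[0,T]$ and $u$ a function on $Q_s(T)$, is a solution to $(\mathrm{P})_{u_0,s_0,b}$ on $[0,T]$ if (S1) $s,s_t\in L^\infty(0,T)$, $a<s$ on $[0,T]$, $u\in L^\infty(Q_s(T))$, $u_t,u_{zz}\in L^2(Q_s(T))$, and $t\in[0,T]\mapsto |u_z(t,\cdot)|_{L^2(a,s(t))}$ is bounded; (S2) $u_t-ku_{zz}=0$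 a.e. on $Q_s(T)$; (S3) $-ku_z(t,a)=\beta(b(t)-Hu(t,a))$ for a.e. $t\in(0,T)$; (S4) $-ku_z(t,s(t))=u(t,s(t))s_t(t)$ for a.e. $t\in(0,T)$; (S5) $s_t(t)=a_0(u(t,s(t))-\varphi(s(t)))$ for a.e. $t\in(0,T)$; (S6) $s(0)=s_0$ and $u(0,z)=u_0(z)$ for $z\in[a,s_0]$. *)

(* Defs.v *)
From HB Require Import structures.
From mathcomp Require Import all_boot all_order all_algebra.
From mathcomp Require Import all_classical all_reals all_analysis.

Set Implicit Arguments.
Unset Strict Implicit.
Unset Printing Implicit Defensive.
Import Order.TTheory GRing.Theory Num.Theory.
Import numFieldNormedType.Exports.
Local Open Scope classical_set_scope.
Local Open Scope ring_scope.

Definition leb1 {R : realType} := @lebesgue_measure R.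
Definition leb2 {R : realType} := (@lebesgue_measure R \x @lebesgue_measure R)%E.

Section Sobolev.
Context {R : realType}.

Definition C1 (f : R -> R) : Prop :=
  (forall x, derivable f x 1) /\ continuous (derive1 f).

Definition dt (f : R * R -> R) (p : R * R) : R := derive1 (fun t => f (t, p.2)) p.1.
Definition dz (f : R * R -> R) (p : R * R) : R := derive1 (fun z => f (p.1, z)) p.2.

Definition C1_2 (f : R * R -> R) : Prop :=
  [/\ forall p, derivable (fun t => f (t, p.2)) p.1 1,
      forall p, derivable (fun z => f (p.1, z)) p.2 1,
      continuous (dt f) & continuous (dz f)].

Definition compactly_supported_in {X : topologicalType} (D : set X)
    (f : X -> R) : Prop :=
  exists K : set X, [/\ compact K, K `<=` D & forall x, ~ K x -> f x = 0].

Definition Lp1 (p : \bar R) (D : set R) (f : R -> R) : Prop :=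
  f \_ D \in Lfun leb1 p.

Definition Lp2 (p : \bar R) (D : set (R * R)) (f : R * R -> R) : Prop :=
  f \_ D \in Lfun leb2 p.

(* squared norm in L^2(D), with value +oo allowed *)
Definition L2sq (D : set R) (f : R -> R) : \bar R :=
  (\int[leb1]_(x in D) ((f x) ^+ 2)%:E)%E.

Definition locally_integrable2 (D : set (R * R)) (f : R * R -> R) : Prop :=
  [/\ measurable_fun D f, open D & forall K, K `<=` D -> compact K ->
    (\int[leb2]_(p in K) `|f p|%:E < +oo)%E].

(* |f - g|^2 in L^2(0, 1) *)
Definition dist01 (f g : R -> R) : \bar R := L2sq `]0, 1[ (f \- g).

Definition time_integral (t : R) (F : R -> \bar R) : \bar R :=
  (\int[leb1]_(tau in [set` `]0%R, t[]) F tau)%E.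

(* Weak derivatives.  The test functions are C^1 with compact support; by
   mollification, C^oo test functions yield the same notion. *)
Definition weak_deriv (D : set R) (f g : R -> R) : Prop :=
  [/\ locally_integrable D f, locally_integrable D g &
    forall eta, C1 eta -> compactly_supported_in D eta ->
      \int[leb1]_(x in D) (f x * derive1 eta x) =
      - \int[leb1]_(x in D) (g x * eta x)].

Definition weak_dt (D : set (R * R)) (f g : R * R -> R) : Prop :=
  [/\ locally_integrable2 D f, locally_integrable2 D g &
    forall eta, C1_2 eta -> compactly_supported_in D eta ->
      \int[leb2]_(p in D) (f p * dt eta p) =
      - \int[leb2]_(p in D) (g p * eta p)].

Definition weak_dz (D : set (R * R)) (f g : R * R -> R) : Prop :=
  [/\ locally_integrable2 D f, locally_integrable2 D g &
    forall eta, C1_2 eta -> compactly_supported_in D eta ->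
      \int[leb2]_(p in D) (f p * dz eta p) =
      - \int[leb2]_(p in D) (g p * eta p)].

(* W^{1,p}(D), for D open *)
Definition W1p (p : \bar R) (D : set R) (f : R -> R) : Prop :=
  Lp1 p D f /\ exists2 g, Lp1 p D g & weak_deriv D f g.

(* A representative of the weak derivative of f on D, and 0 if f is not weakly
   differentiable.  Weak derivatives are unique up to a.e. equality on D. *)
Definition wderiv (D : set R) (f : R -> R) : R -> R :=
  xget (fun=> 0) [set g | weak_deriv D f g].

End Sobolev.

Section Problem.
Context {R : realType}.

(* the shape shared by the conditions on beta and phi *)
Definition cutoff (f : R -> R) (r c : R) : Prop :=
  [/\ C1 f, W1p +oo%E setT f &
   [/\ 0 < r, 0 < c,
       forall x, x <= 0 -> f x = 0,
       forall x, 0 < x < r -> 0 < derive1 f x &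
       forall x, r <= x -> f x = c]].

Definition admissible_b (T bl bu : R) (b : R -> R) : Prop :=
  [/\ W1p 2%:E `]0, T[ b, Lp1 +oo%E `]0, T[ b &
      {ae leb1, forall t, 0 < t < T -> bl <= b t <= bu}].

Definition Q (a T : R) (s : R -> R) : set (R * R) :=
  [set p | 0 < p.1 < T /\ a < p.2 < s p.1].

Definition Qbar (a T : R) (s : R -> R) : set (R * R) :=
  [set p | 0 <= p.1 <= T /\ a <= p.2 <= s p.1].

(* st is s_t, and ut, uz, uzz are the weak derivatives u_t, u_z, u_zz.
   Representatives are fixed so that the pointwise conditions make sense as
   evaluations: s is continuous on [0, T] (s is in W^{1,oo}(0, T)); u is
   continuous on the closure of Q (u_t is in L^2(Q) and u_z is bounded in time
   with values in L^2); for almost every t, uz (t, .) is continuous on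
   [a, s t] (u (t, .) is in H^2(a, s t)). *)
Record solution_with (a a0 H k T : R) (beta phi b : R -> R) (s0 : R)
    (u0 : R -> R) (s st : R -> R) (u ut uz uzz : R * R -> R) : Prop := {
  s_continuous : {within `[0, T], continuous s};
  s_Linfty : Lp1 +oo%E `]0, T[ s;
  st_Linfty : Lp1 +oo%E `]0, T[ st;
  s_weak_deriv : weak_deriv `]0, T[ s st;
  s_gt : forall t, 0 <= t <= T -> a < s t;
  u_continuous : {within Qbar a T s, continuous u};
  u_Linfty : Lp2 +oo%E (Q a T s) u;
  ut_L2 : Lp2 2%:E (Q a T s) ut;
  u_weak_dt : weak_dt (Q a T s) u ut;
  u_weak_dz : weak_dz (Q a T s) u uz;
  uz_weak_dz : weak_dz (Q a T s) uz uzz;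
  uzz_L2 : Lp2 2%:E (Q a T s) uzz;
  uz_slice : forall t, 0 <= t <= T ->
    weak_deriv `]a, s t[ (fun z => u (t, z)) (fun z => uz (t, z));
  uz_slice_bounded : exists C : R, forall t, 0 <= t <= T ->
    (L2sq `]a, s t[ (fun z => uz (t, z)) <= C%:E)%E;
  uz_slice_continuous : {ae leb1, forall t, 0 < t < T ->
    {within `[a, s t], continuous (fun z => uz (t, z))}};
  heat_equation : {ae leb2, forall p, Q a T s p -> ut p - k * uzz p = 0};
  flux_at_a : {ae leb1, forall t, 0 < t < T ->
    - k * uz (t, a) = beta (b t - H * u (t, a))};
  flux_at_s : {ae leb1, forall t, 0 < t < T ->
    - k * uz (t, s t) = u (t, s t) * st t};
  front_speed : {ae leb1, forall t, 0 < t < T ->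
    st t = a0 * (u (t, s t) - phi (s t))};
  s_initial : s 0 = s0;
  u_initial : forall z, a <= z <= s0 -> u (0, z) = u0 z
}.

Definition solution (a a0 H k T : R) (beta phi b : R -> R) (s0 : R)
    (u0 : R -> R) (s : R -> R) (u : R * R -> R) : Prop :=
  exists st ut uz uzz,
    solution_with a a0 H k T beta phi b s0 u0 s st u ut uz uzz.

(* v on (a, l) transported to (0, 1) *)
Definition rescale (a l : R) (v : R -> R) (y : R) : R :=
  v ((1 - y) * a + y * l).

Definition tilde (a : R) (s : R -> R) (u : R * R -> R) (t : R) : R -> R :=
  rescale a (s t) (fun z => u (t, z)).

Definition tilde_y (a : R) (s : R -> R) (u : R * R -> R) (t : R) : R -> R :=
  wderiv `]0, 1[ (tilde a s u t).

End Problem.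

(* Main.v *)
Require Import Defs.
From HB Require Import structures.
From mathcomp Require Import all_boot all_order all_algebra.
From mathcomp Require Import all_classical all_reals all_analysis.
From mathcomp Require Import measurable_realfun ring lra.
Import Order.TTheory GRing.Theory Num.Theory.
Import numFieldNormedType.Exports.
Local Open Scope classical_set_scope.
Local Open Scope ring_scope.
Set Implicit Arguments.
Unset Strict Implicit.
Unset Printing Implicit Defensive.

(** Write l = s - a for the width of the moving domain and U (t, y) = u (t, a + y l (t)) for the
state on the fixed interval (0, 1). With v = s_t, the problem becomes
  U_t = (k / l^2) U_yy + y (v / l) U_y,   v = a0 (U (t, 1) - phi (a + l)),
with the fluxes (k / l^2) U_y equal to - beta (b - H U) / l at y = 0 and to - U v / l at y = 1.

For two solutions put W = U1 - U2 and sigma = l1 - l2, and test the difference of the equations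
with W. The diffusion term yields - kappa |W_y|^2. The differences of the coefficients are
multiplied by derivatives of U2, and are Lipschitz in sigma, in W (t, 1), and, for the flux at 0,
in W (t, 0) and b1 - b2, because l stays away from 0 and u is bounded. Boundary values of W are
absorbed by diffusion through the trace inequality w (y)^2 <= e |w_y|^2 + (1 + 1/e) |w|^2. The only
quantity that is not bounded uniformly in time is A (t) = |U2_y (t)|^2, which appears as a factor of
|W|^2 + sigma^2; it is integrable in time, with a bound on the integral that depends only on the
data, by the energy identity for U2 alone (lemma reduced_energy). Gronwall's inequality with
the integrable weight 1 + A (gronwall_energy) then closes the estimate, and keeps the diffusion
term on the left-hand side (reduced_stability).

The constant must not depend on the solutions, so bounds for l and v are needed. Since u is at least
phi (a) up to the front and phi is Lipschitz, v >= - a0 L l, so l decays at most exponentially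
(exp_lower_bound); the bounds on u and phi bound v, and hence l from above.

The derivatives are weak derivatives on a noncylindrical domain, and the computation above
requires them to be usable pointwise. All of them are converted into statements of the form: F is
the integral of f on [a, b] (the predicate prim). Integration by parts for such pairs is
Fubini's theorem (prim_mul). A weak derivative of a continuous function is of this form, as
trapezoidal test functions approximate indicators of intervals (prim_of_weak). In two variables,
tensor products of test functions on the rectangle, pulled back to the moving domain,
give primitives along almost every line (prim_slice). The result is the structure reduced,
which solution_reduced derives from the definition of a solution. In the time variable the
change of variables uses that l is continuously differentiable on (0, T), as v is continuous. *)

(** * Integrals of real-valued functions *)

Section RealIntegrals.
Context d (X : measurableType d) (R : realType).
Variable mu : {measure set X -> \bar R}.
Implicit Types (D : set X) (f g : X -> R).

Lemma restrE D f x : (f \_ D) x = if x \in D then f x else 0.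
Proof. by rewrite patchE. Qed.

(** Integrands are kept real-valued, so that identities between them are identities in a field;
    extended reals appear only where finiteness is in question. *)
Definition intble D f := mu.-integrable D (EFin \o f).

Lemma ae_imp (P Q : X -> Prop) : (forall x, P x -> Q x) ->
  {ae mu, forall x, P x} -> {ae mu, forall x, Q x}.
Proof. by move=> PQ; apply: filterS. Qed.

Lemma ae_and (P Q : X -> Prop) : {ae mu, forall x, P x} -> {ae mu, forall x, Q x} ->
  {ae mu, forall x, P x /\ Q x}.
Proof. by move=> hP hQ; exact: filterI. Qed.

Lemma intble_meas D f : intble D f -> measurable_fun D f.
Proof. by move=> /integrableP[/measurable_EFinP]. Qed.

Lemma intble_eq D f g : measurable D -> {in D, f =1 g} -> intble D f -> intble D g.
Proof.
move=> mD fg; apply: eq_integrable => // x xD; by rewrite /= fg.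
Qed.

Lemma intbleD D f g : measurable D -> intble D f -> intble D g ->
  intble D (fun x => f x + g x).
Proof. by move=> mD fi gi; have := integrableD mD fi gi; apply: eq_integrable. Qed.

Lemma intbleB D f g : measurable D -> intble D f -> intble D g ->
  intble D (fun x => f x - g x).
Proof. by move=> mD fi gi; have := integrableB mD fi gi; apply: eq_integrable. Qed.

Lemma intbleZ D c f : measurable D -> intble D f -> intble D (fun x => c * f x).
Proof. by move=> mD fi; have := integrableZl mD c fi; apply: eq_integrable. Qed.

Lemma intbleN D f : measurable D -> intble D f -> intble D (fun x => - f x).
Proof. by move=> mD fi; have := integrableN fi; apply: eq_integrable. Qed.

Lemma intbleS D E f : measurable D -> measurable E -> E `<=` D ->
  intble D f -> intble E f.
Proof. by move=> mD mE ED; apply: integrableS. Qed.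

Lemma le_intble D f g : measurable D -> measurable_fun D f ->
  (forall x, D x -> `|f x| <= g x) -> intble D g -> intble D f.
Proof.
move=> mD mf fg gi; apply: le_integrable gi => //; first exact/measurable_EFinP.
by move=> x Dx; rewrite /= lee_fin (le_trans (fg _ Dx))// ler_norm.
Qed.

Lemma intble_abs D f : measurable D -> intble D f -> intble D (fun x => `|f x|).
Proof. by move=> mD fi; have := integrable_abse fi; apply: eq_integrable. Qed.

Lemma intble_mulb D f g M : measurable D -> measurable_fun D g ->
  (forall x, D x -> `|g x| <= M) -> intble D f -> intble D (fun x => g x * f x).
Proof.
move=> mD mg gM fi; apply: (@le_intble _ _ (fun x => M * `|f x|)) => //.
- by apply: measurable_funM => //; exact: intble_meas.
- by move=> x Dx; rewrite normrM ler_wpM2r// gM.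
- by apply: intbleZ => //; exact: intble_abs.
Qed.

Lemma intble_mulbr D f g M : measurable D -> measurable_fun D g ->
  (forall x, D x -> `|g x| <= M) -> intble D f -> intble D (fun x => f x * g x).
Proof.
move=> mD mg gM fi; have := intble_mulb mD mg gM fi.
by apply: intble_eq => // x _; rewrite mulrC.
Qed.

Lemma intble_cst D c : measurable D -> (mu D < +oo)%E -> intble D (fun=> c).
Proof.
move=> mD muD; apply: measurable_bounded_integrable => //.
exists `|c|; split; first exact: num_real.
by move=> x cx y _ /=; exact: ltW.
Qed.

Lemma intble_of_sq D f : measurable D -> (mu D < +oo)%E -> measurable_fun D f ->
  intble D (fun x => f x ^+ 2) -> intble D f.
Proof.
move=> mD muD mf f2; apply: (@le_intble _ _ (fun x => f x ^+ 2 + 1)) => //.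
- move=> x _; have := sqr_ge0 (f x + 1); have := sqr_ge0 (f x - 1); have := sqr_ge0 (f x).
  by rewrite ler_norml => *; apply/andP; split; nra.
- by apply: intbleD => //; exact: intble_cst.
Qed.

Lemma intble_sqD D f g : measurable D -> measurable_fun D f -> measurable_fun D g ->
  intble D (fun x => f x ^+ 2) -> intble D (fun x => g x ^+ 2) ->
  intble D (fun x => (f x + g x) ^+ 2).
Proof.
move=> mD mf mg f2 g2.
apply: (@le_intble _ _ (fun x => 2 * f x ^+ 2 + 2 * g x ^+ 2)) => //.
- by apply: measurable_funX; exact: measurable_funD.
- move=> x _; have h := sqr_ge0 (f x - g x).
  by rewrite ger0_norm ?sqr_ge0//; nra.
- by apply: intbleD => //; exact: intbleZ.
Qed.

Lemma intble_sqB D f g : measurable D -> measurable_fun D f -> measurable_fun D g ->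
  intble D (fun x => f x ^+ 2) -> intble D (fun x => g x ^+ 2) ->
  intble D (fun x => (f x - g x) ^+ 2).
Proof.
move=> mD mf mg f2 g2; apply: intble_sqD => //; first exact: measurableT_comp.
by apply: intble_eq g2 => // x _; rewrite sqrrN.
Qed.

Lemma intble_sqmulb D f g M : measurable D -> measurable_fun D g -> measurable_fun D f ->
  (forall x, D x -> `|g x| <= M) -> intble D (fun x => f x ^+ 2) ->
  intble D (fun x => (g x * f x) ^+ 2).
Proof.
move=> mD mg mf gM fi.
apply: (@intble_eq _ (fun x => g x ^+ 2 * f x ^+ 2)) => //.
  by move=> x _; rewrite exprMn.
apply: (@intble_mulb _ _ _ (M ^+ 2)) => //; first exact: measurable_funX.
move=> x Dx; rewrite normrX; have := gM _ Dx; have := normr_ge0 (g x).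
by move=> h0 h1; rewrite ler_sqr ?nnegrE//; lra.
Qed.

Lemma RintD D f g : measurable D -> intble D f -> intble D g ->
  \int[mu]_(x in D) (f x + g x) = \int[mu]_(x in D) f x + \int[mu]_(x in D) g x.
Proof. exact: RintegralD. Qed.

Lemma RintN D f : measurable D -> intble D f ->
  \int[mu]_(x in D) (- f x) = - \int[mu]_(x in D) f x.
Proof.
move=> mD fi; rewrite -mulN1r -RintegralZl//.
by apply: eq_Rintegral => x _; rewrite mulN1r.
Qed.

(** The integral of the nonnegative difference is that of its positive part, which equals it
    almost everywhere and is nonnegative everywhere. *)
Lemma ae_le_Rint D f g : measurable D -> intble D f -> intble D g ->
  {ae mu, forall x, D x -> f x <= g x} ->
  \int[mu]_(x in D) f x <= \int[mu]_(x in D) g x.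
Proof.
move=> mD fi gi fg.
have hi : intble D (fun x => g x - f x) by exact: intbleB.
rewrite -subr_ge0 -RintegralB//.
have -> : \int[mu]_(x in D) (g x - f x) = \int[mu]_(x in D) (Num.max 0 (g x - f x)).
  congr fine; apply: ae_eq_integral => //.
  - exact: (measurable_int mu).
  - apply/measurable_EFinP; apply: measurable_maxr => //; exact: intble_meas.
  - apply: filterS fg => x /= h Dx; congr EFin.
    by rewrite max_r// subr_ge0 h.
by apply: Rintegral_ge0 => x _; rewrite le_max lexx.
Qed.

Lemma ae_eq_Rint D f g : measurable D -> measurable_fun D f -> measurable_fun D g ->
  {ae mu, forall x, D x -> f x = g x} ->
  \int[mu]_(x in D) f x = \int[mu]_(x in D) g x.
Proof.
move=> mD fi gi fg; congr fine; apply: ae_eq_integral => //.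
- exact/measurable_EFinP.
- exact/measurable_EFinP.
- by apply: filterS fg => x /= h Dx; rewrite h.
Qed.

Lemma EFin_Rint D f : measurable D -> intble D f ->
  (\int[mu]_(x in D) f x)%:E = (\int[mu]_(x in D) (f x)%:E)%E.
Proof. by move=> mD fi; rewrite /Rintegral fineK//; exact: integrable_fin_num. Qed.

Lemma intble_mkcond D f : measurable D -> intble D f <-> intble setT (f \_ D).
Proof.
move=> mD; rewrite /intble (integrable_mkcond _ mD); split;
  by apply: eq_integrable => // x _ /=; rewrite restrict_EFin.
Qed.

Lemma ge0_intble D f : measurable D -> measurable_fun D f ->
  (forall x, D x -> 0 <= f x) -> (\int[mu]_(x in D) (f x)%:E < +oo)%E -> intble D f.
Proof.
move=> mD mf f0 fi; apply/integrableP; split; first exact/measurable_EFinP.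
apply: le_lt_trans fi; rewrite le_eqVlt; apply/orP; left; apply/eqP.
by apply: eq_integral => x; rewrite inE => Dx /=; rewrite ger0_norm// f0.
Qed.

End RealIntegrals.

(** * Fubini's theorem and absolutely continuous functions *)

Section RealFubini.
Context d1 d2 (X : measurableType d1) (Y : measurableType d2) (R : realType).
Variables (m1 : {sigma_finite_measure set X -> \bar R}).
Variables (m2 : {sigma_finite_measure set Y -> \bar R}).
Implicit Types h : X * Y -> R.

Let ae_fine1 h : intble (m1 \x m2)%E setT h ->
  {ae m1, forall x, setT x -> (\int[m2]_y h (x, y))%:E =
     (\int[m2]_y (h (x, y))%:E)%E}.
Proof.
move=> hi; apply: filterS (ae_integrable1 hi) => x hx _.
by rewrite EFin_Rint.
Qed.

Let meas1 h : intble (m1 \x m2)%E setT h ->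
  measurable_fun setT (fun x => \int[m2]_y h (x, y)).
Proof.
move=> hi; apply: measurableT_comp => //; exact: (measurable_fubini_F hi).
Qed.

(** The inner real integral agrees with the inner extended-real integral for almost every x
    only, since a slice may fail to be integrable; hence the detour through almost-everywhere
    equality. *)
Lemma fubini_intble1 h : intble (m1 \x m2)%E setT h ->
  intble m1 setT (fun x => \int[m2]_y h (x, y)).
Proof.
move=> hi; have /integrableP[mF iF] := integrable_fubini_F hi.
apply/integrableP; split; first by apply/measurable_EFinP; exact: meas1.
apply: le_lt_trans iF; rewrite le_eqVlt; apply/orP; left; apply/eqP.
apply: ae_eq_integral => //.
- by apply: measurableT_comp => //; apply/measurable_EFinP; exact: meas1.
- exact: measurableT_comp.
- by apply: filterS (ae_fine1 hi) => x /(_ I) /= h1 _; rewrite /fubini_F /= -h1.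
Qed.

Lemma fubini_Rint1 h : intble (m1 \x m2)%E setT h ->
  \int[m1]_x \int[m2]_y h (x, y) = \int[(m1 \x m2)%E]_p h p.
Proof.
move=> hi; congr fine; rewrite -integral12_prod_meas1//.
apply: ae_eq_integral => //.
- by apply/measurable_EFinP; exact: meas1.
- exact: (measurable_fubini_F hi).
- by apply: filterS (ae_fine1 hi) => x /(_ I) /= h1 _; rewrite /fubini_F /= -h1.
Qed.

Let ae_fine2 h : intble (m1 \x m2)%E setT h ->
  {ae m2, forall y, setT y -> (\int[m1]_x h (x, y))%:E =
     (\int[m1]_x (h (x, y))%:E)%E}.
Proof.
move=> hi; apply: filterS (ae_integrable2 hi) => x hx _.
by rewrite EFin_Rint.
Qed.

Let meas2 h : intble (m1 \x m2)%E setT h ->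
  measurable_fun setT (fun y => \int[m1]_x h (x, y)).
Proof.
move=> hi; apply: measurableT_comp => //; exact: (measurable_fubini_G hi).
Qed.

Lemma fubini_intble2 h : intble (m1 \x m2)%E setT h ->
  intble m2 setT (fun y => \int[m1]_x h (x, y)).
Proof.
move=> hi; have mh := measurable_int _ hi.
have fin := (integrable21ltyP m1 m2 mh).1 hi.
apply/integrableP; split; first by apply/measurable_EFinP; exact: meas2.
apply: le_lt_trans fin; apply: ae_ge0_le_integral => //.
- by apply: measurableT_comp => //; apply/measurable_EFinP; exact: meas2.
- by move=> y _; apply: integral_ge0.
- apply: (measurable_fun_fubini_tonelli_G (abse \o (EFin \o h))).
    exact: measurableT_comp.
  by move=> p; exact: abse_ge0.
have := ae_fine2 hi; apply: ae_imp => y /(_ I) /= h1 _; rewrite -abse_EFin h1.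
apply: le_abse_integral => //.
by apply: measurableT_comp mh _.
Qed.

Lemma fubini_Rint2 h : intble (m1 \x m2)%E setT h ->
  \int[m2]_y \int[m1]_x h (x, y) = \int[(m1 \x m2)%E]_p h p.
Proof.
move=> hi; congr fine; rewrite -integral21_prod_meas1//.
apply: ae_eq_integral => //.
- by apply/measurable_EFinP; exact: meas2.
- exact: (measurable_fubini_G hi).
- by apply: filterS (ae_fine2 hi) => x /(_ I) /= h1 _; rewrite /fubini_G /= -h1.
Qed.

Lemma intble_tensor (f : X -> R) (g : Y -> R) :
  intble m1 setT f -> intble m2 setT g ->
  intble (m1 \x m2)%E setT (fun p => f p.1 * g p.2).
Proof.
move=> fi gi; have mf := intble_meas fi; have mg := intble_meas gi.
apply/integrable12ltyP.
  apply/measurable_EFinP/measurable_funM.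
    exact: measurableT_comp measurable_fst.
  exact: measurableT_comp measurable_snd.
have gi' := intble_abs measurableT gi.
have fi' := intble_abs measurableT fi.
rewrite (eq_integral (fun x => (\int[m2]_y `|g y| * `|f x|)%:E)).
  have := intbleZ (\int[m2]_y `|g y|) measurableT fi'.
  move=> /integrableP[_]; apply: le_lt_trans.
  rewrite le_eqVlt; apply/orP; left; apply/eqP; apply: eq_integral => x _ /=.
  by rewrite (normrM _ `|f x|) normr_id ger0_norm// Rintegral_ge0.
move=> x _; rewrite mulrC -RintegralZl// EFin_Rint//; last exact: intbleZ.
by apply: eq_integral => y _ /=; rewrite normrM.
Qed.

End RealFubini.

Section Primitives.
Context {R : realType}.
Notation mu := (@lebesgue_measure R).
Implicit Types (f g F G : R -> R) (a b : R).

(** F is absolutely continuous on [a, b] with derivative f, in integrated form. The formula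
    makes sense for a function f that is defined almost everywhere, and fixes the continuous
    representative F. *)
Definition prim a b F f :=
  intble mu `[a, b] f /\
  forall x, a <= x <= b -> F x = F a + \int[mu]_(t in `[a, x]) f t.

Lemma Rint_cat f a b x y : intble mu `[a, b] f -> a <= x -> x <= y -> y <= b ->
  \int[mu]_(t in `[a, y]) f t =
  \int[mu]_(t in `[a, x]) f t + \int[mu]_(t in `[x, y]) f t.
Proof.
move=> fi ax xy yb.
have fi1 : intble mu `[a, y] f by apply: intbleS fi => //; apply: subset_itvl.
have := @Rintegral_itvB R f (BLeft a) (BRight y) x fi1.
rewrite !bnd_simp => /(_ ax xy) h.
have fi2 : intble mu `]x, y] f.
  by apply: intbleS fi1 => //; apply: subset_itvr; rewrite bnd_simp.
by rewrite -(Rintegral_itv_obnd_cbnd fi2) -h; ring.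
Qed.

Lemma primB a b F f x y : prim a b F f -> a <= x -> x <= y -> y <= b ->
  F y - F x = \int[mu]_(t in `[x, y]) f t.
Proof.
move=> [fi Ff] ax xy yb; rewrite Ff ?(le_trans ax xy)//.
rewrite (Ff x) ?ax ?(le_trans xy)// (Rint_cat fi ax xy yb); ring.
Qed.

Lemma primS a b F f x y : prim a b F f -> a <= x -> x <= y -> y <= b -> prim x y F f.
Proof.
move=> FF ax xy yb; split.
  by apply: intbleS FF.1 => //; apply: subset_itv; rewrite bnd_simp.
move=> z /andP[xz zy]; rewrite -(primB FF ax xz (le_trans zy yb)); ring.
Qed.

Lemma prim_continuous a b F f : a <= b -> prim a b F f ->
  {within `[a, b], continuous F}.
Proof.
move=> ab [fi Ff].
have c := parameterized_integral_continuous ab fi.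
apply: (@subspace_eq_continuous _ _ _ (fun x => F a + parameterized_integral mu a x f));
  last by move=> x; apply: cvgD; [exact: cvg_cst|exact: c].
move=> x xab.
by apply/esym/Ff; move: xab; rewrite inE /= in_itv.
Qed.

Lemma continuous_meas a b F : {within `[a, b], continuous F} ->
  measurable_fun `[a, b] F.
Proof. by move=> cF; apply: subspace_continuous_measurable_fun. Qed.

Lemma continuous_bounded a b F : a <= b -> {within `[a, b], continuous F} ->
  exists M, forall x, a <= x <= b -> `|F x| <= M.
Proof.
move=> ab cF.
have cF' : {within `[a, b], continuous (fun x => `|F x|)}.
  by move=> x; apply: cvg_norm; exact: cF.
have [c cab cM] := EVT_max ab cF'.
by exists `|F c| => x xab; apply: cM; rewrite in_itv.
Qed.

Lemma continuous_intble a b F : {within `[a, b], continuous F} -> intble mu `[a, b] F.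
Proof.
move=> cF; apply: continuous_compact_integrable => //; exact: segment_compact.
Qed.

Lemma intble_mulc a b F f : a <= b -> {within `[a, b], continuous F} ->
  intble mu `[a, b] f -> intble mu `[a, b] (fun x => F x * f x).
Proof.
move=> ab cF fi; have [M FM] := continuous_bounded ab cF.
by apply: (intble_mulb (M := M)) => //; exact: continuous_meas.
Qed.

Let prim_swap a b F f G g : a <= b -> prim a b F f -> prim a b G g ->
  \int[mu]_(s in `[a, b]) (f s * (G b - G s)) =
  \int[mu]_(t in `[a, b]) (g t * (F t - F a)).
Proof.
move=> ab FF GG; pose f0 := f \_ `[a, b]; pose g0 := g \_ `[a, b].
have f0i : intble mu setT f0.
  by apply/(intble_mkcond mu f (measurable_itv `[a, b])); exact: FF.1.
have g0i : intble mu setT g0.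
  by apply/(intble_mkcond mu g (measurable_itv `[a, b])); exact: GG.1.
(* f (s) g (t) on the triangle s <= t *)
pose h (p : R * R) : R := (if p.1 <= p.2 then 1 else 0) * (f0 p.1 * g0 p.2).
have hi : intble (mu \x mu)%E setT h.
  apply: (intble_mulb (M := 1)) => //.
  - apply: measurable_fun_ifT => //; apply: measurable_fun_ler.
      exact: measurable_fst.
    exact: measurable_snd.
  - by move=> x _; case: ifP; rewrite ?normr1 ?normr0.
  - exact: intble_tensor.
have := fubini_Rint1 hi; rewrite -(fubini_Rint2 hi) /h /= => e.
rewrite Rintegral_mkcond [RHS]Rintegral_mkcond.
transitivity (\int[mu]_x \int[mu]_y ((if x <= y then 1 else 0) * (f0 x * g0 y))).
  apply: eq_Rintegral => s _; rewrite !restrE; case: ifPn => [|/negP] sab; last first.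
    rewrite -[LHS](Rintegral_set0 mu (fun=> 0)) [LHS]Rintegral_mkcond.
    apply: eq_Rintegral => t _; rewrite !restrE ifF; last by rewrite in_set0.
    by rewrite /f0 restrE (negbTE (introN idP sab)) mul0r mulr0.
  have /andP[as_ sb] : a <= s <= b by move: sab; rewrite mem_setE in_itv.
  rewrite (primB GG as_ sb (lexx _)) -RintegralZl; [|by []|exact: (primS GG as_ sb (lexx _)).1].
  rewrite Rintegral_mkcond; apply: eq_Rintegral => t _.
  rewrite /f0 /g0 !restrE sab !mem_setE !in_itv /=.
  have [st|st] := leP s t; rewrite ?andbF ?mul0r//=.
  by rewrite (le_trans as_ st)/=; case: ifP; rewrite ?mul1r ?mulr0.
rewrite e; apply: eq_Rintegral => t _; rewrite !restrE; case: ifPn => [|/negP] tab; last first.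
  rewrite -[RHS](Rintegral_set0 mu (fun=> 0)) [RHS]Rintegral_mkcond.
  apply: eq_Rintegral => s _; rewrite !restrE [in RHS]ifF; last by rewrite in_set0.
  by rewrite /g0 !restrE (negbTE (introN idP tab)) !mulr0.
have /andP[at_ tb] : a <= t <= b by move: tab; rewrite mem_setE in_itv.
rewrite (primB FF (lexx _) at_ tb) -RintegralZl; [|by []|exact: (primS FF (lexx _) at_ tb).1].
rewrite [RHS]Rintegral_mkcond; apply: eq_Rintegral => s _.
rewrite /f0 /g0 !restrE tab !mem_setE !in_itv /= andbC.
have [st|st] := leP s t; rewrite /= ?andbF ?mul0r//.
by rewrite (le_trans st tb)/= mul1r; case: ifP; rewrite ?mul0r// mulrC.
Qed.

(** Integration by parts for absolutely continuous functions: both cross terms are iterated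
    integrals of f (s) g (t) over the triangle s <= t, in the two orders. *)
Lemma prim_mul a b F f G g : a <= b -> prim a b F f -> prim a b G g ->
  F b * G b - F a * G a = \int[mu]_(x in `[a, b]) (f x * G x + F x * g x).
Proof.
move=> ab FF GG; have h := prim_swap ab FF GG.
have cF := prim_continuous ab FF; have cG := prim_continuous ab GG.
have i1 := intble_mulc ab cG FF.1; have i2 := intble_mulc ab cF GG.1.
rewrite RintD//; last by apply: intble_eq i1 => // x _; rewrite mulrC.
have e1 : \int[mu]_(s in `[a, b]) (f s * (G b - G s)) =
    G b * (F b - F a) - \int[mu]_(x in `[a, b]) (f x * G x).
  rewrite (primB FF (lexx _) ab (lexx _)) -RintegralZl//; last exact: FF.1.
  rewrite -RintegralB//.
  - by apply: eq_Rintegral => x _; ring.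
  - exact: (intbleZ _ _ FF.1).
  - by apply: intble_eq i1 => // x _; rewrite mulrC.
have e2 : \int[mu]_(s in `[a, b]) (g s * (F s - F a)) =
    \int[mu]_(x in `[a, b]) (F x * g x) - F a * (G b - G a).
  rewrite (primB GG (lexx _) ab (lexx _)) -RintegralZl//; last exact: GG.1.
  rewrite -RintegralB//.
  - by apply: eq_Rintegral => x _; ring.
  - exact: (intbleZ _ _ GG.1).
by move: h; rewrite e1 e2 => h; lra.
Qed.

End Primitives.

(** * Test functions on the line *)

Section Dominated.
Context d (X : measurableType d) (R : realType).
Variable mu : {measure set X -> \bar R}.

Lemma Rint_dominated (D : set X) (f_ : nat -> X -> R) (f g : X -> R) :
  measurable D -> (forall n, measurable_fun D (f_ n)) -> measurable_fun D f ->
  (forall x, D x -> f_ n x @[n --> \oo] --> f x) ->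
  (forall n x, D x -> `|f_ n x| <= g x) -> intble mu D g ->
  \int[mu]_(x in D) f_ n x @[n --> \oo] --> \int[mu]_(x in D) f x.
Proof.
move=> mD mf_ mf ff fg gi.
have [] := @dominated_convergence _ _ _ mu D mD (fun n => EFin \o f_ n) (EFin \o f)
   (EFin \o g).
- by move=> n; exact/measurable_EFinP.
- exact/measurable_EFinP.
- by apply: aeW => x Dx; apply: cvg_EFin; [exact: nearW|exact: ff].
- exact: gi.
- by apply: aeW => x n Dx /=; rewrite lee_fin fg.
move=> fi _ cvg; apply: fine_cvg; rewrite fineK//; exact: integrable_fin_num.
Qed.

End Dominated.

Section TestFunctions.
Context {R : realType}.
Notation mu := (@lebesgue_measure R).
Implicit Types (f g F G : R -> R) (a b x y d z : R).

Lemma Rint_oo_cc a b f : measurable_fun `]a, b[ f ->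
  \int[mu]_(x in `]a, b[) f x = \int[mu]_(x in `[a, b]) f x.
Proof.
move=> mf; rewrite /Rintegral; congr fine; apply/esym/integral_itv_bndoo.
exact/measurable_EFinP.
Qed.

Lemma intble_oo_cc a b f : intble mu `]a, b[ f -> intble mu `[a, b] f.
Proof.
move=> fi; have mf := intble_meas fi; apply/integrableP; split.
  by apply/measurable_EFinP; exact: measurable_fun_itv_cc mf.
rewrite integral_itv_bndoo; first by have /integrableP[] := fi.
by apply: measurableT_comp => //; exact/measurable_EFinP.
Qed.

Lemma intble_cc_oo a b f : intble mu `[a, b] f -> intble mu `]a, b[ f.
Proof. by move=> fi; apply: intbleS fi => //; exact: subset_itv_oo_cc. Qed.

(** Lebesgue's differentiation theorem, applied to the difference extended by zero, whose
    primitive vanishes identically. *)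
Lemma ae_eq_of_primitives a b f g : intble mu `[a, b] f -> intble mu `[a, b] g ->
  (forall x, a <= x <= b ->
     \int[mu]_(t in `[a, x]) f t = \int[mu]_(t in `[a, x]) g t) ->
  {ae mu, forall x, a <= x <= b -> f x = g x}.
Proof.
move=> fi gi fg; pose h := (fun x => f x - g x) \_ `[a, b].
have hi : intble mu `[a, b] (fun x => f x - g x) by exact: intbleB.
have hT : intble mu setT h.
  by apply/(intble_mkcond mu _ (measurable_itv `[a, b])).
have F0 x : \int[mu]_(t in `]-oo, x]) h t = 0.
  rewrite /h -Rintegral_mkcondr.
  have [ab|ba] := leP a b; last first.
    by rewrite (@set_itv_ge _ _ (BLeft a)) ?bnd_simp ?leNgt ?ba// setI0 Rintegral_set0.
  have [xa|ax] := ltP x a.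
    rewrite (_ : _ `&` _ = set0) ?Rintegral_set0//.
    rewrite -subset0 => z [] /=; rewrite !in_itv /= => zx /andP[az _].
    by move: (le_lt_trans (le_trans az zx) xa); rewrite ltxx.
  pose c := Num.min x b.
  have cb : a <= c <= b by rewrite /c le_min ax ab ge_min lexx orbT.
  rewrite (_ : _ `&` _ = `[a, c]%classic); last first.
    apply/seteqP; split => z /=; rewrite !in_itv /= /c le_min.
      by move=> [-> /andP[-> ->]].
    by move=> /and3P[-> -> ->].
  have S : `[a, c] `<=` `[a, b] by apply: subset_itvl; rewrite bnd_simp; case/andP: cb.
  rewrite RintegralB//; [|by apply: intbleS fi|by apply: intbleS gi].
  by rewrite fg// subrr.
have hl := integrable_locally_restrict (measurable_itv `[a, b]) hi.
have := @FTC1Ny R h _ hl.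
have hy y : mu.-integrable `]-oo, y] (EFin \o h).
  by apply: intbleS hT.
move=> /(_ hy); apply: ae_imp => x [_].
rewrite (_ : (fun x : R => _) = cst 0); last by apply/funext => z /=; exact: F0.
rewrite derive1_cst /h restrE => + xab.
by rewrite mem_setE in_itv /= xab => /esym/eqP; rewrite subr_eq0 => /eqP.
Qed.

(** A continuous bump on [x, x + d], used instead of a smooth one because test functions are
    only required to be C^1. *)
Definition bump x d z : R := Num.max 0 ((z - x) * (x + d - z)).
Definition bump_mass x d : R := \int[mu]_(z in `[x, x + d]) bump x d z.
Definition nbump x d z : R := bump x d z / bump_mass x d.
(** Primitive of the normalized bump: a C^1 step from 0 to 1 on [x, x + d]. *)
Definition ramp x d z : R := \int[mu]_(t in `]-oo, z]) nbump x d t.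

Lemma bump_continuous x d : continuous (bump x d).
Proof.
move=> z; rewrite /bump.
under eq_fun do rewrite maxr_absE.
have c : {for z, continuous (fun z : R => (z - x) * (x + d - z) : R^o)}.
  apply: cvgM; first by apply: cvgB => //; exact: cvg_cst.
  by apply: cvgB => //; exact: cvg_cst.
apply: cvgM; last exact: cvg_cst.
apply: cvgD; first by apply: cvgD => //; exact: cvg_cst.
by apply: cvg_norm; apply: cvgB => //; exact: cvg_cst.
Qed.

Lemma bump_ge0 x d z : 0 <= bump x d z.
Proof. by rewrite le_max lexx. Qed.

Lemma bump_out x d z : 0 < d -> ~~ (x < z < x + d) -> bump x d z = 0.
Proof.
move=> d0 h; apply/max_idPl; rewrite negb_and -!leNgt in h.
by case/orP: h => h; nra.
Qed.

Lemma bump_intble x d D : 0 < d -> measurable D -> intble mu D (bump x d).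
Proof.
move=> d0 mD; apply: (intbleS measurableT) => //.
have : intble mu setT (bump x d \_ `[x, x + d]).
  apply/(intble_mkcond mu _ (measurable_itv `[x, x + d])).
  by apply: continuous_intble; apply: continuous_subspaceT; exact: bump_continuous.
apply: intble_eq => // z _; rewrite restrE mem_setE in_itv /=.
case: ifPn => // h; apply/esym/bump_out => //; apply: contra h.
by move=> /andP[/ltW -> /ltW ->].
Qed.

Lemma bump_mass_gt0 x d : 0 < d -> 0 < bump_mass x d.
Proof.
move=> d0; pose I := `[x + d / 4, x + d / 2]%classic.
have mI : measurable I by exact: measurable_itv.
have IS : I `<=` `[x, x + d] by apply: subset_itv; rewrite bnd_simp; lra.
have : \int[mu]_(z in I) (d ^+ 2 / 8) <= bump_mass x d.
  apply: (@le_trans _ _ (\int[mu]_(z in I) bump x d z)).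
    apply: le_Rintegral => //.
    - apply: (@intble_cst _ _ _ mu I (d ^+ 2 / 8)) => //.
      by rewrite /I /= lebesgue_measure_itv /=; case: ifP; rewrite ?ltry.
    - exact: bump_intble.
    - move=> z; rewrite /I /= in_itv /= /bump le_max => /andP[h1 h2].
      by apply/orP; right; nra.
  rewrite /bump_mass Rintegral_mkcond [leRHS]Rintegral_mkcond.
  apply: le_Rintegral => //.
  - by apply/(intble_mkcond mu _ (measurable_itv _)); exact: bump_intble.
  - by apply/(intble_mkcond mu _ (measurable_itv _)); exact: bump_intble.
  - move=> z _; rewrite !restrE; case: ifPn => [zI|_].
      by rewrite ifT//; rewrite inE; apply: IS; rewrite inE in zI.
    by case: ifPn => // _; exact: bump_ge0.
apply: lt_le_trans; rewrite Rintegral_cst//= /I lebesgue_measure_itv /= lte_fin ifT; last lra.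
by rewrite -EFinB /= mulr_gt0 ?divr_gt0 ?exprn_gt0//; lra.
Qed.

Lemma nbump_ge0 x d z : 0 < d -> 0 <= nbump x d z.
Proof. by move=> d0; rewrite divr_ge0 ?bump_ge0// ltW// bump_mass_gt0. Qed.

Lemma nbump_continuous x d : continuous (nbump x d).
Proof. by move=> z; apply: cvgM; [exact: bump_continuous|exact: cvg_cst]. Qed.

Lemma nbump_out x d z : 0 < d -> ~~ (x < z < x + d) -> nbump x d z = 0.
Proof. by move=> d0 h; rewrite /nbump bump_out// mul0r. Qed.

Lemma nbump_intble x d D : 0 < d -> measurable D -> intble mu D (nbump x d).
Proof.
move=> d0 mD; have := intbleZ (bump_mass x d)^-1 mD (bump_intble x d0 mD).
by apply: intble_eq => // z _; rewrite mulrC.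
Qed.

Lemma nbump_total x d : 0 < d -> \int[mu]_(z in `[x, x + d]) nbump x d z = 1.
Proof.
move=> d0; rewrite /nbump RintegralZr//; last exact: bump_intble.
by rewrite divff// gt_eqF// bump_mass_gt0.
Qed.

Lemma nbump_Rint x d (D : set R) : 0 < d -> measurable D -> `[x, x + d] `<=` D ->
  \int[mu]_(z in D) nbump x d z = 1.
Proof.
move=> d0 mD S; rewrite -(nbump_total x d0) Rintegral_mkcond [RHS]Rintegral_mkcond.
apply: eq_Rintegral => z _; rewrite !restrE; case: ifPn => zD; case: ifPn => zI //.
  apply: nbump_out => //; apply: contra zI; rewrite mem_setE in_itv /=.
  by move=> /andP[/ltW -> /ltW ->].
by move: zD; rewrite inE in zI; rewrite notin_setE => /(_ (S _ zI)).
Qed.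

Lemma ramp_left x d z : 0 < d -> z <= x -> ramp x d z = 0.
Proof.
move=> d0 zx; rewrite /ramp -[RHS](Rintegral_set0 mu (fun=> 0)).
rewrite Rintegral_mkcond [RHS]Rintegral_mkcond; apply: eq_Rintegral => t _.
rewrite !restrE in_set0; case: ifPn => //; rewrite mem_setE in_itv /= => tz.
by apply: nbump_out => //; rewrite negb_and -!leNgt (le_trans tz zx).
Qed.

Lemma ramp_right x d z : 0 < d -> x + d <= z -> ramp x d z = 1.
Proof.
move=> d0 xz; apply: nbump_Rint => // t /=; rewrite !in_itv /= => /andP[_ h].
exact: le_trans h xz.
Qed.

Lemma ramp_01 x d z : 0 < d -> 0 <= ramp x d z <= 1.
Proof.
move=> d0; apply/andP; split.
  by apply: Rintegral_ge0 => t _; exact: nbump_ge0.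
rewrite -(@nbump_Rint x d setT)// /ramp Rintegral_mkcond.
apply: le_Rintegral => //.
- by apply/(intble_mkcond mu _ (measurable_itv _)); exact: nbump_intble.
- exact: nbump_intble.
- by move=> t _; rewrite restrE; case: ifPn => // _; exact: nbump_ge0.
Qed.

Lemma ramp_derive x d z : 0 < d ->
  derivable (ramp x d) z 1 /\ (ramp x d)^`()%classic z = nbump x d z.
Proof.
move=> d0; apply: (@continuous_FTC1 R (nbump x d) -oo%O z (z + 1)).
- lra.
- exact: nbump_intble.
- by rewrite ltNyr.
- exact: nbump_continuous.
Qed.

(** A C^1 approximation of the indicator of [x, y], whose derivative is the difference of two
    approximate Dirac masses at x and y. *)
Definition trap x y d z : R := ramp x d z - ramp y d z.

Lemma trap_derive x y d z : 0 < d ->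
  derivable (trap x y d) z 1 /\ (trap x y d)^`()%classic z = nbump x d z - nbump y d z.
Proof.
move=> d0; have [h1 h2] := ramp_derive x z d0; have [h3 h4] := ramp_derive y z d0.
have -> : trap x y d = (ramp x d - ramp y d)%R by apply/funext => t.
split; first exact: derivableB.
rewrite derive1E (deriveB h1 h3); congr (_ - _); [rewrite -h2|rewrite -h4];
  by rewrite derive1E.
Qed.

Lemma trap_C1 x y d : 0 < d -> C1 (trap x y d).
Proof.
move=> d0; split; first by move=> z; have [] := trap_derive x y z d0.
rewrite (_ : _^`()%classic = fun z => nbump x d z - nbump y d z).
  by move=> z; apply: cvgB; exact: nbump_continuous.
by apply/funext => z; have [] := trap_derive x y z d0.
Qed.

Lemma trap_out x y d z : 0 < d -> x < y -> ~~ (x <= z <= y + d) -> trap x y d z = 0.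
Proof.
move=> d0 xy; rewrite negb_and -!ltNge => /orP[h|h].
  by rewrite /trap !ramp_left ?subrr//; lra.
by rewrite /trap !ramp_right ?subrr//; lra.
Qed.

Lemma trap_compact x y d (D : set R) : 0 < d -> x < y -> `[x, y + d] `<=` D ->
  compactly_supported_in D (trap x y d).
Proof.
move=> d0 xy S; exists `[x, y + d]%classic; split => //.
  exact: segment_compact.
by move=> z /= /negP; rewrite in_itv /=; exact: trap_out.
Qed.

Lemma trap_le1 x y d z : 0 < d -> `|trap x y d z| <= 1.
Proof.
move=> d0; have /andP[h1 h2] := ramp_01 x z d0; have /andP[h3 h4] := ramp_01 y z d0.
rewrite /trap; move: (ramp x d z) (ramp y d z) h1 h2 h3 h4; clear => p q *.
by rewrite ler_norml; apply/andP; split; lra.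
Qed.

Lemma trap_in x y d z : 0 < d -> x + d <= z -> z <= y -> trap x y d z = 1.
Proof. by move=> d0 xz zy; rewrite /trap ramp_right// ramp_left// subr0. Qed.

Lemma trap_left x y d z : 0 < d -> x < y -> z <= x -> trap x y d z = 0.
Proof. by move=> d0 xy zx; rewrite /trap !ramp_left ?subrr//; lra. Qed.

Lemma C1_continuous f : C1 f -> continuous f.
Proof.
by move=> [df _] x; apply: differentiable_continuous; apply/derivable1_diffP.
Qed.

Lemma C1_meas f (D : set R) : C1 f -> measurable D -> measurable_fun D f.
Proof.
move=> cf mD; apply: (measurable_funS measurableT) => //.
by apply: continuous_measurable_fun; exact: C1_continuous.
Qed.

End TestFunctions.

(** * Weak derivatives and primitives *)

Section DuBoisReymond.
Context {R : realType}.
Notation mu := (@lebesgue_measure R).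
Implicit Types (f g F G : R -> R) (a b x y d z e : R).

(** A continuous function is nearly constant on the short support of the normalized bump. *)
Lemma nbump_average a b F x d e : 0 < d -> a < x -> x + d < b ->
  {within `[a, b], continuous F} ->
  (forall z, x <= z <= x + d -> `|F z - F x| <= e) ->
  `|\int[mu]_(z in `]a, b[) (F z * nbump x d z) - F x| <= e.
Proof.
move=> d0 ax xb cF Fe.
have ab : a <= b by lra.
have mc f : {within `[a, b], continuous f} -> measurable_fun `]a, b[ f.
  by move=> /continuous_meas mf; apply: measurable_funS mf => //; exact: subset_itv_oo_cc.
have ki : intble mu `]a, b[ (nbump x d) by exact: nbump_intble.
have k1 : \int[mu]_(z in `]a, b[) nbump x d z = 1.
  by apply: nbump_Rint => //; apply: subset_itv; rewrite bnd_simp.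
have [M FM] := continuous_bounded ab cF.
have Fk : intble mu `]a, b[ (fun z => F z * nbump x d z).
  apply: (intble_mulb (M := M)) => //; first exact: mc.
  by move=> z /=; rewrite in_itv /= => /andP[/ltW az /ltW zb]; rewrite FM// az.
rewrite -[X in _ - X]mulr1 -k1 -RintegralZl// -RintegralB//; last exact: intbleZ.
have i3 : intble mu `]a, b[ (fun z => F z * nbump x d z - F x * nbump x d z).
  by apply: intbleB => //; exact: intbleZ.
apply: (le_trans (le_normr_Rintegral _ i3)) => //.
rewrite -[leRHS]mulr1 -k1 -RintegralZl//; apply: le_Rintegral => //.
- exact: (intble_abs _ i3).
- exact: intbleZ.
- move=> z _; rewrite -mulrBl normrM (ger0_norm (nbump_ge0 x z d0)).
  have [h|h] := boolP (x < z < x + d); last by rewrite nbump_out// !mulr0.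
  rewrite ler_wpM2r ?nbump_ge0//; apply: Fe; lra.
Qed.

(** Testing against the trapezoids of slope length 1 / (n + 1): the left side tends to F x - F y
    because the normalized bumps concentrate at x and y, and the right side to the integral over
    [x, y] by dominated convergence. *)
Lemma trap_limit a b F f x y : a < x -> x < y -> y < b ->
  {within `[a, b], continuous F} -> intble mu `[a, b] f ->
  (forall n, x + n.+1%:R^-1 <= y -> y + n.+1%:R^-1 < b ->
    \int[mu]_(z in `]a, b[) (F z * (trap x y n.+1%:R^-1)^`()%classic z) =
    - \int[mu]_(z in `]a, b[) (f z * trap x y n.+1%:R^-1 z)) ->
  F y - F x = \int[mu]_(z in `[x, y]) f z.
Proof.
move=> ax xy yb cF fi H.
have ab : a <= b by lra.
pose d n : R := n.+1%:R^-1.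
have d0 n : 0 < d n by rewrite invr_gt0 ltr0n.
have dlim : d n @[n --> \oo] --> 0 by exact: cvg_harmonic.
have small e : 0 < e -> \forall n \near \oo, d n < e.
  by move=> e0; apply: cvgr_lt dlim _ e0.
have avg w : a < w -> w < b ->
    \int[mu]_(z in `]a, b[) (F z * nbump w (d n) z) @[n --> \oo] --> F w.
  move=> aw wb; apply/cvgrPdist_le => e e0.
  have cw : {for w, continuous F}.
    apply: (within_continuous_continuous _ cF); first lra.
    by rewrite in_itv /= aw wb.
  have := cw => /cvgrPdist_le /(_ e e0) [r /= r0 hr].
  near=> n; rewrite distrC.
  have dn1 : d n < r by near: n; exact: small.
  have dn2 : d n < b - w by near: n; apply: small; lra.
  apply: nbump_average => //; first lra.
  move=> z /andP[wz zw]; rewrite distrC; apply: hr; rewrite /ball_ /=.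
  by rewrite ler0_norm; lra.
have E : \forall n \near \oo,
    \int[mu]_(z in `]a, b[) (F z * nbump x (d n) z) -
    \int[mu]_(z in `]a, b[) (F z * nbump y (d n) z) =
    - \int[mu]_(z in `]a, b[) (f z * trap x y (d n) z).
  near=> n.
  have dn1 : d n < y - x by near: n; apply: small; lra.
  have dn2 : d n < b - y by near: n; apply: small; lra.
  rewrite -H; [|by rewrite -lerBrDl ltW|by rewrite -ltrBrDl].
  have Fi w : intble mu `]a, b[ (fun z => F z * nbump w (d n) z).
    have [M FM] := continuous_bounded ab cF.
    apply: (intble_mulb (M := M)) => //.
    - exact: (intble_meas (intble_cc_oo (continuous_intble cF))).
    - by move=> z /=; rewrite in_itv /= => /andP[/ltW az /ltW zb]; rewrite FM// az.
    - exact: nbump_intble.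
  rewrite -(RintegralB _ (Fi x) (Fi y))//; apply: eq_Rintegral => z _.
  by rewrite (trap_derive x y z (d0 n)).2 mulrBr.
have L1 : (\int[mu]_(z in `]a, b[) (F z * nbump x (d n) z) -
    \int[mu]_(z in `]a, b[) (F z * nbump y (d n) z)) @[n --> \oo] --> F x - F y.
  by apply: cvgB; apply: avg; lra.
have foo : intble mu `]a, b[ f by exact: intble_cc_oo.
have L2 : \int[mu]_(z in `]a, b[) (f z * trap x y (d n) z) @[n --> \oo] -->
    \int[mu]_(z in `]a, b[) ((f \_ `]x, y]) z).
  apply: (@Rint_dominated _ _ R mu `]a, b[%classic (fun n z => f z * trap x y (d n) z)
    (f \_ `]x, y]) (fun z => `|f z|)) => //.
  - move=> n; apply: measurable_funM; first exact: (intble_meas foo).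
    by apply: C1_meas => //; exact: trap_C1.
  - apply/measurable_restrict => //.
    by apply: measurable_funS (intble_meas foo) => //; exact: subIsetl.
  - move=> z; rewrite /= in_itv /= => /andP[az zb].
    rewrite restrE mem_setE in_itv /=.
    have [xz|zx] := ltP x z; last first.
      apply: cvg_near_cst; near=> n.
      by rewrite trap_left ?mulr0.
    have [zy|yz] := leP z y; apply: cvg_near_cst; near=> n.
      rewrite /= trap_in ?mulr1//.
      have : d n < z - x by near: n; apply: small; lra.
      lra.
    rewrite /= trap_out ?mulr0//.
    have : d n < z - y by near: n; apply: small; lra.
    by move=> h; rewrite negb_and -!ltNge; apply/orP; right; lra.
  - by move=> n z _; rewrite normrM ler_piMr// trap_le1.
  - exact: intble_abs.
have L3 : (- \int[mu]_(z in `]a, b[) (f z * trap x y (d n) z)) @[n --> \oo] -->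
    F x - F y.
  by apply: cvg_trans L1; apply: near_eq_cvg; apply: filterS E => n ->.
have e1 := cvg_unique (@norm_hausdorff _ _) (cvgN L2) L3.
move: e1.
have -> : \int[mu]_(z in `]a, b[) ((f \_ `]x, y]) z) = \int[mu]_(z in `[x, y]) f z.
  rewrite -Rintegral_mkcondr (_ : _ `&` _ = `]x, y]%classic).
    apply: Rintegral_itv_obnd_cbnd; apply: intbleS fi => //.
    by apply: subset_itv; rewrite bnd_simp ltW.
  apply/seteqP; split => z /=; rewrite !in_itv /=; first by case.
  by move=> /andP[xz zy]; rewrite xz zy (lt_trans ax xz) (le_lt_trans zy yb).
by move=> e1; rewrite -[LHS]opprK opprB -e1 opprK.
Unshelve. all: by end_near. Qed.

End DuBoisReymond.

Section AeCountable.
Context d (X : measurableType d) (R : realType).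
Variable mu : {measure set X -> \bar R}.

Lemma ae_forall_count (I : countType) (P : I -> X -> Prop) :
  (forall i, {ae mu, forall x, P i x}) -> {ae mu, forall x, forall i, P i x}.
Proof.
move=> h; have : {ae mu, forall x, forall n : nat,
    if unpickle n is Some i then P i x else True}.
  apply/ae_foralln => n; case: (unpickle n) => [i|]; first exact: h.
  exact: aeW.
by apply: ae_imp => x hx i; have := hx (pickle i); rewrite pickleK.
Qed.

End AeCountable.

Section WeakPrimitives.
Context {R : realType}.
Notation mu := (@lebesgue_measure R).
Implicit Types (f g F G : R -> R) (a b x y d z e : R).

Lemma within_ball a b F x e : a < b -> {within `[a, b], continuous F} ->
  a <= x <= b -> 0 < e ->
  exists2 r, 0 < r & forall z, a <= z <= b -> (`|z - x| < r) -> (`|F z - F x| <= e).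
Proof.
move=> ab cF xab e0.
have xI : `[a, b]%classic x by rewrite /= in_itv.
have := (subspace_continuousP _ F).1 cF x xI => /cvgrPdist_le /(_ e e0).
rewrite near_withinE => -[r /= r0 hr]; exists r => // z zab zx.
rewrite distrC; apply: hr; last by rewrite /= in_itv.
by rewrite /ball_ /= distrC.
Qed.

(** The identity needs to be known only on rational subintervals, by continuity of both sides;
    in this form it can be verified along almost every line, where only countably many test
    functions share a null set. *)
Lemma prim_of_rat a b F f : a < b -> {within `[a, b], continuous F} ->
  intble mu `[a, b] f ->
  (forall q r : rat, a < ratr q -> ratr q < ratr r :> R -> ratr r < b ->
     F (ratr r) - F (ratr q) = \int[mu]_(z in `[ratr q, ratr r]) f z) ->
  prim a b F f.
Proof.
move=> ab cF fi H; split => //.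
pose G x := F a + \int[mu]_(t in `[a, x]) f t.
have Ga : G a = F a by rewrite /G set_itv1 Rintegral_set1 addr0.
have GG : prim a b G f by split => // x xab; rewrite Ga.
have cG := prim_continuous (ltW ab) GG.
pose D x := F x - G x.
have cD : {within `[a, b], continuous D} by move=> x; apply: cvgB; [exact: cF|exact: cG].
have Dq (q r : rat) : a < ratr q < b -> a < ratr r < b -> D (ratr q) = D (ratr r).
  wlog qr : q r / (ratr q : R) < ratr r => [hw|].
    have [h|h|h] := ltgtP (ratr q : R) (ratr r); first exact: hw.
      by move=> h1 h2; apply/esym/hw.
    by rewrite h.
  move=> /andP[aq qb] /andP[ar rb].
  have := H q r aq qr rb; rewrite -(primB GG (ltW aq) (ltW qr) (ltW rb)) /D; lra.
have [q0] := rat_in_itvoo ab; rewrite in_itv /= => q0ab.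
have Dc x : a <= x <= b -> D x = D (ratr q0).
  move=> xab; apply/eqP; rewrite -subr_eq0 -normr_le0; apply/ler_addgt0Pr => e e0.
  rewrite add0r.
  have [r r0 hr] := within_ball ab cD xab e0.
  have I : Num.max a (x - r) < Num.min b (x + r).
    by rewrite lt_min !gt_max; case/andP: xab => *; apply/andP; split; apply/andP; split; lra.
  have [q] := rat_in_itvoo I; rewrite in_itv /= gt_max lt_min => /andP[/andP[h1 h2] /andP[h3 h4]].
  rewrite -(Dq q q0) ?h1// distrC; apply: hr; first by rewrite !ltW.
  by rewrite ltr_norml; apply/andP; split; lra.
move=> x xab; have := Dc x xab; rewrite -(Dc a); last by rewrite lexx ltW.
by rewrite /D Ga subrr /G => /eqP; rewrite subr_eq0 => /eqP.
Qed.

(** Fundamental theorem for weak derivatives of continuous functions. *)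
Lemma prim_of_weak a b F f : a < b -> {within `[a, b], continuous F} ->
  intble mu `[a, b] f ->
  (forall xi, C1 xi -> compactly_supported_in `]a, b[ xi ->
      \int[mu]_(x in `]a, b[) (F x * derive1 xi x) =
      - \int[mu]_(x in `]a, b[) (f x * xi x)) ->
  prim a b F f.
Proof.
move=> ab cF fi H; apply: prim_of_rat => // q r aq qr rb.
apply: (trap_limit aq qr rb cF fi) => n h1 h2.
have d0 : 0 < n.+1%:R^-1 :> R by rewrite invr_gt0 ltr0n.
apply: H; first exact: trap_C1.
by apply: trap_compact => //; apply: subset_itv; rewrite bnd_simp.
Qed.

Lemma weak_deriv_prim a b F f : a < b -> {within `[a, b], continuous F} ->
  intble mu `]a, b[ f -> weak_deriv `]a, b[ F f -> prim a b F f.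
Proof.
by move=> ab cF fi [_ _ H]; apply: prim_of_weak => //; exact: intble_oo_cc.
Qed.

(** Absolutely continuous functions have only one derivative up to null sets. *)
Lemma prim_ae_unique a b F f g : prim a b F f -> prim a b F g ->
  {ae mu, forall x, a <= x <= b -> f x = g x}.
Proof.
move=> [fi Ff] [gi Fg]; apply: ae_eq_of_primitives => // x xab.
by apply: (addrI (F a)); rewrite -Ff// -Fg.
Qed.

Lemma prim_C1 a b F : a <= b -> C1 F -> prim a b F (derive1 F).
Proof.
rewrite le_eqVlt => /orP[/eqP <-|ab] CF.
  have i1 : intble mu `[a, a] (derive1 F).
    by apply: continuous_intble; apply: continuous_subspaceT; exact: CF.2.
  split => // x; rewrite -eq_le => /eqP <-.
  by rewrite set_itv1 Rintegral_set1 addr0.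
have c : {within `[a, b], continuous (derive1 F)}.
  by apply: continuous_subspaceT; exact: CF.2.
split; first exact: continuous_intble.
move=> x /andP[ax xb]; have [<-|xa] := eqVneq a x.
  by rewrite set_itv1 Rintegral_set1 addr0.
have ax' : a < x by rewrite lt_neqAle xa.
rewrite /Rintegral (@continuous_FTC2 R (derive1 F) F a x) //=; first by ring.
- by apply: continuous_subspaceT; exact: CF.2.
- have dF := CF.1; split => //.
  + by apply: cvg_at_right_filter; exact: (C1_continuous CF).
  + by apply: cvg_at_left_filter; exact: (C1_continuous CF).
Qed.

Lemma compact_support_out (D : set R) (xi : R -> R) x : compactly_supported_in D xi ->
  ~ D x -> xi x = 0.
Proof. by move=> [K [_ KD K0]] Dx; apply: K0 => /KD. Qed.

Lemma prim_weak_deriv a b F f : a <= b -> prim a b F f -> weak_deriv `]a, b[ F f.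
Proof.
move=> ab FF.
have cF := prim_continuous ab FF.
have iF := continuous_intble cF.
have iFo := intble_cc_oo iF; have ifo := intble_cc_oo FF.1.
have oI : open (`]a, b[%classic : set R) by exact: interval_open.
split; [exact: open_integrable_locally|exact: open_integrable_locally|].
move=> xi Ceta seta.
have eta_prim := prim_C1 ab Ceta.
have e0 x : ~~ (a < x < b) -> xi x = 0.
  by move=> h; apply: (compact_support_out seta) => /=; rewrite in_itv /=; exact/negP.
have := prim_mul ab FF eta_prim.
rewrite (e0 b) ?ltxx ?andbF// (e0 a) ?ltxx// !mulr0 subr0.
have ceta : {within `[a, b], continuous xi}.
  by apply: continuous_subspaceT; exact: C1_continuous.
have i1 : intble mu `[a, b] (fun x => f x * xi x).
  have := intble_mulc ab ceta FF.1.
  by apply: intble_eq => // x _; rewrite mulrC.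
have i2 := intble_mulc ab cF eta_prim.1.
rewrite RintD// -(Rint_oo_cc (intble_meas (intble_cc_oo i1))).
by rewrite -(Rint_oo_cc (intble_meas (intble_cc_oo i2))) => /esym/eqP; rewrite addrC addr_eq0 => /eqP.
Qed.

(** A function that annihilates all test functions is a weak derivative of the zero function. *)
Lemma ae_zero_of_test a b f : a < b -> intble mu `[a, b] f ->
  (forall xi, C1 xi -> compactly_supported_in `]a, b[ xi ->
      \int[mu]_(x in `]a, b[) (f x * xi x) = 0) ->
  {ae mu, forall x, a <= x <= b -> f x = 0}.
Proof.
move=> ab fi H.
have p0 : prim a b (cst 0) f.
  apply: prim_of_weak => //; first exact: cst_continuous.
  move=> xi Ce se; rewrite (H xi)// oppr0.
  rewrite -[RHS](Rintegral_set0 mu (fun=> 0)) Rintegral_mkcond [RHS]Rintegral_mkcond.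
  by apply: eq_Rintegral => x _; rewrite !restrE in_set0 mul0r if_same.
apply: (prim_ae_unique p0); split.
  by apply: continuous_intble; exact: cst_continuous.
move=> x _ /=; rewrite add0r -[LHS](Rintegral_set0 mu (fun=> 0)) Rintegral_mkcond [RHS]Rintegral_mkcond.
by apply: eq_Rintegral => t _; rewrite !restrE in_set0 if_same.
Qed.

End WeakPrimitives.

(** * Affine substitutions and slices of weak derivatives *)

Section AffineSubstitution.
Context {R : realType}.
Notation mu := (@lebesgue_measure R).
Variables (a l : R).
Hypothesis l0 : 0 < l.

Let phi : R -> R := fun y => a + y * l.

Let mphi : measurable_fun setT (phi : measurableTypeR R -> measurableTypeR R).
Proof.
apply: continuous_measurable_fun => y; apply: cvgD; first exact: cvg_cst.
by apply: cvgM => //; exact: cvg_cst.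
Qed.

Let pushed : {measure set (measurableTypeR R) -> \bar R} :=
  measure_function_pushforward__canonical__measure_function_Measure mu mphi.

Let l_nng : {nonneg R} := NngNum (ltW l0).

Let scaled (A : set R) : measurable A ->
  mscale l_nng pushed A = mu A.
Proof.
move=> mA; apply/esym/lebesgue_measure_unique => //= _ [[x y]] _ <-.
rewrite /mscale /= /pushforward.
have -> : phi @^-1` `]x, y] = `](x - a) / l, (y - a) / l]%classic.
  apply/seteqP; split => z /=; rewrite !in_itv /= /phi ltr_pdivrMr// ler_pdivlMr//.
    by move=> /andP[h1 h2]; apply/andP; split; lra.
  by move=> /andP[h1 h2]; apply/andP; split; lra.
rewrite !lebesgue_measure_itv /= !lte_fin ltr_pM2r ?invr_gt0// ltrD2r.
case: ifPn => _; last by rewrite mule0.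
by rewrite -!EFinB -EFinM; congr EFin; field; rewrite gt_eqF.
Qed.

(** The image of Lebesgue measure under an affine map, scaled by l, agrees with Lebesgue measure
    on intervals, hence everywhere. *)
Lemma ge0_affine_integral (f : R -> \bar R) : measurable_fun setT f ->
  (forall x, (0 <= f x)%E) ->
  (\int[mu]_x f x = l%:E * \int[mu]_y f (a + y * l)%R)%E.
Proof.
move=> mf f0.
rewrite (eq_measure_integral (mscale l_nng pushed)); last first.
  by move=> A mA _; apply/esym; exact: scaled.
by rewrite ge0_integral_mscale// ge0_integral_pushforward.
Qed.

Lemma affine_intble (f : R -> R) : intble mu setT f -> intble mu setT (fun y => f (a + y * l)).
Proof.
move=> /integrableP[mf fi]; apply/integrableP; split.
  exact: (measurableT_comp mf mphi).
have mf' : measurable_fun setT (fun x => `|(EFin \o f) x|%E) by exact: measurableT_comp.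
move: fi; rewrite (ge0_affine_integral mf') => [|x]; last exact: abse_ge0.
have fin (X : \bar R) : (0 <= X)%E -> (l%:E * X < +oo)%E -> (X < +oo)%E.
  by case: X => [r _ _|_|//]; [rewrite ltry|rewrite gt0_muley ?lte_fin].
by apply: fin; exact: integral_ge0.
Qed.

Lemma affine_Rint (f : R -> R) : intble mu setT f ->
  \int[mu]_x f x = l * \int[mu]_y f (a + y * l).
Proof.
move=> fi; have mf := intble_meas fi.
have pos (g : R -> R) : intble mu setT g -> (forall x, 0 <= g x) ->
    \int[mu]_x g x = l * \int[mu]_y g (a + y * l).
  move=> gi g0; apply: EFin_inj; rewrite EFinM !EFin_Rint//; last exact: affine_intble.
  apply: (ge0_affine_integral (f := EFin \o g)).
    exact: (measurable_int mu).
  by move=> x; rewrite lee_fin.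
have i1 : intble mu setT (fun x => `|f x|) by exact: intble_abs.
have i2 : intble mu setT (fun x => `|f x| - f x) by exact: intbleB.
have e1 := pos _ i1 (fun x => normr_ge0 _).
have e2 : \int[mu]_x (`|f x| - f x) = l * \int[mu]_y (`|f (a + y * l)| - f (a + y * l)).
  by apply: pos => // x; rewrite subr_ge0 ler_norm.
move: e2; rewrite !RintegralB//; [|exact: (affine_intble i1)|exact: affine_intble].
by rewrite e1; lra.
Qed.

End AffineSubstitution.

Section Slices.
Context {R : realType}.
Notation mu := (@lebesgue_measure R).
Notation mu2 := (mu \x mu)%E.
Implicit Types (f g : R -> R) (a b : R).

Lemma support_bounded f (D : set R) : continuous f -> compactly_supported_in D f ->
  exists M, forall x, `|f x| <= M.
Proof.
move=> cf [K [cK _ K0]].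
have := compact_bounded (continuous_compact (continuous_subspaceT cf) cK).
move=> [M [_ /(_ (Num.max (M + 1) 1))]] h; exists (Num.max (M + 1) 1) => x.
have [Kx|Kx] := pselect (K x); last by rewrite K0// normr0 le_max ler01 orbT.
by apply: h; [rewrite lt_max ltrDl ltr01|exists x].
Qed.

Lemma support_near0 (f : R -> R) (D : set R) x : compactly_supported_in D f -> ~ D x ->
  \forall z \near x, f z = 0.
Proof.
move=> [K [cK KD K0]] Dx.
have cl : closed K by apply: compact_closed => //; exact: norm_hausdorff.
have : nbhs x (~` K).
  by apply: open_nbhs_nbhs; split; [exact: closed_openC|move=> /KD].
by apply: filterS => z /K0.
Qed.

(** Applied outside the support of a test function, where products with the test function need
    no regularity of the other factor. *)
Lemma near0_derive1 (f : R -> R) x : (\forall z \near x, f z = 0) ->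
  derivable f x 1 /\ derive1 f x = 0.
Proof.
move=> f0; split.
  apply: (@near_eq_derivable _ _ _ (cst 0)); last exact: derivable_cst.
  by apply: filterS f0 => z ->.
rewrite derive1E (@near_eq_derive _ _ _ _ (cst 0)) ?derive_cst// oner_neq0.
Qed.

Lemma support_derive f (D : set R) : C1 f -> compactly_supported_in D f ->
  compactly_supported_in D (derive1 f).
Proof.
move=> Cf [K [cK KD K0]]; exists K; split => // x Kx.
have sK : compactly_supported_in K f by exists K; split.
by have [_] := near0_derive1 (support_near0 sK Kx).
Qed.

Lemma fst_meas (f : R -> R) : measurable_fun setT f ->
  measurable_fun setT (fun p : R * R => f p.1).
Proof. by move=> mf; exact: measurableT_comp mf measurable_fst. Qed.

Lemma snd_meas (f : R -> R) : measurable_fun setT f ->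
  measurable_fun setT (fun p : R * R => f p.2).
Proof. by move=> mf; exact: measurableT_comp mf measurable_snd. Qed.

(** If an identity of weak derivatives in y holds against tensor products of test functions,
    then it holds on almost every line x = constant. For one psi, the integrals over y vanish
    for almost every x; trapezoids with rational endpoints and slope lengths 1 / (n + 1) are
    countably many, so a common null set works for all of them, and trap_limit applies on each
    remaining line. The functions Vc x are the continuous representatives. *)
Lemma prim_slice a1 b1 a2 b2 (V W : R * R -> R) (Vc : R -> R -> R) :
  a1 < b1 -> a2 < b2 -> intble mu2 setT V -> intble mu2 setT W ->
  (forall xi psi, C1 xi -> C1 psi ->
    compactly_supported_in `]a1, b1[ xi -> compactly_supported_in `]a2, b2[ psi ->
    \int[mu2]_p (V p * (xi p.1 * derive1 psi p.2)) =
    - \int[mu2]_p (W p * (xi p.1 * psi p.2))) ->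
  {ae mu, forall x, a1 < x < b1 -> {within `[a2, b2], continuous (Vc x)} /\
      forall y, a2 < y < b2 -> V (x, y) = Vc x y} ->
  {ae mu, forall x, a1 < x < b1 -> prim a2 b2 (Vc x) (fun y => W (x, y))}.
Proof.
move=> ab1 ab2 Vi Wi H VVc.
have Z psi : C1 psi -> compactly_supported_in `]a2, b2[ psi ->
  {ae mu, forall x, a1 <= x <= b1 ->
     \int[mu]_y (V (x, y) * derive1 psi y + W (x, y) * psi y) = 0}.
  move=> Cpsi spsi.
  have [M psiM] := support_bounded (C1_continuous Cpsi) spsi.
  have [M' psiM'] := support_bounded Cpsi.2 (support_derive Cpsi spsi).
  pose h (p : R * R) := V p * derive1 psi p.2 + W p * psi p.2.
  have h1 : intble mu2 setT (fun p => V p * derive1 psi p.2).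
    apply: (intble_mulbr (M := M')) => //; apply: snd_meas.
    by apply: continuous_measurable_fun; exact: Cpsi.2.
  have h2 : intble mu2 setT (fun p => W p * psi p.2).
    by apply: (intble_mulbr (M := M)) => //; apply: snd_meas; exact: C1_meas.
  have hi : intble mu2 setT h by exact: intbleD.
  have vi := fubini_intble1 hi.
  apply: ae_zero_of_test => //; first exact: (intbleS measurableT _ _ vi).
  move=> xi Cxi sxi.
  have [N xiN] := support_bounded (C1_continuous Cxi) sxi.
  have mxi : measurable_fun setT xi by exact: C1_meas.
  have hxi : intble mu2 setT (fun p => xi p.1 * h p).
    by apply: (intble_mulb (M := N)) => //; exact: fst_meas.
  transitivity (\int[mu]_x (xi x * \int[mu]_y h (x, y))).
    rewrite Rintegral_mkcond; apply: eq_Rintegral => x _; rewrite restrE mulrC.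
    case: ifPn => //; rewrite notin_setE => xI.
    by rewrite (compact_support_out sxi xI) mul0r.
  transitivity (\int[mu]_x \int[mu]_y (xi x * h (x, y))).
    apply: ae_eq_Rint => //.
    - by apply: measurable_funM => //; exact: intble_meas vi.
    - exact: intble_meas (fubini_intble1 hxi).
    - have := ae_integrable1 hi; apply: ae_imp => x hx _.
      by rewrite RintegralZl.
  rewrite (fubini_Rint1 hxi).
  transitivity (\int[mu2]_p (V p * (xi p.1 * derive1 psi p.2) + W p * (xi p.1 * psi p.2))).
    by apply: eq_Rintegral => p _; rewrite /h; ring.
  rewrite RintD//.
  - by rewrite H// addNr.
  - have i : intble mu2 setT (fun p => xi p.1 * (V p * derive1 psi p.2)).
      by apply: (intble_mulb (M := N)) => //; exact: fst_meas.
    by apply: intble_eq i => // p _; ring.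
  - have i : intble mu2 setT (fun p => xi p.1 * (W p * psi p.2)).
      by apply: (intble_mulb (M := N)) => //; exact: fst_meas.
    by apply: intble_eq i => // p _; ring.
have Zall : {ae mu, forall x, forall i : rat * rat * nat, a1 <= x <= b1 ->
    let q := ratr i.1.1 in let r := ratr i.1.2 in let d := i.2.+1%:R^-1 in
    a2 < q -> q < r -> r + d < b2 ->
     \int[mu]_y (V (x, y) * derive1 (trap q r d) y + W (x, y) * trap q r d y) = 0}.
  apply: ae_forall_count => -[[q r] n] /=.
  pose d : R := n.+1%:R^-1; have d0 : 0 < d by rewrite invr_gt0 ltr0n.
  have [h|h] := boolP [&& a2 < ratr q, ratr q < ratr r :> R & ratr r + d < b2]; last first.
    by apply: aeW => x _ h1 h2 h3; move: h; rewrite h1 h2 h3.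
  have /and3P[h1 h2 h3] := h.
  have sT : compactly_supported_in `]a2, b2[ (trap (ratr q) (ratr r) d).
    by apply: trap_compact => //; apply: subset_itv; rewrite bnd_simp.
  by have := Z _ (trap_C1 _ _ d0) sT; apply: ae_imp => x hx xab _ _ _; exact: hx.
have := ae_and (ae_and Zall VVc) (ae_and (ae_integrable1 Vi) (ae_integrable1 Wi)).
apply: ae_imp => x [[Zx VVx] [Vx Wx]] xab; have [cV eV] := VVx xab.
have Wx' : intble mu `[a2, b2] (fun y => W (x, y)) by apply: intbleS Wx.
apply: prim_of_rat => // q r aq qr rb.
apply: (trap_limit aq qr rb cV Wx') => n h1 h2.
set d : R := n.+1%:R^-1; have d0 : 0 < d by rewrite invr_gt0 ltr0n.
have Ct := trap_C1 (ratr q) (ratr r) d0.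
have sT : compactly_supported_in `]a2, b2[ (trap (ratr q) (ratr r) d).
  by apply: trap_compact => //; apply: subset_itv; rewrite bnd_simp.
have sT' := support_derive Ct sT.
have [M tM] := support_bounded (C1_continuous Ct) sT.
have [M' tM'] := support_bounded Ct.2 sT'.
have e : \int[mu]_y (V (x, y) * derive1 (trap (ratr q) (ratr r) d) y +
    W (x, y) * trap (ratr q) (ratr r) d y) = 0.
  by apply: (Zx (q, r, n)) => //=; case/andP: xab => *; rewrite !ltW.
have i1 : intble mu setT (fun y => V (x, y) * derive1 (trap (ratr q) (ratr r) d) y).
  apply: (intble_mulbr (M := M')) => //.
  by apply: continuous_measurable_fun; exact: Ct.2.
have i2 : intble mu setT (fun y => W (x, y) * trap (ratr q) (ratr r) d y).
  by apply: (intble_mulbr (M := M)) => //; exact: C1_meas.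
move: e; rewrite RintD// => /eqP; rewrite addr_eq0 => /eqP e.
rewrite [LHS]Rintegral_mkcond [in RHS]Rintegral_mkcond.
transitivity (\int[mu]_y (V (x, y) * derive1 (trap (ratr q) (ratr r) d) y)).
  apply: eq_Rintegral => y _; rewrite restrE; case: ifPn => [|/negP yI].
    by rewrite mem_setE in_itv /= => /eV ->.
  by rewrite (compact_support_out sT') ?mulr0// => yI'; apply: yI; rewrite inE.
rewrite e; congr (- _); apply: eq_Rintegral => y _; rewrite restrE; case: ifPn => [//|/negP yI].
by rewrite (compact_support_out sT) ?mulr0// => yI'; apply: yI; rewrite inE.
Qed.

End Slices.

(** * Straightening the moving domain *)

Section Clamp.
Context {R : realType}.

(** Extends functions from [0, T] to the whole line by constants, which spares the side
    conditions on t in continuity and measurability arguments. *)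
Definition clamp (T t : R) : R := Num.max 0 (Num.min t T).

Lemma clamp_id T t : 0 <= t <= T -> clamp T t = t.
Proof. by move=> /andP[t0 tT]; rewrite /clamp (min_idPl tT) (max_idPr t0). Qed.

Lemma clamp_in T t : 0 <= T -> 0 <= clamp T t <= T.
Proof. by move=> T0; rewrite /clamp le_max lexx ge_max T0 ge_min lexx orbT. Qed.

Lemma clamp_continuous T : continuous (clamp T).
Proof.
move=> t; rewrite /clamp; under eq_fun do rewrite maxr_absE minr_absE.
apply: cvgM; last exact: cvg_cst.
have c : {for t, continuous (fun t : R => (t + T - `|t - T|) / 2)}.
  apply: cvgM; last exact: cvg_cst.
  apply: cvgB; first by apply: cvgD => //; exact: cvg_cst.
  by apply: cvg_norm; apply: cvgB => //; exact: cvg_cst.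
apply: cvgD; first by apply: cvgD => //; exact: cvg_cst.
by apply: cvg_norm; apply: cvgB => //; exact: cvg_cst.
Qed.

End Clamp.

Lemma comp_within_continuous (X Y Z : topologicalType) (A : set Y) (g : X -> Y)
    (f : Y -> Z) :
  continuous g -> (forall x, A (g x)) -> {within A, continuous f} ->
  continuous (f \o g).
Proof.
move=> cg Ag cf x O Of.
have h := (subspace_continuousP _ f).1 cf _ (Ag x) O Of.
have := cg x _ h; rewrite /= !nbhs_simpl /= => h'.
by apply: filterS h' => z /= hz; exact: hz.
Qed.

Lemma meas_ltr d (X : measurableType d) (R : realType) (f g : X -> R) :
  measurable_fun setT f -> measurable_fun setT g -> measurable [set p | f p < g p].
Proof.
move=> mf mg; have h := measurable_fun_ltr mf mg measurableT (Y := [set true]) I.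
by rewrite setTI in h.
Qed.

Section Transport.
Context {R : realType}.
Notation mu := (@lebesgue_measure R).
Notation mu2 := (mu \x mu)%E.
Variables (a T : R) (s : R -> R).
Hypothesis T0 : 0 < T.
Hypothesis cs : {within `[0, T], continuous s}.
Hypothesis sa : forall t, 0 <= t <= T -> a < s t.

(** Width of the moving domain at time t, continued by constants outside [0, T] so that it is
    continuous and positive on the whole line. *)
Definition len t := s (clamp T t) - a.

Lemma len_continuous : continuous len.
Proof.
move=> t; apply: cvgB; last exact: cvg_cst.
apply: (comp_within_continuous (A := `[0, T]%classic) (@clamp_continuous R T) _ cs).
by move=> x; rewrite /= in_itv /= clamp_in// ltW.
Qed.

Lemma len_id t : 0 <= t <= T -> len t = s t - a.
Proof. by move=> tT; rewrite /len clamp_id. Qed.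

Lemma len_gt0 t : 0 < len t.
Proof. by rewrite subr_gt0 sa// clamp_in// ltW. Qed.

Lemma len_lbound : exists2 m, 0 < m & forall t, m <= len t.
Proof.
have [c cI cm] := EVT_min (ltW T0) cs.
exists (s c - a); first by rewrite subr_gt0 sa//; move: cI; rewrite in_itv.
by move=> t; rewrite lerB// cm// in_itv /= clamp_in// ltW.
Qed.

Lemma len_ubound : exists M, forall t, len t <= M.
Proof.
have [c cI cm] := EVT_max (ltW T0) cs.
exists (s c - a).
by move=> t; rewrite lerB// cm// in_itv /= clamp_in// ltW.
Qed.

Lemma len_meas : measurable_fun setT len.
Proof. by apply: continuous_measurable_fun; exact: len_continuous. Qed.

(** The map (t, y) to (t, a + y len t) carries the open rectangle onto the moving domain. *)
Lemma Q_transport t y :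
  Q a T s (t, a + y * len t) <-> (0 < t < T) /\ (0 < y < 1).
Proof.
have l0 := len_gt0 t; rewrite /Q /=; split.
  move=> [tT /andP[h1 h2]]; split => //.
  have st : s t = a + len t.
    by case/andP: (tT) => *; rewrite len_id ?ltW//; ring.
  apply/andP; split.
    by move: h1; rewrite ltrDl pmulr_lgt0.
  by move: h2; rewrite st ltrD2l gtr_pMl.
move=> [tT /andP[h1 h2]]; split => //.
have st : s t = a + len t.
  by case/andP: (tT) => *; rewrite len_id ?ltW//; ring.
by rewrite st ltrDl pmulr_lgt0// h1 ltrD2l gtr_pMl.
Qed.

Lemma fst_len_meas : measurable_fun setT (fun p : R * R => len p.1).
Proof. exact: measurableT_comp len_meas measurable_fst. Qed.

Lemma Q_measurable : measurable (Q a T s).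
Proof.
have -> : Q a T s = [set p | 0 < p.1] `&` [set p | p.1 < T] `&`
   ([set p | a < p.2] `&` [set p | p.2 < a + len p.1]).
  apply/seteqP; split => -[t z]; rewrite /Q /=.
    move=> [/andP[t0 tT] /andP[h1 h2]]; split => //; split => //.
    by rewrite len_id ?ltW// addrC subrK.
  move=> [[t0 tT] [h1 h2]]; rewrite t0 tT h1; split => //.
  by move: h2; rewrite len_id ?ltW// addrC subrK.
have mf := @measurable_fst _ _ R R; have ms := @measurable_snd _ _ R R.
apply: measurableI; apply: measurableI; apply: meas_ltr => //.
by apply: measurable_funD => //; exact: fst_len_meas.
Qed.

(** A function on the moving domain in the coordinates of the rectangle, extended by zero. *)
Definition tr (f : R * R -> R) (p : R * R) : R := (f \_ (Q a T s)) (p.1, a + p.2 * len p.1).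

Lemma trE f p : tr f p =
  if (p.1, a + p.2 * len p.1) \in Q a T s then f (p.1, a + p.2 * len p.1) else 0.
Proof. exact: restrE. Qed.

Lemma tr_in f t y : 0 < t < T -> 0 < y < 1 -> tr f (t, y) = f (t, a + y * len t).
Proof.
move=> tT y01; rewrite /tr /= restrE ifT// inE; apply/Q_transport; split => //.
Qed.

Lemma tr_out f t y : ~ (0 < t < T /\ 0 < y < 1) -> tr f (t, y) = 0.
Proof.
move=> h; rewrite /tr /= restrE ifF//; apply/negP; rewrite inE.
by move/Q_transport => hq; apply: h.
Qed.

Lemma tr_meas f : measurable_fun setT (f \_ (Q a T s)) -> measurable_fun setT (tr f).
Proof.
move=> mf; apply: (measurableT_comp mf).
apply/measurable_fun_pairP; split; first exact: measurable_fst.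
apply: measurable_funD => //; apply: measurable_funM; first exact: measurable_snd.
exact: fst_len_meas.
Qed.

Let meas_abs_int (f : R * R -> R) : measurable_fun setT f ->
  measurable_fun setT (fun x : R => (\int[mu]_y `|(EFin \o f) (x, y)|)%E).
Proof.
move=> mf; have h : measurable_fun setT (abse \o (EFin \o f)).
  by apply: measurableT_comp => //; exact/measurable_EFinP.
have h0 p : (0 <= (abse \o (EFin \o f)) p)%E by exact: abse_ge0.
exact: (measurable_fun_fubini_tonelli_F (m2 := mu) _ h h0).
Qed.

(** On every line the substitution has Jacobian len t, which is bounded away from zero. *)
Lemma tr_intble f : intble mu2 setT (f \_ (Q a T s)) -> intble mu2 setT (tr f).
Proof.
move=> fi; have mf := intble_meas fi; have mtr := tr_meas mf.
have mf' : measurable_fun setT (EFin \o (f \_ (Q a T s))) by exact/measurable_EFinP.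
have mtr' : measurable_fun setT (EFin \o tr f) by exact/measurable_EFinP.
apply/(integrable12ltyP mu mu mtr').
have [m m0 lm] := len_lbound.
have := (integrable12ltyP mu mu mf').1 fi.
set I1 := (\int[mu]_x _)%E => I1fin.
have I2le : (\int[mu]_x \int[mu]_y `|(EFin \o tr f) (x, y)| <= m^-1%:E * I1)%E.
  rewrite /I1 -ge0_integralZl//; last 3 first.
  - exact: meas_abs_int.
  - by move=> x _; apply: integral_ge0.
  - by rewrite lee_fin invr_ge0 ltW.
  apply: ge0_le_integral => //.
  - by move=> x _; apply: integral_ge0.
  - exact: meas_abs_int.
  - by apply: measurable_funeM; exact: meas_abs_int.
  move=> t _.
  have mt : measurable_fun setT (fun z => `|(EFin \o (f \_ (Q a T s))) (t, z)|%E).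
    by apply: measurableT_comp => //; exact: measurableT_comp mf' (pair1_measurable t).
  rewrite (@ge0_affine_integral R a (len t) (len_gt0 t) _ mt) => [|z]; last exact: abse_ge0.
  rewrite muleA -EFinM -[leLHS]mul1e lee_wpmul2r//; first exact: integral_ge0.
  by rewrite lee_fin ler_pdivlMl ?mulr1.
apply: (le_lt_trans I2le); rewrite lte_mul_pinfty// ?lee_fin ?invr_ge0 ?ltW//.
Qed.

Lemma tr_Rint f : intble mu2 setT (f \_ (Q a T s)) ->
  \int[mu2]_p (f \_ (Q a T s)) p = \int[mu2]_p (len p.1 * tr f p).
Proof.
move=> fi; have [M lM] := len_ubound; have ti := tr_intble fi.
have lti : intble mu2 setT (fun p => len p.1 * tr f p).
  apply: (intble_mulb (M := M)) => //; first exact: fst_len_meas.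
  by move=> p _; rewrite ger0_norm// ltW// len_gt0.
rewrite -(fubini_Rint1 fi) -(fubini_Rint1 lti); apply: ae_eq_Rint => //.
- exact: intble_meas (fubini_intble1 fi).
- exact: intble_meas (fubini_intble1 lti).
- have := ae_and (ae_integrable1 fi) (ae_integrable1 ti).
  apply: ae_imp => t [ft tt] _.
  transitivity (len t * \int[mu]_y tr f (t, y)).
    exact: (@affine_Rint R a (len t) (len_gt0 t) _ ft).
  by rewrite -RintegralZl.
Qed.

End Transport.

(** * Test functions pulled back to the moving domain *)

Section TestTransport.
Context {R : realType}.
Notation mu := (@lebesgue_measure R).
Notation mu2 := (mu \x mu)%E.
Implicit Types xi psi : R -> R.

Lemma continuous_fst (f : R -> R) : continuous f -> continuous (fun p : R * R => f p.1).
Proof. by move=> cf p; apply: continuous_comp; [exact: cvg_fst|exact: cf]. Qed.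

Variables (a T : R) (s v : R -> R).
Hypothesis T0 : 0 < T.
Hypothesis cs : {within `[0, T], continuous s}.
Hypothesis sa : forall t, 0 <= t <= T -> a < s t.
Notation len := (len a T s).
Hypothesis cv : continuous v.
Hypothesis dlen : forall t, 0 < t < T -> is_derive t 1 len (v t).

Let len0 t : 0 < len t. Proof. exact: len_gt0. Qed.
Let len_neq0 t : len t != 0. Proof. by rewrite gt_eqF. Qed.
Let clen : continuous len. Proof. exact: len_continuous. Qed.

(** Dividing by len compensates for the Jacobian of the change of variables. The function len is
    differentiable on (0, T) only; near and beyond the endpoints the test function vanishes. *)
Lemma test_div xi : C1 xi -> compactly_supported_in `]0, T[ xi ->
  let zeta t := xi t / len t in
  [/\ C1 zeta, compactly_supported_in `]0, T[ zeta &
    forall t, derive1 zeta t = (derive1 xi t - xi t * v t / len t) / len t].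
Proof.
move=> Cxi sxi zeta.
have D t : derivable zeta t 1 /\
   derive1 zeta t = (derive1 xi t - xi t * v t / len t) / len t.
  have [tT|tT] := boolP (0 < t < T).
    have d1 : is_derive t 1 xi (derive1 xi t).
      by apply: DeriveDef; [exact: Cxi.1|rewrite derive1E].
    have d2 := dlen tT.
    have d3 : is_derive t 1 (fun t => (len t)^-1) (- (len t) ^- 2 *: v t).
      exact: is_deriveV.
    have d4 := is_deriveM d1 d3.
    have d5 : is_derive t 1 zeta ((derive1 xi t - xi t * v t / len t) / len t).
      apply: is_derive_eq d4 _; rewrite /GRing.scale /=; field; exact: len_neq0.
    by split; [exact: ex_derive|rewrite derive1E; exact: derive_val].
  have nz : \forall z \near t, xi z = 0.
    by apply: support_near0 sxi _; rewrite /= in_itv /=; exact/negP.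
  have [_ x1] := near0_derive1 nz.
  have nz' : \forall z \near t, zeta z = 0.
    by apply: filterS nz => z; rewrite /zeta => ->; rewrite mul0r.
  have [h1 h2] := near0_derive1 nz'; split => //.
  by rewrite h2 x1 (nbhs_singleton nz) !mul0r subrr mul0r.
split.
- split; first by move=> t; have [] := D t.
  rewrite (_ : derive1 zeta = fun t => (derive1 xi t - xi t * v t / len t) / len t).
    have cV : continuous (fun t => (len t)^-1) by move=> t; apply: cvgV => //; exact: clen.
    move=> t; apply: cvgM; last exact: cV.
    apply: cvgB; first exact: Cxi.2.
    apply: cvgM; last exact: cV.
    by apply: cvgM; [exact: C1_continuous|exact: cv].
  by apply/funext => t; have [] := D t.
- have [K [cK KD K0]] := sxi; exists K; split => // x Kx.
  by rewrite /zeta K0// mul0r.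
- by move=> t; have [] := D t.
Qed.

(** The tensor product xi (t) psi (y) in the variables (t, z) of the moving domain; these are
    the test functions for the equation. *)
Definition pulled xi psi (p : R * R) : R := xi p.1 * psi ((p.2 - a) / len p.1).

Let wcont : continuous (fun p : R * R => (p.2 - a) / len p.1).
Proof.
move=> p; apply: cvgM.
  by apply: cvgB; [exact: cvg_snd|exact: cvg_cst].
by apply: cvgV => //; exact: (continuous_fst clen).
Qed.

Let wcomp (f : R -> R) : continuous f -> continuous (fun p : R * R => f ((p.2 - a) / len p.1)).
Proof. by move=> cf p; apply: continuous_comp; [exact: wcont|exact: cf]. Qed.

Let pulled_t xi psi t z : C1 xi -> C1 psi -> compactly_supported_in `]0, T[ xi ->
  let w := (z - a) / len t in
  derivable (fun t => pulled xi psi (t, z)) t 1 /\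
  derive1 (fun t => pulled xi psi (t, z)) t =
   derive1 xi t * psi w - xi t * derive1 psi w * w * v t / len t.
Proof.
move=> Cxi Cpsi sxi w.
have [tT|tT] := boolP (0 < t < T).
  have d1 : is_derive t 1 xi (derive1 xi t).
    by apply: DeriveDef; [exact: Cxi.1|rewrite derive1E].
  have d2 := dlen tT.
  have d3 : is_derive t 1 (fun t => (len t)^-1) (- (len t) ^- 2 *: v t).
    exact: is_deriveV.
  have d4 : is_derive t 1 (fun t => (z - a) / len t) ((z - a) * (- (len t) ^- 2 *: v t)).
    exact: is_deriveZ.
  have d5 : is_derive w 1 psi (derive1 psi w).
    by apply: DeriveDef; [exact: Cpsi.1|rewrite derive1E].
  have d6 := @is_derive1_comp R psi (fun t => (z - a) / len t) t _ _ d5 d4.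
  have d7 := is_deriveM d1 d6.
  have d8 : is_derive t 1 (fun t => pulled xi psi (t, z))
     (derive1 xi t * psi w - xi t * derive1 psi w * w * v t / len t).
    apply: is_derive_eq d7 _; rewrite /GRing.scale /= /w; field; exact: len_neq0.
  by split; [exact: ex_derive|rewrite derive1E; exact: derive_val].
have nz : \forall z \near t, xi z = 0.
  by apply: support_near0 sxi _; rewrite /= in_itv /=; exact/negP.
have [_ x1] := near0_derive1 nz.
have nz' : \forall u \near t, pulled xi psi (u, z) = 0.
  by apply: filterS nz => u; rewrite /pulled /= => ->; rewrite mul0r.
have [h1 h2] := near0_derive1 nz'; split => //.
by rewrite h2 x1 (nbhs_singleton nz) !mul0r subrr.
Qed.

Let pulled_z xi psi t z : C1 psi ->
  derivable (fun z => pulled xi psi (t, z)) z 1 /\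
  derive1 (fun z => pulled xi psi (t, z)) z =
   xi t * derive1 psi ((z - a) / len t) / len t.
Proof.
move=> Cpsi; set w := (z - a) / len t.
have d1 : is_derive z 1 (fun z => (len t)^-1 * (z - a)) ((len t)^-1 * (1 - 0)).
  have d0 : is_derive z 1 (fun z : R => z - a) (1 - 0) by exact: is_deriveB.
  exact: (@is_deriveZ _ _ _ (fun z : R => z - a) (len t)^-1 z 1 (1 - 0) d0).
have d4 : is_derive z 1 (fun z => (z - a) / len t) (len t)^-1.
  rewrite (_ : (fun z => _) = (fun z => (len t)^-1 * (z - a))).
    by apply: is_derive_eq d1 _; rewrite subr0 mulr1.
  by apply/funext => u; rewrite mulrC.
have d5 : is_derive w 1 psi (derive1 psi w).
  by apply: DeriveDef; [exact: Cpsi.1|rewrite derive1E].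
have d6 := @is_derive1_comp R psi (fun z => (z - a) / len t) z _ _ d5 d4.
have d7 : is_derive z 1 (fun z => pulled xi psi (t, z)) (xi t * (derive1 psi w / len t)).
  have d8 := @is_deriveZ _ _ _ _ (xi t) z 1 _ d6.
  by apply: is_derive_eq d8 _; rewrite /GRing.scale /=; ring.
split; first exact: ex_derive.
by rewrite derive1E -mulrA; exact: derive_val.
Qed.

(** The second term comes from the motion of the front, and produces the convection term y (v /
    l) U_y in the reduced equation. *)
Lemma pulled_dt xi psi p : C1 xi -> C1 psi -> compactly_supported_in `]0, T[ xi ->
  dt (pulled xi psi) p = derive1 xi p.1 * psi ((p.2 - a) / len p.1) -
    xi p.1 * derive1 psi ((p.2 - a) / len p.1) * ((p.2 - a) / len p.1) * v p.1 / len p.1.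
Proof. by move=> h1 h2 h3; case: p => t z; have [] := pulled_t t z h1 h2 h3. Qed.

Lemma pulled_dz xi psi p : C1 psi ->
  dz (pulled xi psi) p = xi p.1 * derive1 psi ((p.2 - a) / len p.1) / len p.1.
Proof. by move=> h1; case: p => t z; have [] := pulled_z xi t z h1. Qed.

Lemma pulled_C1 xi psi : C1 xi -> C1 psi -> compactly_supported_in `]0, T[ xi ->
  C1_2 (pulled xi psi).
Proof.
move=> Cxi Cpsi sxi.
have cV : continuous (fun t => (len t)^-1) by move=> t; apply: cvgV => //; exact: clen.
split.
- by move=> [t z]; have [] := pulled_t t z Cxi Cpsi sxi.
- by move=> [t z]; have [] := pulled_z xi t z Cpsi.
- rewrite (funext (fun p => pulled_dt p Cxi Cpsi sxi)) => p.
  apply: cvgB.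
    apply: cvgM; first exact: (continuous_fst Cxi.2).
    exact: (wcomp (C1_continuous Cpsi)).
  apply: cvgM; last exact: (continuous_fst cV).
  apply: cvgM; last exact: (continuous_fst cv).
  apply: cvgM; last exact: wcont.
  apply: cvgM; first exact: (continuous_fst (C1_continuous Cxi)).
  exact: (wcomp Cpsi.2).
- rewrite (funext (fun p => pulled_dz xi p Cpsi)) => p.
  apply: cvgM; last exact: (continuous_fst cV).
  apply: cvgM; first exact: (continuous_fst (C1_continuous Cxi)).
  exact: (wcomp Cpsi.2).
Qed.

Lemma pulled_support xi psi : compactly_supported_in `]0, T[ xi ->
  compactly_supported_in (`]0, 1[%classic : set R) psi -> compactly_supported_in (Q a T s) (pulled xi psi).
Proof.
move=> [K [cK KD K0]] [L [cL LD L0]].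
pose Th (p : R * R) : R * R := (p.1, a + p.2 * len p.1).
have cTh : continuous Th.
  move=> p.
  have h1 : (fun q : R * R => q.1) q @[q --> p] --> p.1 by exact: cvg_fst.
  have h2 : (fun q : R * R => a + q.2 * len q.1) q @[q --> p] --> a + p.2 * len p.1.
    apply: cvgD; first exact: cvg_cst.
    by apply: cvgM; [exact: cvg_snd|exact: (continuous_fst clen)].
  exact: (cvg_pair h1 h2).
exists (Th @` (K `*` L)); split.
- apply: continuous_compact; last exact: compact_setX.
  exact: continuous_subspaceT.
- move=> _ [[t y] [/= Kt Ly] <-]; apply/Q_transport => //.
  by split; [have := KD _ Kt|have := LD _ Ly]; rewrite /= in_itv.
- move=> [t z] h; rewrite /pulled /=.
  have [Kt|Kt] := pselect (K t); last by rewrite K0// mul0r.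
  have [Lw|Lw] := pselect (L ((z - a) / len t)); last by rewrite (L0 _ Lw) mulr0.
  exfalso; apply: h; exists (t, (z - a) / len t) => //.
  by rewrite /Th /= divfK// addrC subrK.
Qed.

End TestTransport.

(** * The problem on the fixed interval *)

Section PrimitiveCalculus.
Context {R : realType}.
Notation mu := (@lebesgue_measure R).
Implicit Types (f g F G : R -> R) (a b c l x y : R).

Lemma prim_ae_eq a b F f g : measurable_fun `]a, b[ g ->
  {ae mu, forall x, a < x < b -> f x = g x} -> prim a b F f -> prim a b F g.
Proof.
move=> mg fg [fi Ff].
have fio := intble_cc_oo fi.
have gi : intble mu `[a, b] g.
  apply: intble_oo_cc; apply/integrableP; split; first exact/measurable_EFinP.
  have /integrableP[mf] := fio; apply: le_lt_trans.
  rewrite le_eqVlt; apply/orP; left; apply/eqP; apply: ae_eq_integral => //.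
  - by apply: measurableT_comp => //; exact/measurable_EFinP.
  - exact: measurableT_comp.
  - by apply: ae_imp fg => x h /=; rewrite in_itv /= => /h ->.
split => // x xab; rewrite Ff//; congr (_ + _).
have S : `]a, x[ `<=` `]a, b[ by apply: subset_itvl; rewrite bnd_simp; case/andP: xab.
have mf := intble_meas fio.
rewrite -!Rint_oo_cc; [|exact: measurable_funS mg|exact: measurable_funS mf].
apply: ae_eq_Rint => //; [exact: measurable_funS mf|exact: measurable_funS mg|].
by apply: ae_imp fg => z h /= /S /=; rewrite in_itv /= => /h.
Qed.

Lemma prim_eq_oo a b F f g : (forall x, a < x < b -> f x = g x) ->
  prim a b F f -> prim a b F g.
Proof.
move=> fg FF; apply: (prim_ae_eq _ _ FF); last exact: aeW.
have := intble_meas (intble_cc_oo FF.1).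
by apply: eq_measurable_fun => x; rewrite inE /= in_itv /= => /fg.
Qed.

Lemma prim_eq a b F G f : a <= b -> (forall x, a <= x <= b -> F x = G x) ->
  prim a b F f -> prim a b G f.
Proof.
move=> ab FG [fi Ff]; split => // x xab.
by rewrite -!FG ?lexx ?ab// Ff.
Qed.

Lemma primZ a b F f c : prim a b F f ->
  prim a b (fun x => c * F x) (fun x => c * f x).
Proof.
move=> [fi Ff]; split; first exact: intbleZ.
move=> x xab; rewrite Ff// mulrDr RintegralZl//.
apply: intbleS fi => //; apply: subset_itvl; rewrite bnd_simp; by case/andP: xab.
Qed.

Lemma primB_fun a b F f G g : prim a b F f -> prim a b G g ->
  prim a b (fun x => F x - G x) (fun x => f x - g x).
Proof.
move=> [fi Ff] [gi Gg]; split; first exact: intbleB.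
move=> x xab; rewrite Ff// Gg// RintegralB//; first by ring.
all: apply: intbleS fi + apply: intbleS gi.
all: rewrite //; apply: subset_itvl; rewrite bnd_simp; by case/andP: xab.
Qed.

Lemma prim_affine a l F f : 0 < l -> prim a (a + l) F f ->
  prim 0 1 (fun y => F (a + y * l)) (fun y => l * f (a + y * l)).
Proof.
move=> l0 [fi Ff].
have E c (y : R) : 0 <= y <= 1 ->
   (f \_ `[a, a + y * l]) (a + c * l) = ((fun c => f (a + c * l)) \_ `[0, y]) c.
  move=> y01; rewrite !restrE !mem_setE !in_itv /= lerDl pmulr_lge0//.
  by rewrite lerD2l ler_pM2r.
have i1 y : 0 <= y <= 1 -> intble mu `[0, y] (fun c => f (a + c * l)).
  move=> y01; apply/(intble_mkcond mu _ (measurable_itv `[0, y])).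
  have i0 : intble mu `[a, a + y * l] f.
    apply: intbleS fi => //; apply: subset_itvl; rewrite bnd_simp lerD2l.
    by rewrite ger_pMl//; case/andP: y01.
  have := affine_intble a l0 ((intble_mkcond mu f (measurable_itv `[a, a + y * l])).1 i0).
  by apply: intble_eq => // c _; rewrite E.
split; first by apply: intbleZ => //; apply: i1; rewrite lexx ler01.
move=> y y01; rewrite RintegralZl//; last exact: i1.
have yl : a <= a + y * l <= a + l.
  by case/andP: y01 => y0 y1; rewrite lerDl mulr_ge0 ?(ltW l0)//= lerD2l ger_pMl.
rewrite Ff// mul0r addr0; congr (_ + _).
rewrite Rintegral_mkcond [in RHS]Rintegral_mkcond.
rewrite (affine_Rint a l0); first by congr (_ * _); apply: eq_Rintegral => c _; exact: E.
apply/(intble_mkcond mu f (measurable_itv `[a, a + y * l])).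
apply: intbleS fi => //; apply: subset_itvl; rewrite bnd_simp.
by case/andP: yl.
Qed.

(** A primitive of a continuous function is differentiable in the interior; applied to the width
    of the domain, whose derivative turns out to be continuous. *)
Lemma prim_is_derive a b F f x : prim a b F f -> a < x < b -> continuous f ->
  is_derive x 1 F (f x).
Proof.
move=> [fi Ff] /andP[ax xb] cf.
have [d1 d2] := continuous_FTC1_closed xb fi ax (cf x).
have nF : \forall z \near x, F a + \int[mu]_(t in `[a, z]) f t = F z.
  have : x \in `]a, b[ by rewrite in_itv /= ax.
  move/near_in_itvoo; apply: filterS => z; rewrite in_itv /= => /andP[az zb].
  by rewrite -Ff// !ltW.
have d3 : is_derive x 1 (fun z => F a + \int[mu]_(t in `[a, z]) f t) (0 + f x).
  have d0 : is_derive x 1 (fun z => \int[mu]_(t in `[a, z]) f t) (f x).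
    exact: (DeriveDef d1 (etrans (esym (derive1E _ _)) d2)).
  exact: (is_deriveD (is_derive_cst (F a) x 1) d0).
rewrite add0r in d3.
apply: DeriveDef; first by apply: near_eq_derivable nF _; exact: ex_derive.
by rewrite -(near_eq_derive _ nF) ?derive_val// oner_neq0.
Qed.

End PrimitiveCalculus.

Section Reduced.
Context {R : realType}.
Notation mu := (@lebesgue_measure R).
Notation mu2 := (mu \x mu)%E.

(** What the estimates use of a solution in the fixed coordinates. U is the continuous state; UT
    is the same state cut off to zero outside the open rectangle, which makes it measurable and
    bounded; P and N stand for U_y and U_yy, also extended by zero. For almost every time Pc is
    the continuous representative of U_y, the one that satisfies the boundary conditions; red_t
    is the reduced equation along almost every line y = constant. *)
Record reduced (k a0 H T a : R) (beta phi b l v : R -> R) (U UT P N : R * R -> R) : Prop := {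
  red_l : prim 0 T l v;
  red_l_gt0 : forall t, 0 < l t;
  red_v : forall t, 0 <= t <= T -> v t = a0 * (U (t, 1) - phi (a + l t));
  red_U_y : forall t, continuous (fun y => U (t, y));
  red_UT_meas : measurable_fun setT UT;
  red_UT : forall t y, 0 < t < T -> 0 < y < 1 -> UT (t, y) = U (t, y);
  red_P_meas : measurable_fun setT P;
  red_P_sq : intble mu2 setT (fun p => P p ^+ 2);
  red_P_out : forall t y, ~ (0 < t < T /\ 0 < y < 1) -> P (t, y) = 0;
  red_N_out : forall t y, ~ (0 < t < T /\ 0 < y < 1) -> N (t, y) = 0;
  red_y : forall t, 0 < t < T -> prim 0 1 (fun y => U (t, y)) (fun y => P (t, y));
  red_yy : {ae mu, forall t, 0 < t < T -> exists Pc : R -> R,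
    [/\ prim 0 1 Pc (fun y => N (t, y)), forall y, 0 < y < 1 -> Pc y = P (t, y),
        Pc 0 = - (l t / k) * beta (b t - H * U (t, 0)) &
        Pc 1 = - (l t / k) * (U (t, 1) * v t)]};
  red_G_int : intble mu2 setT (fun p => k / l p.1 ^+ 2 * N p + p.2 * (v p.1 / l p.1) * P p);
  red_t : {ae mu, forall y, 0 < y < 1 -> prim 0 T (fun t => U (t, y))
    (fun t => k / l t ^+ 2 * N (t, y) + y * (v t / l t) * P (t, y))}
}.

End Reduced.

(** * Integrals over the moving domain *)

Section Swap.
Context {R : realType}.
Notation mu := (@lebesgue_measure R).
Notation mu2 := (mu \x mu)%E.

Lemma swap_intble (h : R * R -> R) : intble mu2 setT h ->
  intble mu2 setT (fun p => h (p.2, p.1)).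
Proof.
move=> hi; have mh : measurable_fun setT (EFin \o h) by exact: (measurable_int mu2).
have msw : measurable_fun setT (fun p : R * R => (p.2, p.1)).
  by apply: measurable_fun_pair; [exact: measurable_snd|exact: measurable_fst].
have mh' : measurable_fun setT (EFin \o (fun p => h (p.2, p.1))).
  exact: (measurableT_comp mh msw).
apply/(integrable21ltyP mu mu mh').
exact: (integrable12ltyP mu mu mh).1 hi.
Qed.

Lemma swap_Rint (h : R * R -> R) : intble mu2 setT h ->
  \int[mu2]_p h (p.2, p.1) = \int[mu2]_p h p.
Proof.
move=> hi; rewrite -(fubini_Rint1 (swap_intble hi)) -(fubini_Rint2 hi).
by apply: eq_Rintegral.
Qed.

End Swap.

Section TransportedIntegrals.
Context {R : realType}.
Notation mu := (@lebesgue_measure R).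
Notation mu2 := (mu \x mu)%E.
Variables (a T : R) (s : R -> R).
Hypothesis T0 : 0 < T.
Hypothesis cs : {within `[0, T], continuous s}.
Hypothesis sa : forall t, 0 <= t <= T -> a < s t.
Notation len := (len a T s).
Notation tr := (tr a T s).
Notation QT := (Q a T s).
Let mQ : measurable QT. Proof. exact: Q_measurable. Qed.
Let len0 t : 0 < len t. Proof. exact: len_gt0. Qed.
Let len_neq0 t : len t != 0. Proof. by rewrite gt_eqF. Qed.
Let clen : continuous len. Proof. exact: len_continuous. Qed.

(** Bounded functions and square integrable functions on the moving domain are therefore
    integrable. *)
Lemma Q_finite : (mu2 QT < +oo)%E.
Proof.
have [M lM] := len_ubound a T0 cs.
pose I1 := `]0, T[%classic : set R; pose I2 := `]a, a + M[%classic : set R.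
have S : QT `<=` I1 `*` I2.
  move=> [t z] [/= tT /andP[h1 h2]]; rewrite /I1 /I2 /= !in_itv /=; split => //.
  rewrite h1 /=; apply: (lt_le_trans h2); have := lM t.
  by case/andP: tT => t0 tT; rewrite len_id ?(ltW t0) ?(ltW tT)// => h; lra.
apply: (@le_lt_trans _ _ (mu2 (I1 `*` I2))).
  by apply: le_measure => //; rewrite inE//; apply: measurableX; exact: measurable_itv.
have -> : mu2 (I1 `*` I2) = (mu I1 * mu I2)%E.
  by apply: product_measure1E; exact: measurable_itv.
rewrite /I1 /I2 !lebesgue_measure_itv /=.
by case: ifP => _; case: ifP => _; rewrite ?mule0 ?mul0e// -?EFinB -?EFinM ltry.
Qed.

Lemma tr_mul (f g : R * R -> R) p : tr (fun q => f q * g q) p = tr f p * g (p.1, a + p.2 * len p.1).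
Proof. by rewrite !trE; case: ifPn => // _; rewrite mul0r. Qed.

(** Change of variables in the two sides of a weak formulation. *)
Lemma weak_transport (f g : R * R -> R) (M : R) : intble mu2 setT (f \_ QT) -> measurable_fun setT g ->
  (forall p, `|g p| <= M) ->
  \int[mu2]_(p in QT) (f p * g p) =
  \int[mu2]_p (len p.1 * (tr f p * g (p.1, a + p.2 * len p.1))).
Proof.
move=> fi mg gM; rewrite Rintegral_mkcond.
rewrite (tr_Rint T0 cs sa (f := fun p => f p * g p)).
  by apply: eq_Rintegral => p _; rewrite tr_mul.
have i : intble mu2 setT (fun p => (f \_ QT) p * g p).
  by apply: (intble_mulbr (M := M)).
apply: intble_eq i => // p _; rewrite !restrE; case: ifPn => // _; by rewrite mul0r.
Qed.

Lemma tr_sq_intble (f : R * R -> R) : intble mu2 setT (fun p => (f \_ QT) p ^+ 2) ->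
  intble mu2 setT (fun p => tr f p ^+ 2).
Proof.
move=> fi.
have e p : ((fun q => f q ^+ 2) \_ QT) p = (f \_ QT) p ^+ 2.
  by rewrite !restrE; case: ifPn => // _; rewrite expr0n.
have := @tr_intble R a T s T0 cs sa (fun q => f q ^+ 2).
have -> : (fun q => f q ^+ 2) \_ QT = (fun p => (f \_ QT) p ^+ 2) by apply/funext.
move=> /(_ fi); apply: intble_eq => // p _; exact: e.
Qed.

Lemma sq_Q_intble (f : R * R -> R) : measurable_fun setT (f \_ QT) ->
  intble mu2 setT (fun p => (f \_ QT) p ^+ 2) -> intble mu2 setT (f \_ QT).
Proof.
move=> mf fi; apply/(intble_mkcond mu2 f mQ).
have mfQ : measurable_fun QT f by exact: ((measurable_restrictT f mQ).2 mf).
apply: (@intble_of_sq _ _ R mu2 QT f mQ Q_finite mfQ).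
apply/(intble_mkcond mu2 _ mQ); move: fi; apply: intble_eq => // p _.
by rewrite !restrE; case: ifPn => // _; rewrite expr0n.
Qed.

Lemma L2_Q (f : R * R -> R) : Lp2 2%:E QT f ->
  measurable_fun setT (f \_ QT) /\ intble mu2 setT (fun p => (f \_ QT) p ^+ 2).
Proof.
move=> h; split; last exact: Lfun2_integrable_sqr h.
by have := sub_Lfun_mfun h; rewrite inE.
Qed.

Lemma bounded_Q_intble (f : R * R -> R) (M : R) : measurable_fun QT f -> (forall p, QT p -> `|f p| <= M) ->
  intble mu2 setT (f \_ QT).
Proof.
move=> mf fM; apply/(intble_mkcond mu2 f mQ).
apply: (le_intble (g := fun=> M)) => //; apply: intble_cst => //; exact: Q_finite.
Qed.

(** Tonelli's theorem: a uniform bound on the slices gives square integrability on the domain of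
    finite length in time. *)
Lemma slices_sq_Q (f : R * R -> R) (C : R) : measurable_fun QT f ->
  (forall t, 0 < t < T -> (L2sq `]a, s t[ (fun z => f (t, z)) <= C%:E)%E) ->
  intble mu2 setT (fun p => (f \_ QT) p ^+ 2).
Proof.
move=> mf fC.
have mfT : measurable_fun setT (f \_ QT) by exact: ((measurable_restrictT f mQ).1 mf).
pose g (p : R * R) : R := (f \_ QT) p ^+ 2.
have msq : measurable_fun setT (EFin \o g).
  by apply/measurable_EFinP; exact: measurable_funX.
apply/(integrable12ltyP mu mu msq).
have mI : measurable_fun setT (fun t => (\int[mu]_z `|(EFin \o g) (t, z)|)%E).
  have h : measurable_fun setT (abse \o (EFin \o g)) by exact: measurableT_comp.
  have h0 p : (0 <= (abse \o (EFin \o g)) p)%E by exact: abse_ge0.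
  exact: (measurable_fun_fubini_tonelli_F (m2 := mu) _ h h0).
apply: (@le_lt_trans _ _ (\int[mu]_t ((cst `|C| \_ `]0, T[) t)%:E)%E).
  apply: ge0_le_integral => //.
  - by move=> t _; apply: integral_ge0.
  - apply/measurable_EFinP/(measurable_restrictT _ _).1 => //.
  move=> t _; have [tT|tT] := boolP (0 < t < T).
    rewrite restrE mem_setE in_itv /= tT.
    apply: (@le_trans _ _ (L2sq `]a, s t[ (fun z => f (t, z)))).
      rewrite le_eqVlt; apply/orP; left; apply/eqP.
      rewrite /L2sq [RHS]integral_mkcond; apply: eq_integral => z _ /=; rewrite /g ger0_norm ?sqr_ge0//.
      rewrite restrE patchE mem_setE in_itv /=.
      have -> : ((t, z) \in QT) = (a < z < s t).
        by apply/idP/idP; rewrite inE /Q /=; [case|split].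
      by case: ifP => //; rewrite expr0n.
    by apply: (le_trans (fC _ tT)); rewrite lee_fin ler_norm.
  rewrite restrE mem_setE in_itv /= (negbTE tT).
  rewrite le_eqVlt; apply/orP; left; apply/eqP; apply: integral0_eq => z _ /=; rewrite /g.
  rewrite restrE ifF ?expr0n ?normr0//.
  by apply/negP; rewrite inE => -[] /=; rewrite (negbTE tT).
have i : intble mu setT (cst `|C| \_ `]0, T[).
  apply/(intble_mkcond mu (cst `|C|) (measurable_itv `]0, T[)).
  apply: intble_cst => //; rewrite /= lebesgue_measure_itv /=.
  by case: ifP => _; rewrite ?ltry.
by rewrite -EFin_Rint// ltry.
Qed.

Lemma rescaled_meas (psi : R -> R) : measurable_fun setT psi ->
  measurable_fun setT (fun p : R * R => psi ((p.2 - a) / len p.1)).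
Proof.
move=> mpsi; apply: (measurableT_comp mpsi); apply: measurable_funM.
  by apply: measurable_funB => //; exact: measurable_snd.
have mV : measurable_fun setT (fun t => (len t)^-1).
  by apply: continuous_measurable_fun => t; apply: cvgV => //; exact: clen.
exact: measurableT_comp mV measurable_fst.
Qed.

Lemma rescaled_back y t : (a + y * len t - a) / len t = y.
Proof. by rewrite addrAC subrr add0r mulfK. Qed.

End TransportedIntegrals.

(** * Reduction of solutions to the fixed interval *)

Section Reduction.
Context {R : realType}.
Notation mu := (@lebesgue_measure R).
Notation mu2 := (mu \x mu)%E.
Variables (a a0 H k T : R) (beta phi b : R -> R) (s0 : R) (u0 : R -> R).
Variables (s st : R -> R) (u ut uz uzz : R * R -> R).
Hypothesis T0 : 0 < T.
Hypothesis k0 : 0 < k.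
Hypothesis cphi : continuous phi.
Hypothesis sol : solution_with a a0 H k T beta phi b s0 u0 s st u ut uz uzz.
Variable B : R.
Hypothesis uB : forall p, Q a T s p -> `|u p| <= B.

Let cs := s_continuous sol.
Let sa := s_gt sol.
Notation len := (len a T s).
Notation tr := (tr a T s).
Notation QT := (Q a T s).
Let mQ : measurable QT. Proof. exact: Q_measurable. Qed.
Let len0 t : 0 < len t. Proof. exact: len_gt0. Qed.
Let len_neq0 t : len t != 0. Proof. by rewrite gt_eqF. Qed.
Let clen : continuous len. Proof. exact: len_continuous. Qed.

(** The state in fixed coordinates, continued by constants outside the closed rectangle so that
    it is continuous on the plane. *)
Definition uc (p : R * R) : R := u (clamp T p.1, a + clamp 1 p.2 * len p.1).
(** The front speed, as the continuous function given by the kinetic condition; s_t equals it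
    almost everywhere on (0, T). *)
Definition vel t : R := a0 * (uc (t, 1) - phi (a + len t)).

Lemma uc_continuous : continuous uc.
Proof.
pose g (p : R * R) := (clamp T p.1, a + clamp 1 p.2 * len p.1).
have cg : continuous g.
  move=> p.
  have h1 : (fun q : R * R => clamp T q.1) q @[q --> p] --> clamp T p.1.
    exact: (continuous_fst (@clamp_continuous R T)).
  have h2 : (fun q : R * R => a + clamp 1 q.2 * len q.1) q @[q --> p] -->
      a + clamp 1 p.2 * len p.1.
    apply: cvgD; first exact: cvg_cst.
    apply: cvgM; last exact: (continuous_fst clen).
    by apply: continuous_comp; [exact: cvg_snd|exact: clamp_continuous].
  exact: (cvg_pair h1 h2).
apply: (comp_within_continuous cg _ (u_continuous sol)) => -[t y].
rewrite /g /Qbar /=; split; first by rewrite clamp_in// ltW.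
have /andP[h0 h1] : 0 <= clamp 1 y <= 1 by rewrite clamp_in.
rewrite lerDl mulr_ge0 ?(ltW (len0 t))//= -lerBrDl.
by rewrite -[leRHS]/(len t) ger_pMl.
Qed.

Lemma uc_t y : continuous (fun t => uc (t, y)).
Proof.
move=> t; apply: (@continuous_comp _ _ _ (fun t => (t, y)) uc); last exact: uc_continuous.
by apply: (cvg_pair (@cvg_id _ (nbhs t)) (cvg_cst y)).
Qed.

Lemma uc_y t : continuous (fun y => uc (t, y)).
Proof.
move=> y; apply: (@continuous_comp _ _ _ (fun y => (t, y)) uc); last exact: uc_continuous.
by apply: (cvg_pair (cvg_cst t) (@cvg_id _ (nbhs y))).
Qed.

Lemma uc_in t y : 0 <= t <= T -> 0 <= y <= 1 -> uc (t, y) = u (t, a + y * (s t - a)).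
Proof. by move=> tT y1; rewrite /uc /= !clamp_id// len_id. Qed.

Lemma vel_continuous : continuous vel.
Proof.
move=> t; apply: cvgM; first exact: cvg_cst.
apply: cvgB; first exact: uc_t.
apply: continuous_comp; last exact: cphi.
by apply: cvgD; [exact: cvg_cst|exact: clen].
Qed.

(** The weak derivative of s equals the continuous function vel almost everywhere, so s is
    continuously differentiable on (0, T). *)
Lemma front_prim : prim 0 T s vel.
Proof.
have [_ [mst _ _] W] := s_weak_deriv sol.
have cvT : {within `[0, T], continuous vel}.
  by apply: continuous_subspaceT; exact: vel_continuous.
apply: (prim_of_weak T0 cs (continuous_intble cvT)) => xi Cxi sxi.
rewrite (W _ Cxi sxi); congr (- _); apply: ae_eq_Rint => //.
- by apply: measurable_funM => //; exact: C1_meas.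
- apply: measurable_funM; last exact: C1_meas.
  exact: (intble_meas (intble_cc_oo (continuous_intble cvT))).
have := front_speed sol; apply: ae_imp => t h /=; rewrite in_itv /= => tT.
rewrite h// /vel; have tT' : 0 <= t <= T by case/andP: tT => *; rewrite !ltW.
have e : a + (s t - a) = s t by ring.
by rewrite uc_in ?lexx ?ler01// len_id// mul1r e.
Qed.

Lemma len_prim : prim 0 T len vel.
Proof.
have [vi sv] := front_prim.
split => // t tT; rewrite !len_id ?lexx ?(ltW T0)//.
by rewrite sv//; ring.
Qed.

Lemma len_derive t : 0 < t < T -> is_derive t 1 len (vel t).
Proof. by move=> tT; apply: prim_is_derive len_prim tT vel_continuous. Qed.

Let UT := tr u.
Let P (p : R * R) : R := len p.1 * tr uz p.
Let N (p : R * R) : R := len p.1 ^+ 2 * tr uzz p.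

Let mu_Q : measurable_fun QT u. Proof. by have [[]] := u_weak_dt sol. Qed.
Let muz_Q : measurable_fun QT uz. Proof. by have [_ []] := u_weak_dz sol. Qed.

Let u_int : intble mu2 setT (u \_ QT).
Proof. exact: (bounded_Q_intble T0 cs mu_Q uB). Qed.

Let slice_sq : exists C, forall t, 0 <= t <= T ->
  (L2sq `]a, s t[ (fun z => uz (t, z)) <= C%:E)%E.
Proof. exact: uz_slice_bounded sol. Qed.

Let uz_sq : intble mu2 setT (fun p => (uz \_ QT) p ^+ 2).
Proof.
have [C hC] := slice_sq.
apply: (slices_sq_Q T0 cs muz_Q (C := C)) => t /andP[t0 tT].
by apply: hC; rewrite !ltW.
Qed.

Let muz : measurable_fun setT (uz \_ QT).
Proof. exact: (measurable_restrictT uz mQ).1 muz_Q. Qed.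

Let uz_int : intble mu2 setT (uz \_ QT).
Proof. exact: (sq_Q_intble T0 cs muz uz_sq). Qed.

Let uzz_int : intble mu2 setT (uzz \_ QT).
Proof. by have [h1 h2] := L2_Q (uzz_L2 sol); exact: (sq_Q_intble T0 cs h1 h2). Qed.

Let ut_int : intble mu2 setT (ut \_ QT).
Proof. by have [h1 h2] := L2_Q (ut_L2 sol); exact: (sq_Q_intble T0 cs h1 h2). Qed.

Let mlen1 : measurable_fun setT (fun p : R * R => len p.1).
Proof. exact: fst_len_meas. Qed.

Let P_meas : measurable_fun setT P.
Proof.
apply: measurable_funM => //; exact: (tr_meas T0 cs (intble_meas uz_int)).
Qed.

Let P_sq : intble mu2 setT (fun p => P p ^+ 2).
Proof.
have [M lM] := len_ubound a T0 cs.
apply: (intble_sqmulb (M := M)) => //.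
- exact: (tr_meas T0 cs (intble_meas uz_int)).
- by move=> p _; rewrite ger0_norm// ltW.
- exact: (tr_sq_intble T0 cs sa uz_sq).
Qed.

Let P_int : intble mu2 setT P.
Proof.
have [M lM] := len_ubound a T0 cs.
apply: (intble_mulb (M := M)) => //; first by move=> p _; rewrite ger0_norm// ltW.
exact: (tr_intble T0 cs sa uz_int).
Qed.

Let oo_cc (t c : R) : 0 < t < c -> 0 <= t <= c.
Proof. by case/andP => *; rewrite !ltW. Qed.

Let s_len t : 0 < t < T -> s t = a + len t.
Proof. by move=> /oo_cc h; rewrite len_id//; ring. Qed.

(** Uses the weak derivative on each slice, which is given for every t; the bound on the slices
    makes it square integrable. *)
Let slice_prim t : 0 < t < T -> prim 0 1 (fun y => uc (t, y)) (fun y => P (t, y)).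
Proof.
move=> tT; have tT' := oo_cc tT; have lt := @len_id R a T s t tT'.
have [C hC] := slice_sq.
have [_ [mz _ _] _] := uz_slice sol tT'.
have mz2 : measurable_fun `]a, s t[ (fun z => uz (t, z) ^+ 2) by exact: measurable_funX.
have iz2 : intble mu `]a, s t[ (fun z => uz (t, z) ^+ 2).
  apply: ge0_intble => //; first by move=> z _; exact: sqr_ge0.
  by apply: (le_lt_trans (hC _ tT')); rewrite ltry.
have iz : intble mu `]a, s t[ (fun z => uz (t, z)).
  apply: intble_of_sq => //.
  by rewrite /= lebesgue_measure_itv /=; case: ifP => _; rewrite ?ltry.
have cu : {within `[a, s t], continuous (fun z => u (t, z))}.
  apply: (@subspace_eq_continuous _ _ _ (fun z => uc (t, (z - a) / len t))).
    move=> z; rewrite inE /= in_itv /= => /andP[az zs].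
    rewrite uc_in//.
      congr (u (t, _)); rewrite -lt divfK//; ring.
    apply/andP; split; first by apply: divr_ge0; [rewrite subr_ge0|exact: ltW].
    by rewrite ler_pdivrMr// mul1r lt lerD2r.
  apply: continuous_subspaceT => z.
  apply: (@continuous_comp _ _ _ (fun z => (z - a) / len t) (fun y => uc (t, y))).
    by apply: cvgM; [apply: cvgB; [exact: cvg_id|exact: cvg_cst]|exact: cvg_cst].
  exact: uc_y.
have p1 := weak_deriv_prim (sa tT') cu iz (uz_slice sol tT').
rewrite s_len// in p1.
have p2 := prim_affine (len0 t) p1.
apply: prim_eq (prim_eq_oo _ p2) => //.
- by move=> y y01; rewrite uc_in// lt.
- by move=> y y01; rewrite /P /= tr_in.
Qed.

Let len_inv_bound : exists M, forall t, `|(len t)^-1| <= M.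
Proof.
have [m m0 lm] := len_lbound T0 cs sa; exists m^-1 => t.
by rewrite ger0_norm ?invr_ge0 ?(ltW (len0 t))// lef_pV2 ?posrE.
Qed.

Let mlenV : measurable_fun setT (fun t => (len t)^-1).
Proof. by apply: continuous_measurable_fun => t; apply: cvgV => //; exact: clen. Qed.

(** The equation that defines uzz, tested with pulled-back tensor products. *)
Let space_identity xi psi : C1 xi -> C1 psi -> compactly_supported_in `]0, T[ xi ->
  compactly_supported_in (`]0, 1[%classic : set R) psi ->
  \int[mu2]_p (tr uz p * (xi p.1 * derive1 psi p.2)) =
  - \int[mu2]_p ((len p.1 * tr uzz p) * (xi p.1 * psi p.2)).
Proof.
move=> Cxi Cpsi sxi spsi.
have [Mx xM] := support_bounded (C1_continuous Cxi) sxi.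
have [Mp pM] := support_bounded (C1_continuous Cpsi) spsi.
have [Mp' pM'] := support_bounded Cpsi.2 (support_derive Cpsi spsi).
have [Ml lM] := len_inv_bound.
have mxi : measurable_fun setT xi by exact: C1_meas.
have mpsi : measurable_fun setT psi by exact: C1_meas.
have mpsi' : measurable_fun setT (derive1 psi).
  by apply: continuous_measurable_fun; exact: Cpsi.2.
have [_ _ W] := uz_weak_dz sol.
have := W _ (pulled_C1 T0 cs sa vel_continuous len_derive Cxi Cpsi sxi)
  (pulled_support T0 cs sa sxi spsi).
rewrite (weak_transport T0 cs sa (g := dz (pulled a T s xi psi)) (M := Mx * Mp' * Ml) uz_int).
- rewrite (weak_transport T0 cs sa (g := pulled a T s xi psi) (M := Mx * Mp) uzz_int).
  + move=> E; rewrite -[LHS](_ : \int[mu2]_p (len p.1 * (tr uz p *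
      dz (pulled a T s xi psi) (p.1, a + p.2 * len p.1))) = _).
      rewrite E; congr (- _); apply: eq_Rintegral => p _.
      by rewrite /pulled /= (rescaled_back T0 sa); ring.
    apply: eq_Rintegral => p _; rewrite pulled_dz//= (rescaled_back T0 sa).
    by field.
  + apply: measurable_funM; first exact: fst_meas.
    exact: (rescaled_meas T0 cs sa).
  + by move=> p; rewrite /pulled normrM ler_pM.
- rewrite (funext (fun p => pulled_dz a T s xi p Cpsi)).
  apply: measurable_funM; last exact: (fst_meas mlenV).
  apply: measurable_funM; first exact: fst_meas.
  exact: (rescaled_meas T0 cs sa).
- by move=> p; rewrite pulled_dz// normrM ler_pM// normrM ler_pM.
Qed.

Let UT_int : intble mu2 setT UT.
Proof. exact: (tr_intble T0 cs sa u_int). Qed.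

Let in_oo (c t : R) : `]0, c[%classic t -> 0 < t < c.
Proof. by rewrite /= in_itv. Qed.

(** The convection term contains no derivative of the state until it is integrated by parts in
    y; the function y xi vanishes at both ends. *)
Let parts t c xi : 0 < t < T -> C1 xi -> compactly_supported_in (`]0, 1[%classic : set R) xi ->
  \int[mu]_y (UT (t, y) * (c * xi y) + UT (t, y) * (c * (derive1 xi y * y))) =
  \int[mu]_y (- (P (t, y) * (c * (y * xi y)))).
Proof.
move=> tT Cxi sxi; pose Y (y : R) := y * xi y.
have dY (y : R) : is_derive y 1 Y (xi y + derive1 xi y * y).
  have d1 : is_derive y 1 xi (derive1 xi y).
    by apply: DeriveDef; [exact: Cxi.1|rewrite derive1E].
  have d2 := is_deriveM (is_derive_id y 1) d1.
  by apply: is_derive_eq d2 _; rewrite /GRing.scale /=; ring.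
have eY : derive1 Y = fun y => xi y + derive1 xi y * y.
  by apply/funext => y; rewrite derive1E; have h := dY y; exact: derive_val.
have CY : C1 Y.
  split; first by move=> y; have h := dY y; exact: ex_derive.
  rewrite eY => y; apply: cvgD; first exact: C1_continuous.
  by apply: cvgM; [exact: Cxi.2|exact: cvg_id].
have pY := prim_C1 ler01 CY.
have pU := slice_prim tT.
have xi0 y : ~~ (0 < y < 1) -> xi y = 0.
  by move=> h; apply: (compact_support_out sxi) => /in_oo hh; rewrite hh in h.
have xi0' y : ~~ (0 < y < 1) -> derive1 xi y = 0.
  by move=> h; apply: (compact_support_out (support_derive Cxi sxi)) => /in_oo hh; rewrite hh in h.
have Y0 : Y 0 = 0 by rewrite /Y mul0r.
have Y1 : Y 1 = 0 by rewrite /Y xi0 ?mulr0// ltxx andbF.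
have := prim_mul ler01 pU pY; rewrite Y0 Y1 !mulr0 subrr.
have cU := prim_continuous ler01 pU; have cY := prim_continuous ler01 pY.
have i1 : intble mu `[0, 1] (fun y => P (t, y) * Y y).
  by have := intble_mulc ler01 cY pU.1; apply: intble_eq => // y _; rewrite mulrC.
have i2 := intble_mulc ler01 cU pY.1.
rewrite RintD// => /esym/eqP; rewrite addrC addr_eq0 => /eqP E.
transitivity (c * \int[mu]_(y in `[0, 1]) (uc (t, y) * derive1 Y y)).
  have i2c : intble mu `[0, 1] (fun y => c * (uc (t, y) * derive1 Y y)) by exact: intbleZ.
  have -> : c * \int[mu]_(y in `[0, 1]) (uc (t, y) * derive1 Y y) =
      \int[mu]_(y in `[0, 1]) (c * (uc (t, y) * derive1 Y y)) by rewrite RintegralZl.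
  rewrite -(Rint_oo_cc (intble_meas (intble_cc_oo i2c))).
  rewrite [RHS]Rintegral_mkcond; apply: eq_Rintegral => y _; rewrite restrE mem_setE in_itv /=.
  case: ifPn => h; last by rewrite xi0// xi0'// mul0r !mulr0 addr0.
  rewrite eY /UT tr_in// uc_in ?(oo_cc h)// ?(oo_cc tT)// len_id ?(oo_cc tT)//; ring.
have i1c : intble mu `[0, 1] (fun y => c * (P (t, y) * Y y)) by exact: intbleZ.
have i1n : intble mu `[0, 1] (fun y => - (c * (P (t, y) * Y y))) by exact: intbleN.
have e1 : c * \int[mu]_(y in `[0, 1]) (P (t, y) * Y y) =
    \int[mu]_(y in `[0, 1]) (c * (P (t, y) * Y y)) by rewrite RintegralZl.
have e2 : (- \int[mu]_(y in `[0, 1]) (c * (P (t, y) * Y y))) =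
    \int[mu]_(y in `[0, 1]) (- (c * (P (t, y) * Y y))) by rewrite RintN.
rewrite E mulrN e1 e2.
rewrite -(Rint_oo_cc (intble_meas (intble_cc_oo i1n))).
rewrite Rintegral_mkcond; apply: eq_Rintegral => y _; rewrite restrE mem_setE in_itv /=.
case: ifPn => h; first by rewrite /Y; ring.
by rewrite xi0// !mulr0 oppr0.
Qed.

Let Gf (p : R * R) : R := k * tr uzz p + p.2 * (vel p.1 / len p.1) * P p.

Let cont_supp_bounded (f : R -> R) (c : R) : continuous f ->
  compactly_supported_in `]0, c[ f ->
  measurable_fun setT f /\ exists M, forall x, `|f x| <= M.
Proof.
by move=> cf sf; split; [exact: continuous_measurable_fun|exact: support_bounded sf].
Qed.

Let supp_mul (f g : R -> R) (D : set R) : compactly_supported_in D f ->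
  compactly_supported_in D (fun x => f x * g x).
Proof. by move=> [K [h1 h2 h3]]; exists K; split => // x /h3 ->; rewrite mul0r. Qed.

Let mul12_intble (h : R * R -> R) (f g : R -> R) (M M' : R) : intble mu2 setT h ->
  measurable_fun setT f -> measurable_fun setT g ->
  (forall x, `|f x| <= M) -> (forall x, `|g x| <= M') ->
  intble mu2 setT (fun p => h p * (f p.1 * g p.2)).
Proof.
move=> hi mf mg fM gM; apply: (intble_mulbr (M := M * M')) => //.
  by apply: measurable_funM; [exact: fst_meas|exact: snd_meas].
by move=> p _; rewrite normrM ler_pM.
Qed.

(** The weak form of the reduced equation. The test function is divided by len, which cancels
    the Jacobian and leaves the derivative of psi alone against the state; the remaining terms
    combine by lemma parts. *)
Let time_identity xi psi : C1 xi -> C1 psi ->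
  compactly_supported_in (`]0, 1[%classic : set R) xi -> compactly_supported_in `]0, T[ psi ->
  \int[mu2]_p (UT p * (derive1 psi p.1 * xi p.2)) =
  - \int[mu2]_p (Gf p * (psi p.1 * xi p.2)).
Proof.
move=> Cxi Cpsi sxi spsi; pose zeta t := psi t / len t.
have [Cz sz dz'] := test_div T0 cs sa vel_continuous len_derive Cpsi spsi.
rewrite -/zeta in Cz sz dz'.
have cV : continuous (fun t => (len t)^-1) by move=> t; apply: cvgV => //; exact: clen.
pose z1 t := zeta t * (vel t / len t); pose xi1 y := derive1 xi y * y.
pose r t := psi t * (vel t / len t).
have cvl : continuous (fun t => vel t / len t).
  by move=> t; apply: cvgM; [exact: vel_continuous|exact: cV].
have cz1 : continuous z1.
  by move=> t; apply: cvgM; [exact: C1_continuous|exact: cvl].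
have cr : continuous r.
  by move=> t; apply: cvgM; [exact: C1_continuous|exact: cvl].
have cxi1 : continuous xi1 by move=> y; apply: cvgM; [exact: Cxi.2|exact: cvg_id].
have [mz1 [Mz1 z1M]] := cont_supp_bounded cz1 (supp_mul _ sz).
have [mr [Mr rM]] := cont_supp_bounded cr (supp_mul _ spsi).
have [mxi1 [Mx1 x1M]] := cont_supp_bounded cxi1 (supp_mul _ (support_derive Cxi sxi)).
have [mxi [Mx xM]] := cont_supp_bounded (C1_continuous Cxi) sxi.
have [mz [Mz zM]] := cont_supp_bounded (C1_continuous Cz) sz.
have [mz' [Mz' z'M]] := cont_supp_bounded Cz.2 (support_derive Cz sz).
have [mpsi [Mp pM]] := cont_supp_bounded (C1_continuous Cpsi) spsi.
have [mpsi' [Mp' p'M]] := cont_supp_bounded Cpsi.2 (support_derive Cpsi spsi).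
have dtE p : dt (pulled a T s zeta xi) p = derive1 zeta p.1 * xi ((p.2 - a) / len p.1) -
    z1 p.1 * xi1 ((p.2 - a) / len p.1).
  by rewrite (pulled_dt T0 sa len_derive p Cz Cxi sz) /z1 /xi1; ring.
have [_ _ W] := u_weak_dt sol.
have := W _ (pulled_C1 T0 cs sa vel_continuous len_derive Cz Cxi sz)
  (pulled_support T0 cs sa sz sxi).
have mut : measurable_fun QT ut.
  exact: ((measurable_restrictT ut mQ).2 (intble_meas ut_int)).
have muzz : measurable_fun QT uzz.
  exact: ((measurable_restrictT uzz mQ).2 (intble_meas uzz_int)).
have mpull : measurable_fun setT (pulled a T s zeta xi).
  by apply: measurable_funM; [exact: fst_meas|exact: (rescaled_meas T0 cs sa)].
have mpullQ : measurable_fun QT (pulled a T s zeta xi).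
  exact: (measurable_funS measurableT) mpull.
have heat : \int[mu2]_(p in QT) (ut p * pulled a T s zeta xi p) =
    \int[mu2]_(p in QT) ((k * uzz p) * pulled a T s zeta xi p).
  apply: ae_eq_Rint => //.
  - exact: measurable_funM.
  - by apply: measurable_funM => //; exact: measurable_funM.
  - have := heat_equation sol; apply: ae_imp => p h Qp.
    by congr (_ * _); apply/eqP; rewrite -subr_eq0 h.
rewrite -/mu2 heat.
have kuzz_int : intble mu2 setT ((fun p => k * uzz p) \_ QT).
  have := intbleZ k measurableT uzz_int; apply: intble_eq => // p _.
  by rewrite !restrE; case: ifP => // _; rewrite mulr0.
rewrite (weak_transport T0 cs sa (g := dt (pulled a T s zeta xi))
  (M := Mz' * Mx + Mz1 * Mx1) u_int); last 2 first.
- rewrite (funext dtE); apply: measurable_funB; apply: measurable_funM;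
    by [exact: fst_meas|exact: (rescaled_meas T0 cs sa)].
- move=> p; rewrite dtE (le_trans (ler_normB _ _))// lerD// normrM ler_pM//.
rewrite (weak_transport T0 cs sa (g := pulled a T s zeta xi) (M := Mz * Mx) kuzz_int)//; last first.
  by move=> p; rewrite normrM ler_pM.
move=> E0.
have trk p : tr (fun q => k * uzz q) p = k * tr uzz p.
  by rewrite !trE; case: ifP => // _; rewrite mulr0.
have i1 := mul12_intble UT_int mpsi' mxi p'M xM.
have i2 := mul12_intble UT_int mr mxi rM xM.
have i3 := mul12_intble UT_int mr mxi1 rM x1M.
have i4 := mul12_intble (tr_intble T0 cs sa uzz_int) mpsi mxi pM xM.
pose yxi y := y * xi y.
have cyxi : continuous yxi by move=> y; apply: cvgM; [exact: cvg_id|exact: C1_continuous].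
have syxi : compactly_supported_in (`]0, 1[%classic : set R) yxi.
  by have [K [h1 h2 h3]] := sxi; exists K; split => // y /h3; rewrite /yxi => ->; rewrite mulr0.
have [myxi [My yM]] := cont_supp_bounded cyxi syxi.
have i5 := mul12_intble P_int mr myxi rM yM.
have E1 : \int[mu2]_p (UT p * (derive1 psi p.1 * xi p.2)) -
   \int[mu2]_p (UT p * (r p.1 * xi p.2) + UT p * (r p.1 * xi1 p.2)) =
   - \int[mu2]_p (k * (tr uzz p * (psi p.1 * xi p.2))).
  rewrite -RintegralB//; last exact: intbleD.
  transitivity (\int[mu2]_p (len p.1 * (UT p * dt (pulled a T s zeta xi) (p.1, a + p.2 * len p.1)))).
    apply: eq_Rintegral => p _; rewrite dtE /= (rescaled_back T0 sa) dz' /z1 /r /zeta.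
    by field.
  rewrite E0; congr (- _); apply: eq_Rintegral => p _.
  rewrite trk /pulled /= (rescaled_back T0 sa) /zeta; by field.
have E2 : \int[mu2]_p (UT p * (r p.1 * xi p.2) + UT p * (r p.1 * xi1 p.2)) =
   - \int[mu2]_p (P p * (r p.1 * yxi p.2)).
  rewrite -RintN// -(fubini_Rint1 (intbleD measurableT i2 i3)).
  rewrite -(fubini_Rint1 (intbleN measurableT i5)).
  apply: eq_Rintegral => t _ /=.
  have [tT|tT] := boolP (0 < t < T); last first.
    have -> : r t = 0.
      rewrite /r (compact_support_out spsi) ?mul0r// => /in_oo h.
      by rewrite h in tT.
    by apply: eq_Rintegral => y _; rewrite !mul0r !mulr0 addr0 oppr0.
  exact: parts.
move: E1; rewrite E2 opprK => E1.
have -> : \int[mu2]_p (Gf p * (psi p.1 * xi p.2)) =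
   \int[mu2]_p (k * (tr uzz p * (psi p.1 * xi p.2))) + \int[mu2]_p (P p * (r p.1 * yxi p.2)).
  rewrite -RintD//; last exact: intbleZ.
  by apply: eq_Rintegral => p _; rewrite /Gf /r /yxi; ring.
by move: E1; lra.
Qed.

Let Gf_int : intble mu2 setT (fun p => Gf p).
Proof.
have vT : {within `[0, T], continuous (fun t => vel t / len t)}.
  apply: continuous_subspaceT => t; apply: cvgM; first exact: vel_continuous.
  by apply: cvgV => //; exact: clen.
have [M vM] := continuous_bounded (ltW T0) vT.
pose g (p : R * R) : R := (vel p.1 / len p.1) * p.2.
have mg : measurable_fun setT g.
  apply: measurable_funM; last exact: measurable_snd.
  apply: (@fst_meas _ (fun t => vel t / len t)); apply: continuous_measurable_fun => t.
  apply: cvgM; first exact: vel_continuous.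
  by apply: cvgV => //; exact: clen.
have h : intble mu2 setT (fun p => g p * P p).
  apply: (@le_intble _ _ R mu2 setT _ (fun p => M * `|P p|)) => //.
  - exact: measurable_funM.
  - move=> [t y] _; rewrite normrM.
    have [ty|ty] := pselect (0 < t < T /\ 0 < y < 1); last first.
      by rewrite /P /= tr_out// mulr0 normr0 !mulr0.
    rewrite ler_wpM2r// /g /= normrM -[leRHS]mulr1 ler_pM//.
      by apply: vM; exact: oo_cc ty.1.
    by case: ty => _ /andP[y0 y1]; rewrite ger0_norm ltW.
  - by apply: intbleZ => //; exact: intble_abs.
have := intbleD measurableT (intbleZ k measurableT (tr_intble T0 cs sa uzz_int)) h.
by apply: intble_eq => // p _; rewrite /Gf /g; ring.
Qed.

(** Here the roles of the variables are exchanged: the primitives are taken in time, along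
    almost every line y = constant. *)
Let time_slices : {ae mu, forall y, 0 < y < 1 -> prim 0 T (fun t => uc (t, y))
  (fun t => Gf (t, y))}.
Proof.
have V_int := swap_intble UT_int; have W_int := swap_intble Gf_int.
apply: (prim_slice ltr01 T0 V_int W_int (Vc := fun y t => uc (t, y))).
  move=> xi psi Cxi Cpsi sxi spsi.
  have [mxi [Mx xM]] := cont_supp_bounded (C1_continuous Cxi) sxi.
  have [mpsi [Mp pM]] := cont_supp_bounded (C1_continuous Cpsi) spsi.
  have [mpsi' [Mp' p'M]] := cont_supp_bounded Cpsi.2 (support_derive Cpsi spsi).
  have E := time_identity Cxi Cpsi sxi spsi.
  have i1 := mul12_intble UT_int mpsi' mxi p'M xM.
  have i2 := mul12_intble Gf_int mpsi mxi pM xM.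
  rewrite -(swap_Rint i1) -(swap_Rint i2) /= in E.
  transitivity (\int[mu2]_p (UT (p.2, p.1) * (derive1 psi p.2 * xi p.1))).
    by apply: eq_Rintegral => p _; rewrite (mulrC (xi _)).
  by rewrite E; congr (- _); apply: eq_Rintegral => p _; rewrite (mulrC (xi _)).
apply: aeW => y y01; split; first by apply: continuous_subspaceT; exact: uc_t.
move=> t tT; rewrite /UT /= tr_in// uc_in ?(oo_cc y01)// ?(oo_cc tT)//.
by rewrite len_id ?(oo_cc tT).
Qed.

(** The continuous representative of uz on a slice is uz itself, which is continuous on the
    closed slice for almost every t. *)
Let space_slices : {ae mu, forall t, 0 < t < T -> prim 0 1
  (fun y => uz (t, a + clamp 1 y * len t)) (fun y => len t * tr uzz (t, y))}.
Proof.
have [M lM] := len_ubound a T0 cs.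
have W_int : intble mu2 setT (fun p => len p.1 * tr uzz p).
  apply: (intble_mulb (M := M)) => //; first by move=> p _; rewrite ger0_norm// ltW.
  exact: (tr_intble T0 cs sa uzz_int).
apply: (prim_slice T0 ltr01 (tr_intble T0 cs sa uz_int) W_int
  (Vc := fun t y => uz (t, a + clamp 1 y * len t))).
  by move=> xi psi; exact: space_identity.
have := uz_slice_continuous sol; apply: ae_imp => t h tT.
split; last by move=> y y01; rewrite tr_in// clamp_id// oo_cc.
apply: continuous_subspaceT.
apply: (comp_within_continuous (g := fun y => a + clamp 1 y * len t) _ _ (h tT)).
  move=> y; apply: cvgD; first exact: cvg_cst.
  by apply: cvgM; [exact: clamp_continuous|exact: cvg_cst].
move=> y; have /andP[y0 y1] : 0 <= clamp 1 y <= 1 by rewrite clamp_in.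
rewrite /= in_itv /=; apply/andP; split; first by rewrite lerDl mulr_ge0// ltW.
by rewrite s_len// lerD2l ler_piMl// ltW.
Qed.

(** The derivatives with respect to y carry one factor len for each order. *)
Lemma solution_reduced : reduced k a0 H T a beta phi b len vel uc UT P N.
Proof.
have N_eq t y : N (t, y) = len t * (len t * tr uzz (t, y)) by rewrite /N /=; ring.
split => //.
- exact: len_prim.
- exact: uc_y.
- exact: intble_meas UT_int.
- move=> t y tT y01; rewrite /UT tr_in// uc_in ?(oo_cc y01) ?(oo_cc tT)//.
  by rewrite len_id ?(oo_cc tT).
- by move=> t y h; rewrite /P /= tr_out// mulr0.
- by move=> t y h; rewrite /N /= tr_out// mulr0.
- have h := ae_and (ae_and space_slices (flux_at_a sol)) (ae_and (flux_at_s sol) (front_speed sol)).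
  apply: ae_imp h => t [[h1 h2] [h3 h4]] tT.
  have tT' := oo_cc tT.
  have i01 : 0 <= (1 : R) <= 1 by rewrite ler01 lexx.
  have i00 : 0 <= (0 : R) <= 1 by rewrite ler01 lexx.
  have velt : st t = vel t by rewrite h4// /vel uc_in// mul1r (addrC a) !subrK s_len// addrAC subrr add0r.
  exists (fun y => len t * uz (t, a + clamp 1 y * len t)); split.
  + apply: prim_eq_oo (primZ (len t) (h1 tT)) => y _; exact/esym/N_eq.
  + by move=> y y01; rewrite /P /= tr_in// clamp_id// oo_cc.
  + rewrite clamp_id// mul0r addr0 uc_in// mul0r addr0 -h2//; field.
    by rewrite gt_eqF.
  + rewrite clamp_id// mul1r uc_in// mul1r -velt (addrC a (s t - a)) subrK -s_len//.
    rewrite -h3//; field; by rewrite gt_eqF.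
- apply: intble_eq Gf_int => // p _.
  by rewrite /Gf /N; field; rewrite len_neq0.
- apply: ae_imp time_slices => y h y01; apply: prim_eq_oo (h y01) => t tT.
  by rewrite /Gf /N /=; field; rewrite len_neq0.
Qed.

End Reduction.

(** * Estimates at a fixed time *)

Section SliceEstimates.
Context {R : realType}.
Notation mu := (@lebesgue_measure R).
Implicit Types (f g w p q n P : R -> R) (x y e : R).

Definition I01 f : R := \int[mu]_(y in `[0, 1]) f y.

Lemma itv01_fin : (mu [set` `[0%R, 1%R]] < +oo)%E.
Proof. by rewrite lebesgue_measure_itv /= lte_fin ltr01 -EFinB ltry. Qed.

Lemma I01_cst (c : R) : I01 (fun=> c) = c.
Proof.
rewrite /I01 Rintegral_cst//= lebesgue_measure_itv /= lte_fin ltr01 -EFinB /=.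
by rewrite subr0 mulr1.
Qed.

Lemma intble01_cst (c : R) : intble mu `[0, 1] (fun=> c).
Proof. by apply: intble_cst => //; exact: itv01_fin. Qed.

Lemma I01_ge0 f : (forall y, 0 <= y <= 1 -> 0 <= f y) -> 0 <= I01 f.
Proof. by move=> f0; apply: Rintegral_ge0 => y /=; rewrite in_itv => /f0. Qed.

(** Comparison is required on the open interval only, because representatives are uncontrolled
    at the endpoints. *)
Lemma I01_le f g : intble mu `[0, 1] f -> intble mu `[0, 1] g ->
  (forall y, 0 < y < 1 -> f y <= g y) -> I01 f <= I01 g.
Proof.
move=> fi gi fg; rewrite /I01.
rewrite -(Rint_oo_cc (intble_meas (intble_cc_oo fi))).
rewrite -(Rint_oo_cc (intble_meas (intble_cc_oo gi))).
apply: le_Rintegral; [by []|exact: intble_cc_oo|exact: intble_cc_oo|].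
by move=> y /=; rewrite in_itv => /fg.
Qed.

Let mI (x y : R) : measurable (`[x, y]%classic : set (measurableTypeR R)).
Proof. exact: measurable_itv. Qed.

Let primSq w p x y : prim 0 1 w p -> intble mu `[0, 1] (fun y => w y * p y) ->
  0 <= x -> x <= y -> y <= 1 ->
  `|w y ^+ 2 - w x ^+ 2| <= I01 (fun y => `|2 * (w y * p y)|).
Proof.
move=> W wpi x0 xy y1; have Wxy := primS W x0 xy y1.
have S : `[x, y] `<=` `[0, 1] by apply: subset_itv; rewrite bnd_simp.
have i2 : intble mu `[0, 1] (fun y => 2 * (w y * p y)) by exact: intbleZ.
have i3 := intbleS (mI 0 1) (mI x y) S i2.
rewrite !expr2 (prim_mul xy Wxy Wxy).
have -> : \int[mu]_(z in `[x, y]) (p z * w z + w z * p z) =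
  \int[mu]_(z in `[x, y]) (2 * (w z * p z)) by apply: eq_Rintegral => z _; ring.
apply: (le_trans (le_normr_Rintegral _ i3)) => //.
rewrite /I01 Rintegral_mkcond [leRHS]Rintegral_mkcond.
have i4 := intble_abs (mI 0 1) i2.
have i5 := intble_abs (mI x y) i3.
apply: le_Rintegral => //.
- exact: (intble_mkcond mu _ (mI x y)).1 i5.
- exact: (intble_mkcond mu _ (mI 0 1)).1 i4.
- move=> z _; rewrite !restrE; case: ifPn => [zI|_].
    by rewrite ifT//; rewrite inE; apply: S; rewrite inE in zI.
  by case: ifPn.
Qed.

(** The square of w varies by at most the integral of 2 |w p|, which Young's inequality splits
    with weight e; averaging over the base point x turns w (x)^2 into its integral. *)
Lemma trace_sq w p y e : prim 0 1 w p -> intble mu `[0, 1] (fun y => p y ^+ 2) ->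
  0 <= y <= 1 -> 0 < e ->
  w y ^+ 2 <= e * I01 (fun y => p y ^+ 2) + (1 + e^-1) * I01 (fun y => w y ^+ 2).
Proof.
move=> W p2 /andP[y0 y1] e0.
have cw := prim_continuous ler01 W.
have wpi : intble mu `[0, 1] (fun y => w y * p y) by exact: intble_mulc W.1.
have w2 : intble mu `[0, 1] (fun y => w y ^+ 2).
  have := intble_mulc ler01 cw (continuous_intble cw).
  by apply: intble_eq => // z _; rewrite expr2.
have E1 : I01 (fun y => `|2 * (w y * p y)|) <=
    e * I01 (fun y => p y ^+ 2) + e^-1 * I01 (fun y => w y ^+ 2).
  rewrite /I01 -!RintegralZl// -RintD; [|by []|exact: intbleZ|exact: intbleZ].
  apply: I01_le.
  - by apply: intble_abs => //; exact: intbleZ.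
  - by apply: intbleD => //; exact: intbleZ.
  move=> z _; have e'0 : 0 < e^-1 by rewrite invr_gt0.
  have ee : e * e^-1 = 1 by rewrite divff// gt_eqF.
  have h1 : 0 <= e * (p z - e^-1 * w z) ^+ 2 by rewrite mulr_ge0 ?sqr_ge0// ltW.
  have h2 : 0 <= e * (p z + e^-1 * w z) ^+ 2 by rewrite mulr_ge0 ?sqr_ge0// ltW.
  have eq1 : e * (p z - e^-1 * w z) ^+ 2 = e * p z ^+ 2 + e^-1 * w z ^+ 2 - 2 * (w z * p z).
    by field; rewrite gt_eqF.
  have eq2 : e * (p z + e^-1 * w z) ^+ 2 = e * p z ^+ 2 + e^-1 * w z ^+ 2 + 2 * (w z * p z).
    by field; rewrite gt_eqF.
  by rewrite ler_norml; apply/andP; split; lra.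
have E2 x : 0 < x < 1 -> w y ^+ 2 <= w x ^+ 2 + I01 (fun y => `|2 * (w y * p y)|).
  move=> /andP[x0 x1]; rewrite -lerBlDl; apply: le_trans (ler_norm _) _.
  have [xy|yx] := leP x y; first exact: primSq (ltW x0) xy y1.
  by rewrite distrC; apply: primSq (ltW yx) (ltW x1).
have := I01_le (intble01_cst (w y ^+ 2)) (intbleD (mI 0 1) w2 (intble01_cst _)) E2.
have -> : I01 (fun x => w x ^+ 2 + I01 (fun y => `|2 * (w y * p y)|)) =
    I01 (fun y => w y ^+ 2) + I01 (fun y => `|2 * (w y * p y)|).
  by rewrite {1}/I01 RintD//; [rewrite -[X in _ + X]/(I01 _) I01_cst|exact: intble01_cst].
rewrite I01_cst => E3; apply: (le_trans E3); apply: le_trans (lerD (lexx _) E1) _.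
by rewrite mulrDl mul1r; lra.
Qed.

(** Young's inequality with weights adapted to the three dangerous products. The product w1 w P
    involves a boundary value and the unbounded P: the weight 1 / (A + 1), with A the integral
    of P^2, makes the integral of w1^2 P^2 / (A + 1) at most w1^2, at the price of the factor A
    + 1 in front of w^2. *)
Let slice_pointwise (kap M sig k1 d nu ee w1 y p P w A : R) :
  0 < kap -> 0 < M -> kap <= k1 -> `|d| <= M * `|sig| -> `|nu| <= M ->
  `|ee| <= M * (`|w1| + `|sig|) -> 0 < y < 1 -> 0 <= A ->
  - (p * (k1 * p + d * P)) + w * (y * (nu * p + ee * P)) <=
  - (kap / 2) * p ^+ 2 + ((M ^+ 2 / kap + M / 2) * sig ^+ 2 + w1 ^+ 2 / (A + 1)) * P ^+ 2 +
   (M ^+ 2 / kap + M / 2 + M ^+ 2 / 4 * (A + 1)) * w ^+ 2.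
Proof.
move=> kap0 M0 kk dM nuM eM /andP[y0 y1] A0.
have A10 : 0 < A + 1 by lra.
have hp := normr_ge0 p; have hP := normr_ge0 P; have hw := normr_ge0 w.
have hs := normr_ge0 sig; have hw1 := normr_ge0 w1.
have b1 : - (d * p * P) <= M * (`|sig| * `|p| * `|P|).
  apply: (le_trans (ler_norm _)); rewrite normrN !normrM.
  have -> : M * (`|sig| * `|p| * `|P|) = M * `|sig| * `|p| * `|P| by ring.
  by rewrite !ler_wpM2r.
have c1 : w * (y * (nu * p)) <= M * (`|w| * `|p|).
  apply: (le_trans (ler_norm _)); rewrite !normrM (gtr0_norm y0).
  have -> : `|w| * (y * (`|nu| * `|p|)) = y * `|nu| * (`|w| * `|p|) by ring.
  rewrite ler_wpM2r ?mulr_ge0// -[leRHS]mul1r ler_pM// ltW//.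
have d1 : w * (y * (ee * P)) <= M * (`|w1| + `|sig|) * (`|w| * `|P|).
  apply: (le_trans (ler_norm _)); rewrite !normrM (gtr0_norm y0).
  have -> : `|w| * (y * (`|ee| * `|P|)) = y * `|ee| * (`|w| * `|P|) by ring.
  rewrite ler_wpM2r ?mulr_ge0// -[leRHS]mul1r ler_pM// ltW//.
rewrite -(real_normK (num_real p)) -(real_normK (num_real P)) -(real_normK (num_real w)).
rewrite -(real_normK (num_real sig)) -(real_normK (num_real w1)).
have a1 : - (k1 * p ^+ 2) <= - (kap * `|p| ^+ 2).
  by rewrite real_normK ?num_real// lerN2 ler_wpM2r// sqr_ge0.
(* b2 and c2 each spend a quarter of the diffusion kap |p|^2 *)
have b2 : 0 <= kap * (`|p| / 2 - M / kap * (`|sig| * `|P|)) ^+ 2.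
  by rewrite mulr_ge0 ?sqr_ge0// ltW.
have c2 : 0 <= kap * (`|p| / 2 - M / kap * `|w|) ^+ 2 by rewrite mulr_ge0 ?sqr_ge0// ltW.
have d2 : 0 <= M / 2 * (`|w| - `|sig| * `|P|) ^+ 2.
  by rewrite mulr_ge0 ?sqr_ge0//; lra.
have d3 : 0 <= (A + 1) * (`|w1| * `|P| / (A + 1) - M / 2 * `|w|) ^+ 2.
  by rewrite mulr_ge0 ?sqr_ge0// ltW.
have eb : kap * (`|p| / 2 - M / kap * (`|sig| * `|P|)) ^+ 2 =
  kap / 4 * `|p| ^+ 2 - M * (`|sig| * `|p| * `|P|) + M ^+ 2 / kap * (`|sig| ^+ 2 * `|P| ^+ 2).
  by field; rewrite gt_eqF.
have ec : kap * (`|p| / 2 - M / kap * `|w|) ^+ 2 =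
  kap / 4 * `|p| ^+ 2 - M * (`|w| * `|p|) + M ^+ 2 / kap * `|w| ^+ 2.
  by field; rewrite gt_eqF.
have ed : M / 2 * (`|w| - `|sig| * `|P|) ^+ 2 =
  M / 2 * `|w| ^+ 2 + M / 2 * (`|sig| ^+ 2 * `|P| ^+ 2) - M * `|sig| * (`|w| * `|P|) by field.
have ed3 : (A + 1) * (`|w1| * `|P| / (A + 1) - M / 2 * `|w|) ^+ 2 =
  `|w1| ^+ 2 / (A + 1) * `|P| ^+ 2 - M * `|w1| * (`|w| * `|P|) +
  M ^+ 2 / 4 * (A + 1) * `|w| ^+ 2.
  by field; rewrite gt_eqF.
rewrite eb in b2; rewrite ec in c2; rewrite ed in d2; rewrite ed3 in d3.
have -> : - (p * (k1 * p + d * P)) + w * (y * (nu * p + ee * P)) =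
  - (k1 * p ^+ 2) + - (d * p * P) + w * (y * (nu * p)) + w * (y * (ee * P)) by ring.
have -> : - (kap / 2) * `|p| ^+ 2 +
   ((M ^+ 2 / kap + M / 2) * `|sig| ^+ 2 + `|w1| ^+ 2 / (A + 1)) * `|P| ^+ 2 +
   (M ^+ 2 / kap + M / 2 + M ^+ 2 / 4 * (A + 1)) * `|w| ^+ 2 =
   - (kap / 2 * `|p| ^+ 2) + M ^+ 2 / kap * (`|sig| ^+ 2 * `|P| ^+ 2) +
   M / 2 * (`|sig| ^+ 2 * `|P| ^+ 2) + `|w1| ^+ 2 / (A + 1) * `|P| ^+ 2 +
   M ^+ 2 / kap * `|w| ^+ 2 + M / 2 * `|w| ^+ 2 + M ^+ 2 / 4 * (A + 1) * `|w| ^+ 2 by ring.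
have ed1 : M * (`|w1| + `|sig|) * (`|w| * `|P|) =
  M * `|w1| * (`|w| * `|P|) + M * `|sig| * (`|w| * `|P|) by ring.
have ek : kap / 2 * `|p| ^+ 2 = 2 * (kap / 4 * `|p| ^+ 2) by field.
have ek4 : kap * `|p| ^+ 2 = 4 * (kap / 4 * `|p| ^+ 2) by field.
rewrite ed1 in d1; rewrite ek4 in a1; rewrite ek.
move: a1 b1 b2 c1 c2 d1 d2 d3; lra.
Qed.

Let abs_mul_le (x y : R) : `|x| * `|y| <= (x ^+ 2 + y ^+ 2) / 2.
Proof.
rewrite -(real_normK (num_real x)) -(real_normK (num_real y)).
have := sqr_ge0 (`|x| - `|y|); lra.
Qed.

Let slice_boundary (M w1 w0 sig del q1 q0 : R) : 0 < M ->
  `|q1| <= M * (`|w1| + `|sig|) -> `|q0| <= M * (`|w0| + `|sig| + `|del|) ->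
  w1 * q1 - w0 * q0 + M * `|sig| * (`|w1| + `|sig|) <=
  3 * M * w1 ^+ 2 + 2 * M * w0 ^+ 2 + 4 * M * sig ^+ 2 + M * del ^+ 2.
Proof.
move=> M0 h1 h0.
have b1 : w1 * q1 <= `|w1| * (M * (`|w1| + `|sig|)).
  by apply: (le_trans (ler_norm _)); rewrite normrM ler_wpM2l.
have b0 : - (w0 * q0) <= `|w0| * (M * (`|w0| + `|sig| + `|del|)).
  by apply: (le_trans (ler_norm _)); rewrite normrN normrM ler_wpM2l.
have e1 : `|w1| * `|w1| = w1 ^+ 2 by rewrite -expr2 real_normK ?num_real.
have e0 : `|w0| * `|w0| = w0 ^+ 2 by rewrite -expr2 real_normK ?num_real.
have es : `|sig| * `|sig| = sig ^+ 2 by rewrite -expr2 real_normK ?num_real.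
have m1 := ler_wpM2l (ltW M0) (abs_mul_le w1 sig).
have m2 := ler_wpM2l (ltW M0) (abs_mul_le w0 sig).
have m3 := ler_wpM2l (ltW M0) (abs_mul_le w0 del).
have x1 : `|w1| * (M * (`|w1| + `|sig|)) = M * w1 ^+ 2 + M * (`|w1| * `|sig|).
  by rewrite -e1; ring.
have x0 : `|w0| * (M * (`|w0| + `|sig| + `|del|)) =
  M * w0 ^+ 2 + M * (`|w0| * `|sig|) + M * (`|w0| * `|del|).
  by rewrite -e0; ring.
have xs : M * `|sig| * (`|w1| + `|sig|) = M * (`|w1| * `|sig|) + M * sig ^+ 2.
  by rewrite -es; ring.
have p1 := mulr_ge0 (ltW M0) (sqr_ge0 w1).
have p0 := mulr_ge0 (ltW M0) (sqr_ge0 w0).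
have ps := mulr_ge0 (ltW M0) (sqr_ge0 sig).
have pd := mulr_ge0 (ltW M0) (sqr_ge0 del).
rewrite xs; rewrite x1 in b1; rewrite x0 in b0.
move: b1 b0 m1 m2 m3 p1 p0 ps pd; lra.
Qed.

(** The difference of two reduced equations at a fixed time, tested with the difference w of the
    states: p is its derivative, q the difference of the fluxes, P the derivative of the second
    state; d and ee are the differences of the diffusion and convection coefficients. Half of
    the diffusion absorbs the products in the interior, and half of what remains absorbs the
    boundary values through trace_sq. The additional term on the left-hand side is what the
    equation for sig contributes to the total energy. *)
Lemma slice_stability (kap M : R) : 0 < kap -> 0 < M -> exists2 C, 0 < C &
  forall w p q n P (k1 d nu ee sig del : R),
  prim 0 1 w p -> prim 0 1 q n ->
  measurable_fun (`[0, 1]%classic : set R) p ->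
  measurable_fun (`[0, 1]%classic : set R) P -> intble mu `[0, 1] (fun y => p y ^+ 2) ->
  intble mu `[0, 1] (fun y => P y ^+ 2) ->
  (forall y, 0 < y < 1 -> q y = k1 * p y + d * P y) ->
  kap <= k1 -> `|d| <= M * `|sig| -> `|nu| <= M -> `|ee| <= M * (`|w 1| + `|sig|) ->
  `|q 1| <= M * (`|w 1| + `|sig|) -> `|q 0| <= M * (`|w 0| + `|sig| + `|del|) ->
  I01 (fun y => w y * (n y + y * (nu * p y + ee * P y))) +
    M * `|sig| * (`|w 1| + `|sig|) <=
  - (kap / 4) * I01 (fun y => p y ^+ 2) +
   C * ((1 + I01 (fun y => P y ^+ 2)) * (I01 (fun y => w y ^+ 2) + sig ^+ 2) + del ^+ 2).
Proof.
move=> kap0 M0; pose s1 := 1 + 5 * M; have s10 : 0 < s1 by rewrite /s1; lra.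
(* s1 bounds the total weight of the squared boundary values, so the trace inequality with
   this e costs a quarter of kap times the dissipation *)
pose e := kap / (4 * s1); have e0 : 0 < e by rewrite divr_gt0//; lra.
have ie0 : 0 < e^-1 by rewrite invr_gt0.
have Mk : 0 < M ^+ 2 / kap by rewrite divr_gt0// exprn_gt0.
have M2 : 0 < M ^+ 2 by rewrite exprn_gt0.
have se : 0 < s1 * (1 + e^-1) by rewrite mulr_gt0//; lra.
pose C := M ^+ 2 / kap + M / 2 + M ^+ 2 / 4 + 4 * M + s1 * (1 + e^-1).
have C1 : 0 <= C - (M ^+ 2 / kap + M / 2 + M ^+ 2 / 4 + s1 * (1 + e^-1)).
  by rewrite /C; lra.
have C2 : 0 <= C - M ^+ 2 / 4 by rewrite /C; lra.
have C3 : 0 <= C - 4 * M by rewrite /C; lra.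
have C4 : 0 <= C - (M ^+ 2 / kap + M / 2) by rewrite /C; lra.
have C5 : 0 <= C - M by rewrite /C; lra.
have k1' : 0 <= 1 + 3 * M by lra.
have k2' : 0 <= 2 * M by lra.
have es : (1 + 3 * M) + 2 * M = s1 by rewrite /s1; ring.
exists C; first by lra.
move=> w p q n P k1 d nu ee sig del W Qn mp mP p2 P2 qE kk dM nuM eM q1M q0M.
have cw := prim_continuous ler01 W; have cq := prim_continuous ler01 Qn.
have mw : measurable_fun (`[0, 1]%classic : set R) w by exact: continuous_meas.
have m01 := mI 0 1.
have w2 : intble mu `[0, 1] (fun y => w y ^+ 2).
  have := intble_mulc ler01 cw (continuous_intble cw).
  by apply: intble_eq => // z _; rewrite expr2.
have wn : intble mu `[0, 1] (fun y => w y * n y) := intble_mulc ler01 cw Qn.1.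
have pq : intble mu `[0, 1] (fun y => p y * q y).
  by have := intble_mulc ler01 cq W.1; apply: intble_eq => // z _; rewrite mulrC.
have Pi : intble mu `[0, 1] P by apply: intble_of_sq => //; exact: itv01_fin.
have R_int : intble mu `[0, 1] (fun y => w y * (y * (nu * p y + ee * P y))).
  have i1 : intble mu `[0, 1] (fun y => nu * p y + ee * P y).
    by apply: intbleD => //; apply: intbleZ => //; exact: W.1.
  have cwy : {within `[0, 1], continuous (fun y => w y * y)}.
    by move=> y; apply: cvgM; [exact: cw|apply: continuous_subspaceT => z; exact: cvg_id].
  by have := intble_mulc ler01 cwy i1; apply: intble_eq => // z _; rewrite mulrA.
set Ap := I01 (fun y => p y ^+ 2); set A := I01 (fun y => P y ^+ 2).
set Aw := I01 (fun y => w y ^+ 2).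
have Ap0 : 0 <= Ap by apply: I01_ge0 => y _; exact: sqr_ge0.
have A0 : 0 <= A by apply: I01_ge0 => y _; exact: sqr_ge0.
have Aw0 : 0 <= Aw by apply: I01_ge0 => y _; exact: sqr_ge0.
have split1 : I01 (fun y => w y * (n y + y * (nu * p y + ee * P y))) =
    I01 (fun y => w y * n y) + I01 (fun y => w y * (y * (nu * p y + ee * P y))).
  by rewrite /I01 -RintD//; apply: eq_Rintegral => y _; ring.
have byparts : w 1 * q 1 - w 0 * q 0 = I01 (fun y => p y * q y) + I01 (fun y => w y * n y).
  by rewrite (prim_mul ler01 W Qn) RintD.
have split2 : I01 (fun y => w y * (y * (nu * p y + ee * P y))) - I01 (fun y => p y * q y) =
    I01 (fun y => - (p y * q y) + w y * (y * (nu * p y + ee * P y))).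
  rewrite /I01 -RintegralB//; apply: eq_Rintegral => y _; ring.
(* coefficients of P^2 and w^2 in slice_pointwise *)
pose c2 := (M ^+ 2 / kap + M / 2) * sig ^+ 2 + w 1 ^+ 2 / (A + 1).
pose c3 := M ^+ 2 / kap + M / 2 + M ^+ 2 / 4 * (A + 1).
have i_1 : intble mu `[0, 1] (fun y => - (kap / 2) * p y ^+ 2) by exact: intbleZ.
have i_2 : intble mu `[0, 1] (fun y => c2 * P y ^+ 2) by exact: intbleZ.
have i_3 : intble mu `[0, 1] (fun y => c3 * w y ^+ 2) by exact: intbleZ.
have i_12 : intble mu `[0, 1] (fun y => - (kap / 2) * p y ^+ 2 + c2 * P y ^+ 2).
  exact: intbleD.
have bound : I01 (fun y => - (p y * q y) + w y * (y * (nu * p y + ee * P y))) <=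
    - (kap / 2) * Ap + c2 * A + c3 * Aw.
  have -> : - (kap / 2) * Ap + c2 * A + c3 * Aw =
     I01 (fun y => - (kap / 2) * p y ^+ 2 + c2 * P y ^+ 2 + c3 * w y ^+ 2).
    by rewrite /Ap /A /Aw /I01 -!RintegralZl// -!RintD.
  apply: I01_le.
  - by apply: intbleD => //; exact: intbleN.
  - exact: intbleD.
  - by move=> y y01; rewrite qE//; exact: slice_pointwise.
have bdry := slice_boundary M0 q1M q0M.
have t1 : w 1 ^+ 2 <= e * Ap + (1 + e^-1) * Aw.
  by apply: trace_sq => //; rewrite ler01 lexx.
have t0 : w 0 ^+ 2 <= e * Ap + (1 + e^-1) * Aw.
  by apply: trace_sq => //; rewrite ler01 lexx.
have w1A : w 1 ^+ 2 / (A + 1) * A <= w 1 ^+ 2.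
  have A1 : 0 < A + 1 by rewrite ltr_wpDl.
  by rewrite mulrAC ler_pdivrMr// ler_wpM2l ?sqr_ge0// lerDl.
have h3 : s1 * (e * Ap + (1 + e^-1) * Aw) = kap / 4 * Ap + s1 * (1 + e^-1) * Aw.
  rewrite /e; field; rewrite gt_eqF//=; rewrite gt_eqF//.
have ht : (1 + 3 * M) * w 1 ^+ 2 + 2 * M * w 0 ^+ 2 <= s1 * (e * Ap + (1 + e^-1) * Aw).
  by have := lerD (ler_wpM2l k1' t1) (ler_wpM2l k2' t0); rewrite -mulrDl es.
rewrite h3 in ht.
have X1 := mulr_ge0 C1 Aw0; have X2 := mulr_ge0 C2 (mulr_ge0 A0 Aw0).
have X3 := mulr_ge0 C3 (sqr_ge0 sig); have X4 := mulr_ge0 C4 (mulr_ge0 A0 (sqr_ge0 sig)).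
have X5 := mulr_ge0 C5 (sqr_ge0 del).
rewrite split1.
have eq0 : I01 (fun y => w y * n y) + I01 (fun y => w y * (y * (nu * p y + ee * P y))) =
  (w 1 * q 1 - w 0 * q 0) +
  I01 (fun y => - (p y * q y) + w y * (y * (nu * p y + ee * P y))).
  by rewrite byparts -split2; ring.
rewrite eq0.
have Cx : C * ((1 + A) * (Aw + sig ^+ 2) + del ^+ 2) =
  C * Aw + C * (A * Aw) + C * sig ^+ 2 + C * (A * sig ^+ 2) + C * del ^+ 2 by ring.
rewrite Cx.
have bx : - (kap / 2) * Ap + c2 * A + c3 * Aw =
  - (kap / 2) * Ap + (M ^+ 2 / kap + M / 2) * (A * sig ^+ 2) + w 1 ^+ 2 / (A + 1) * A +
  (M ^+ 2 / kap + M / 2 + M ^+ 2 / 4) * Aw + M ^+ 2 / 4 * (A * Aw).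
  by rewrite /c2 /c3; ring.
rewrite bx in bound.
move: bound bdry w1A ht X1 X2 X3 X4 X5; clear; lra.
Qed.

End SliceEstimates.

(** * Gronwall's inequality and the energy identity *)

Section TimeEstimates.
Context {R : realType}.
Notation mu := (@lebesgue_measure R).
Notation mu2 := (mu \x mu)%E.

(** Gronwall's inequality when the weight g is merely integrable. On a time interval on which
    the integral of g is at most 1/2, the maximum of Y is at most twice the sum of its initial
    value and the increment of D; the induction on n crosses as many such intervals as the total
    integral of g requires. Only the increments of Y enter, so Y need not be differentiable, and
    no exponential of the integral of g has to be differentiated. *)
Lemma gronwall (T : R) (Y g D : R -> R) : 0 < T -> {within `[0, T], continuous Y} ->
  (forall t, 0 <= t <= T -> 0 <= Y t) -> intble mu `[0, T] g -> (forall t, 0 <= g t) ->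
  0 <= D 0 -> (forall t1 t2, 0 <= t1 -> t1 <= t2 -> t2 <= T -> D t1 <= D t2) ->
  (forall t1 t2, 0 <= t1 -> t1 <= t2 -> t2 <= T ->
    Y t2 - Y t1 <= \int[mu]_(x in `[t1, t2]) (Y x * g x) + (D t2 - D t1)) ->
  forall (n : nat) t, 0 <= t <= T -> \int[mu]_(x in `[0, t]) g x <= n%:R / 2 ->
  Y t <= 4 ^+ n * (Y 0 + D t).
Proof.
move=> T0 cY Y0 gi g0 D0 Dle H.
pose Ga t := \int[mu]_(x in `[0, t]) g x.
have GaP : prim 0 T Ga g.
  by split => // x _; rewrite /Ga set_itv1 Rintegral_set1 add0r.
have cGa := prim_continuous (ltW T0) GaP.
have Ga0 : Ga 0 = 0 by rewrite /Ga set_itv1 Rintegral_set1.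
have Gale t1 t2 : 0 <= t1 -> t1 <= t2 -> t2 <= T -> Ga t1 <= Ga t2.
  move=> h1 h2 h3; rewrite -subr_ge0 (primB GaP h1 h2 h3).
  by apply: Rintegral_ge0 => x _; exact: g0.
have step t1 t2 m : 0 <= t1 -> t1 <= t2 -> t2 <= T ->
    (forall x, t1 <= x <= t2 -> Y x <= m) ->
    Y t2 - Y t1 <= m * (Ga t2 - Ga t1) + (D t2 - D t1).
  move=> h1 h2 h3 Ym; apply: (le_trans (H _ _ h1 h2 h3)); rewrite lerD2r.
  rewrite (primB GaP h1 h2 h3).
  have S : `[t1, t2] `<=` `[0, T] by apply: subset_itv; rewrite bnd_simp.
  have i1 : intble mu `[t1, t2] g by apply: intbleS gi.
  have i2 : intble mu `[t1, t2] (fun x => Y x * g x).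
    by apply: intbleS (intble_mulc (ltW T0) cY gi).
  rewrite -RintegralZl//; apply: le_Rintegral => //; first exact: intbleZ.
  by move=> x /=; rewrite in_itv /= => xI; rewrite ler_wpM2r// Ym.
elim=> [t /andP[t0 tT] Gt|n IH t /andP[t0 tT] Gt].
  have S0 : `[0, t] `<=` `[0, T] by apply: subset_itvl; rewrite bnd_simp.
  have [c cI cM] := EVT_max t0 (continuous_subspaceW S0 cY).
  have Yc : 0 <= Y c.
    by apply: Y0; move: cI; rewrite in_itv /= => /andP[-> h]; rewrite (le_trans h).
  have cM' x : 0 <= x <= t -> Y x <= Y c by move=> xI; apply: cM; rewrite in_itv.
  have := step 0 t (Y c) (lexx _) t0 tT cM'; rewrite Ga0 subr0 => h.
  have : Y c * Ga t <= 0 by rewrite mulr_ge0_le0//; move: Gt; rewrite mul0r.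
  by rewrite expr0 mul1r; lra.
have [le|lt] := leP (Ga t) (n%:R / 2).
  have := IH t _ le; rewrite t0 => /(_ tT) h; apply: (le_trans h).
  have Dt : 0 <= D t by apply: (le_trans D0); apply: Dle.
  have Y00 : 0 <= Y 0 by apply: Y0; rewrite lexx ltW.
  by rewrite exprS ler_wpM2r ?addr_ge0// ler_peMl ?exprn_ge0//; lra.
have cGt : {within `[0, t], continuous Ga}.
  by apply: continuous_subspaceW cGa; apply: subset_itvl; rewrite bnd_simp.
have n0 : 0 <= (n%:R : R) / 2 by rewrite divr_ge0.
(* the last step starts at a time t' at which the first n steps are used up *)
have : exists2 c, c \in `[0, t] & Ga c = n%:R / 2.
  apply: IVT => //; rewrite Ga0 ge_min le_max n0 /=; apply/orP; right; exact: ltW.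
move=> [t' t'I Gt']; move: t'I; rewrite in_itv /= => /andP[t'0 t't].
have cY' : {within `[t', t], continuous Y}.
  by apply: continuous_subspaceW cY; apply: subset_itv; rewrite bnd_simp.
(* Y r is the maximum on [t', t]; the integral of g there is at most 1/2 *)
have [r rI rM] := EVT_max t't cY'; move: rI; rewrite in_itv /= => /andP[t'r rt].
have YtM : Y t <= Y r by apply: rM; rewrite in_itv /= t't lexx.
have h0 := step t' r (Y r) t'0 t'r (le_trans rt tT).
have {h0}h1 : Y r - Y t' <= Y r * (Ga r - Ga t') + (D r - D t').
  apply: h0 => x /andP[h2 h3]; apply: rM; rewrite in_itv /= h2 /=; exact: le_trans h3 rt.
have Yr0 : 0 <= Y r.
  by apply: Y0; rewrite (le_trans t'0 t'r) (le_trans rt tT).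
have h2 : Ga r - Ga t' <= 2^-1.
  rewrite Gt' lerBlDl; apply: (le_trans (Gale r t (le_trans t'0 t'r) rt tT)).
  apply: (le_trans Gt); rewrite -natr1; lra.
have h3 := ler_wpM2l Yr0 h2.
have h4 : Y t' <= 4 ^+ n * (Y 0 + D t').
  by apply: IH; rewrite ?t'0 ?(le_trans t't tT)// -Gt'.
have Dt' : D t' <= D t by exact: Dle.
have Drt : D r <= D t by apply: Dle => //; exact: le_trans t'0 t'r.
have D't : 0 <= D t' by apply: (le_trans D0); apply: Dle => //; exact: le_trans t't tT.
have Y00 : 0 <= Y 0 by apply: Y0; rewrite lexx ltW.
have p1 : 1 <= 4 ^+ n :> R by rewrite exprn_ege1//; lra.
have h5 : 4 ^+ n * (Y 0 + D t') <= 4 ^+ n * (Y 0 + D t).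
  by rewrite ler_wpM2l ?lerD2l//; lra.
have h6 : Y 0 + D t <= 4 ^+ n * (Y 0 + D t).
  by rewrite ler_peMl//; lra.
rewrite exprS -mulrA; move: h1 h3 h4 h5 h6; lra.
Qed.

(** For almost every y the function W (., y)^2 is absolutely continuous with derivative 2 W g;
    integrating over y and exchanging the integrals gives the energy identity. The truncated
    state WT replaces W in the double integral because it is measurable and bounded on the whole
    plane. *)
Lemma energy_prim (T B : R) (W WT g : R * R -> R) : 0 < T ->
  (forall t, continuous (fun y => W (t, y))) ->
  measurable_fun setT WT -> (forall p, `|WT p| <= B) ->
  (forall t y, 0 < t < T -> 0 < y < 1 -> WT (t, y) = W (t, y)) ->
  intble mu2 setT g -> (forall t y, ~ (0 < t < T /\ 0 < y < 1) -> g (t, y) = 0) ->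
  {ae mu, forall y, 0 < y < 1 -> prim 0 T (fun t => W (t, y)) (fun t => g (t, y))} ->
  prim 0 T (fun t => I01 (fun y => W (t, y) ^+ 2))
    (fun t => \int[mu]_y (2 * (WT (t, y) * g (t, y)))).
Proof.
move=> T0 cW mWT WTB WTW gi g0 gp.
pose h (p : R * R) : R := 2 * (WT p * g p).
have hi : intble mu2 setT h by apply: intbleZ => //; apply: (intble_mulb (M := B)).
have Ji := fubini_intble1 hi.
split; first by apply: intbleS Ji.
move=> t /andP[t0 tT].
(* indicator of the times up to t *)
pose chi (x : R) : R := if x <= t then 1 else 0.
have mchi : measurable_fun setT (fun p : R * R => chi p.1).
  by apply: measurable_fun_ifT => //; apply: measurable_fun_ler => //; exact: measurable_fst.
have hti : intble mu2 setT (fun p => chi p.1 * h p).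
  apply: (intble_mulb (M := 1)) => // p _; rewrite /chi.
  by case: ifP => _; rewrite ?normr1 ?normr0.
have W2i u : intble mu `[0, 1] (fun y => W (u, y) ^+ 2).
  rewrite (_ : (fun y => _) = fun y => W (u, y) * W (u, y)); last first.
    by apply/funext => y; rewrite expr2.
  by apply: continuous_intble; apply: continuous_subspaceT => y; apply: cvgM; exact: cW.
have E1 : I01 (fun y => W (t, y) ^+ 2) - I01 (fun y => W (0, y) ^+ 2) =
    \int[mu]_y \int[mu]_x (chi x * h (x, y)).
  rewrite /I01 -RintegralB; [|by []|exact: W2i|exact: W2i].
  have mf : measurable_fun (`]0, 1[%classic : set R) (fun y => W (t, y) ^+ 2 - W (0, y) ^+ 2).
    exact: (intble_meas (intble_cc_oo (intbleB _ (W2i t) (W2i 0)))).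
  rewrite -Rint_oo_cc// Rintegral_mkcond; apply: ae_eq_Rint => //.
  - exact: ((measurable_restrictT _ (measurable_itv _)).1 mf).
  - exact: intble_meas (fubini_intble2 hti).
  - apply: ae_imp gp => y gy _; rewrite restrE mem_setE in_itv /=.
    case: ifPn => [y01|y01]; last first.
      rewrite -[LHS](Rintegral_set0 mu (fun=> 0)) Rintegral_mkcond.
      apply: eq_Rintegral => x _; rewrite restrE in_set0 /h g0 ?mulr0//.
      by move=> [_ hh]; rewrite hh in y01.
    have Wp := primS (gy y01) (lexx _) t0 tT.
    rewrite !expr2 (prim_mul t0 Wp Wp) Rintegral_mkcond; apply: eq_Rintegral => x _.
    rewrite restrE mem_setE in_itv /= /chi /h.
    have [x0T|x0T] := pselect (0 < x < T /\ 0 < y < 1); last first.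
      by rewrite (g0 _ _ x0T) mul0r !mulr0 addr0 if_same.
    have [xT _] := x0T; rewrite WTW//; case/andP: (xT) => x0 _.
    by rewrite ltW//=; case: ifP => _; rewrite ?mul0r//; ring.
have E2 : \int[mu]_y \int[mu]_x (chi x * h (x, y)) = \int[mu]_(x in `[0, t]) \int[mu]_y h (x, y).
  rewrite (fubini_Rint2 hti) -(fubini_Rint1 hti) [RHS]Rintegral_mkcond.
  apply: ae_eq_Rint => //.
  - exact: intble_meas (fubini_intble1 hti).
  - apply: ((measurable_restrictT _ (measurable_itv _)).1 _).
    by apply: measurable_funS (intble_meas Ji).
  - have := ae_integrable1 hi; apply: ae_imp => x hx _.
    rewrite restrE mem_setE in_itv /=.
    have -> : \int[mu]_y (chi x * h (x, y)) = chi x * \int[mu]_y h (x, y) by rewrite RintegralZl.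
    rewrite /chi; have [x0|x0] := leP 0 x; first by case: ifP => _ /=; rewrite ?mul1r ?mul0r.
    have -> : \int[mu]_y h (x, y) = 0; last by rewrite mulr0.
    rewrite -[RHS](Rintegral_set0 mu (fun=> 0)) [RHS]Rintegral_mkcond.
    apply: eq_Rintegral => y _; rewrite restrE in_set0 /h g0 ?mulr0//.
    by move=> [/andP[x0' _] _]; move: (lt_trans x0 x0'); rewrite ltxx.
rewrite E2 in E1.
by transitivity (I01 (fun y => W (0, y) ^+ 2) + (I01 (fun y => W (t, y) ^+ 2) -
  I01 (fun y => W (0, y) ^+ 2))); [ring|rewrite E1].
Qed.

(** The equation for one state, tested with the state itself. The constant C0 collects the
    fluxes at the ends; the convection term is absorbed by half of the diffusion. *)
Lemma slice_energy (kap B V C0 : R) (U P Pc n : R -> R) (k1 nu : R) :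
  0 < kap -> kap <= k1 -> `|nu| <= V ->
  prim 0 1 U P -> prim 0 1 Pc n -> intble mu `[0, 1] (fun y => P y ^+ 2) ->
  (forall y, 0 < y < 1 -> Pc y = P y) -> (forall y, 0 <= y <= 1 -> `|U y| <= B) ->
  U 1 * (k1 * Pc 1) - U 0 * (k1 * Pc 0) <= C0 ->
  I01 (fun y => U y * (k1 * n y + y * (nu * P y))) <=
   C0 + (V * B) ^+ 2 / (2 * kap) - kap / 2 * I01 (fun y => P y ^+ 2).
Proof.
move=> kap0 kk nuV UP Pn P2 PcP UB bd.
have cU := prim_continuous ler01 UP; have qn := primZ k1 Pn.
have cq := prim_continuous ler01 qn.
have Un : intble mu `[0, 1] (fun y => U y * (k1 * n y)) := intble_mulc ler01 cU qn.1.
have Pq : intble mu `[0, 1] (fun y => P y * (k1 * Pc y)).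
  by have := intble_mulc ler01 cq UP.1; apply: intble_eq => // z _; rewrite mulrC.
have R_int : intble mu `[0, 1] (fun y => U y * (y * (nu * P y))).
  have cUy : {within `[0, 1], continuous (fun y => U y * y)}.
    by move=> y; apply: cvgM; [exact: cU|apply: continuous_subspaceT => z; exact: cvg_id].
  have i1 : intble mu `[0, 1] (fun y => nu * P y) by apply: intbleZ => //; exact: UP.1.
  by have := intble_mulc ler01 cUy i1; apply: intble_eq => // z _; rewrite -mulrA.
have -> : I01 (fun y => U y * (k1 * n y + y * (nu * P y))) =
    I01 (fun y => U y * (k1 * n y)) + I01 (fun y => U y * (y * (nu * P y))).
  by rewrite /I01 -RintD//; apply: eq_Rintegral => y _; ring.
have byparts := prim_mul ler01 UP qn; rewrite RintD// in byparts.
have V0 : 0 <= V by exact: le_trans (normr_ge0 _) nuV.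
have B0 : 0 <= B by apply: (le_trans (normr_ge0 (U 0))); apply: UB; rewrite lexx ler01.
have bound : I01 (fun y => U y * (y * (nu * P y)) - P y * (k1 * Pc y)) <=
    I01 (fun y => (V * B) ^+ 2 / (2 * kap) + - (kap / 2) * P y ^+ 2).
  apply: I01_le.
  - exact: intbleB.
  - by apply: intbleD => //; [exact: intble01_cst|exact: intbleZ].
  - move=> y y01; rewrite PcP//; have /andP[y0 y1] := y01.
    have h1 : U y * (y * (nu * P y)) <= V * B * `|P y|.
      apply: (le_trans (ler_norm _)); rewrite !normrM (gtr0_norm y0).
      have -> : `|U y| * (y * (`|nu| * `|P y|)) = (y * `|nu|) * `|U y| * `|P y| by ring.
      rewrite ler_wpM2r// ler_pM ?mulr_ge0 ?(ltW y0)//; last by rewrite UB// !ltW.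
      by rewrite -[leRHS]mul1r ler_pM// ltW.
    have h2 : kap * (P y * P y) <= P y * (k1 * P y).
      have -> : P y * (k1 * P y) = k1 * (P y * P y) by ring.
      by rewrite ler_wpM2r// -expr2 sqr_ge0.
    have h3 : 0 <= kap / 2 * (`|P y| - V * B / kap) ^+ 2.
      by rewrite mulr_ge0 ?sqr_ge0//; lra.
    have h4 : kap / 2 * (`|P y| - V * B / kap) ^+ 2 =
      kap / 2 * `|P y| ^+ 2 - V * B * `|P y| + (V * B) ^+ 2 / (2 * kap).
      by field; rewrite gt_eqF.
    rewrite h4 real_normK ?num_real// in h3; rewrite -expr2 in h2.
    by move: h1 h2 h3; lra.
have e1 : I01 (fun y => U y * (y * (nu * P y)) - P y * (k1 * Pc y)) =
  I01 (fun y => U y * (y * (nu * P y))) - I01 (fun y => P y * (k1 * Pc y)).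
  by rewrite /I01 RintegralB.
have e2 : I01 (fun y => (V * B) ^+ 2 / (2 * kap) + - (kap / 2) * P y ^+ 2) =
  (V * B) ^+ 2 / (2 * kap) + - (kap / 2) * I01 (fun y => P y ^+ 2).
  rewrite /I01 RintD//; [|exact: intble01_cst|exact: intbleZ].
  by rewrite -[X in X + _]/(I01 _) I01_cst RintegralZl.
rewrite e1 e2 in bound.
have b2 : I01 (fun y => P y * (k1 * Pc y)) + I01 (fun y => U y * (k1 * n y)) <= C0.
  by rewrite /I01 -byparts.
by move: bound b2; lra.
Qed.

End TimeEstimates.

(** * Lipschitz bounds and the Gronwall argument for energies *)

Section Coefficients.
Context {R : realFieldType}.
Implicit Types (m k x y : R).

Lemma inv_lipschitz m x y : 0 < m -> m <= x -> m <= y ->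
  `|x^-1 - y^-1| <= `|x - y| / m ^+ 2.
Proof.
move=> m0 mx my; have x0 : 0 < x by lra.
have y0 : 0 < y by lra.
have -> : x^-1 - y^-1 = (y - x) / (x * y) by field; rewrite !gt_eqF.
have i : (x * y)^-1 <= (m ^+ 2)^-1.
  rewrite lef_pV2 ?posrE ?mulr_gt0 ?exprn_gt0// expr2.
  by apply: ler_pM => //; exact: ltW.
rewrite normrM (distrC y) ler_wpM2l//.
by rewrite ger0_norm// invr_ge0; apply: mulr_ge0; exact: ltW.
Qed.

Lemma inv_sq_lipschitz m k x y : 0 < m -> 0 < k -> m <= x -> m <= y ->
  `|k / x ^+ 2 - k / y ^+ 2| <= 2 * k / m ^+ 3 * `|x - y|.
Proof.
move=> m0 k0 mx my; have x0 : 0 < x by lra.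
have y0 : 0 < y by lra.
have -> : k / x ^+ 2 - k / y ^+ 2 = k * ((x^-1 + y^-1) * (x^-1 - y^-1)).
  by field; rewrite !gt_eqF.
have i z : m <= z -> 0 <= z^-1 <= m^-1.
  move=> mz; have z0 : 0 < z by lra.
  by rewrite invr_ge0 (ltW z0) lef_pV2.
have /andP[ix0 ix] := i _ mx; have /andP[iy0 iy] := i _ my.
rewrite !normrM (gtr0_norm k0) (ger0_norm (addr_ge0 ix0 iy0)).
have -> : 2 * k / m ^+ 3 * `|x - y| = k * ((m^-1 + m^-1) * (`|x - y| / m ^+ 2)).
  by field; rewrite gt_eqF.
rewrite (ler_wpM2l (ltW k0))// ler_pM ?addr_ge0// ?lerD//.
exact: inv_lipschitz.
Qed.

Lemma mul_lipschitz (x y u v : R) : `|x * u - y * v| <= `|x - y| * `|u| + `|y| * `|u - v|.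
Proof.
have -> : x * u - y * v = (x - y) * u + y * (u - v) by ring.
by apply: (le_trans (ler_normD _ _)); rewrite !normrM.
Qed.

End Coefficients.

Section GronwallEnergy.
Context {R : realType}.
Notation mu := (@lebesgue_measure R).

Lemma primD_fun (a b : R) (F f G g : R -> R) : prim a b F f -> prim a b G g ->
  prim a b (fun x => F x + G x) (fun x => f x + g x).
Proof.
move=> FF GG; have := primB_fun FF (primZ (-1) GG).
rewrite (_ : (fun x => F x - -1 * G x) = fun x => F x + G x); last first.
  by apply/funext => x; ring.
by rewrite (_ : (fun x => f x - -1 * g x) = fun x => f x + g x)//; apply/funext => x; ring.
Qed.

Lemma prim_sq (a b : R) (F f : R -> R) : a <= b -> prim a b F f ->
  prim a b (fun x => F x ^+ 2) (fun x => 2 * (F x * f x)).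
Proof.
move=> ab FF; have cF := prim_continuous ab FF.
split; first by apply: intbleZ => //; exact: intble_mulc FF.1.
move=> x /andP[ax xb].
have FF' := primS FF (lexx _) ax xb.
have := prim_mul ax FF' FF'; rewrite -!expr2 => h.
have -> : \int[mu]_(t in `[a, x]) (2 * (F t * f t)) =
  \int[mu]_(t in `[a, x]) (f t * F t + F t * f t).
  by apply: eq_Rintegral => t _; ring.
by rewrite -h; ring.
Qed.

(** Gronwall's inequality for an energy Y with dissipation kap A'. The weight 1 + A has an
    integral of at most T + K, so the constant depends on the data only; the dissipation is
    recovered afterwards by integrating the differential inequality once more. *)
Lemma gronwall_energy (T kap C K : R) : 0 < T -> 0 < kap -> 0 < C -> 0 <= K ->
  exists2 M, 0 < M & forall Y Y' A A' D : R -> R,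
    prim 0 T Y Y' -> (forall t, 0 <= Y t) ->
    intble mu `[0, T] A -> (forall t, 0 <= A t) -> \int[mu]_(t in `[0, T]) A t <= K ->
    intble mu `[0, T] A' -> (forall t, 0 <= A' t) ->
    intble mu `[0, T] D -> (forall t, 0 <= D t) ->
    {ae mu, forall t, 0 < t < T ->
      Y' t <= - kap * A' t + C * ((1 + A t) * Y t + D t)} ->
    forall t, 0 <= t <= T -> Y t + \int[mu]_(x in `[0, t]) A' x <=
      M * (Y 0 + \int[mu]_(x in `[0, t]) D x).
Proof.
move=> T0 kap0 C0 K0.
have [n nK] : exists n : nat, C * (T + K) <= n%:R / 2.
  (* the number of intervals on which the weight C (1 + A) has integral 1/2 *)
  exists (Num.truncn (2 * (C * (T + K)))).+1.
  have := truncnS_gt (2 * (C * (T + K))).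
  by rewrite ler_pdivlMr// mulrC => /ltW.
(* the first term bounds Y, the second the integral of A' *)
pose c := 4 ^+ n + kap^-1 * (1 + n%:R / 2 * 4 ^+ n).
have n0 : 0 <= (n%:R : R) / 2 by rewrite divr_ge0.
have p0 : 0 < (4 : R) ^+ n by rewrite exprn_gt0//; lra.
have c0 : 0 < c.
  have h : 0 <= 1 + n%:R / 2 * 4 ^+ n :> R.
    by apply: addr_ge0 => //; apply: mulr_ge0 => //; exact: ltW.
  by apply: (lt_le_trans p0); rewrite lerDl mulr_ge0// invr_ge0 ltW.
exists (c * (1 + C)); first by rewrite mulr_gt0//; lra.
move=> Y Y' A A' D YP Y0 iA A0 AK iA' A'0 iD D0 ineq.
have cY := prim_continuous (ltW T0) YP.
have sub t1 t2 : 0 <= t1 -> t2 <= T -> `[t1, t2] `<=` `[0, T].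
  by move=> h1 h2; apply: subset_itv; rewrite bnd_simp.
pose g t := C * (1 + A t).
have ig : intble mu `[0, T] g.
  by apply: intbleZ => //; apply: intbleD => //; apply: continuous_intble;
     apply: continuous_subspaceT => x; exact: cvg_cst.
have g0 t : 0 <= g t by rewrite mulr_ge0 ?(ltW C0)// addr_ge0.
have iYg := intble_mulc (ltW T0) cY ig.
pose DD t := \int[mu]_(x in `[0, t]) (C * D x).
have iCD : intble mu `[0, T] (fun x => C * D x) by exact: intbleZ.
have DP : prim 0 T DD (fun x => C * D x).
  by split => // x _; rewrite /DD set_itv1 Rintegral_set1 add0r.
have DD0 : DD 0 = 0 by rewrite /DD set_itv1 Rintegral_set1.
have DDle t1 t2 : 0 <= t1 -> t1 <= t2 -> t2 <= T -> DD t1 <= DD t2.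
  move=> h1 h2 h3; rewrite -subr_ge0 (primB DP h1 h2 h3).
  by apply: Rintegral_ge0 => x _; rewrite mulr_ge0// ltW.
have incr t1 t2 : 0 <= t1 -> t1 <= t2 -> t2 <= T ->
    Y t2 - Y t1 + kap * \int[mu]_(x in `[t1, t2]) A' x <=
    \int[mu]_(x in `[t1, t2]) (Y x * g x) + (DD t2 - DD t1).
  move=> h1 h2 h3; have S := sub _ _ h1 h3.
  have j1 : intble mu `[t1, t2] Y' by exact: intbleS YP.1.
  have j2 : intble mu `[t1, t2] (fun x => kap * A' x).
    by apply: intbleZ => //; exact: intbleS iA'.
  have j3 : intble mu `[t1, t2] (fun x => Y x * g x) by exact: intbleS iYg.
  have j4 : intble mu `[t1, t2] (fun x => C * D x) by exact: intbleS iCD.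
  rewrite (primB YP h1 h2 h3) (primB DP h1 h2 h3) -RintegralZl//; last exact: intbleS iA'.
  rewrite -RintD// -RintD//.
  have j12 : intble mu `[t1, t2] (fun x => Y' x + kap * A' x) by exact: intbleD.
  have j34 : intble mu `[t1, t2] (fun x => Y x * g x + C * D x) by exact: intbleD.
  have m1 := intble_meas j12; have m2 := intble_meas j34.
  have S' : (`]t1, t2[%classic : set R) `<=` `[t1, t2] by exact: subset_itv_oo_cc.
  rewrite -Rint_oo_cc; last exact: measurable_funS m1.
  rewrite -[leRHS]Rint_oo_cc; last exact: measurable_funS m2.
  apply: ae_le_Rint => //.
  - by apply: intbleS j12.
  - by apply: intbleS j34.
  - apply: ae_imp ineq => x hx /=; rewrite in_itv /= => /andP[x1 x2].
    have := hx; rewrite (le_lt_trans h1 x1) (lt_le_trans x2 h3) => /(_ isT).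
    by rewrite /g; move=> h; lra.
move=> t /andP[t0 tT].
have gt t' : 0 <= t' <= T -> \int[mu]_(x in `[0, t']) g x <= n%:R / 2.
  move=> /andP[t'0 t'T]; apply: le_trans nK.
  have GP : prim 0 T (fun t => \int[mu]_(x in `[0, t]) g x) g.
    by split => // x _; rewrite [in RHS]set_itv1 Rintegral_set1 add0r.
  have := primB GP t'0 t'T (lexx _).
  have : 0 <= \int[mu]_(x in `[t', T]) g x by apply: Rintegral_ge0.
  have -> : \int[mu]_(x in `[0, T]) g x = C * (T + \int[mu]_(x in `[0, T]) A x).
    rewrite /g RintegralZl//; last first.
      by apply: intbleD => //; apply: continuous_intble;
         apply: continuous_subspaceT => x; exact: cvg_cst.
    rewrite RintD//; last first.
      by apply: continuous_intble; apply: continuous_subspaceT => x; exact: cvg_cst.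
    congr (_ * (_ + _)); rewrite Rintegral_cst//= lebesgue_measure_itv /= lte_fin T0.
    by rewrite -EFinB /= mul1r subr0.
  have := ler_wpM2l (ltW C0) AK; lra.
have Yt t' : 0 <= t' <= t -> Y t' <= 4 ^+ n * (Y 0 + DD t).
  move=> /andP[t'0 t't]; have t'T := le_trans t't tT.
  have t'I : 0 <= t' <= T by rewrite t'0.
  apply: (@le_trans _ _ (4 ^+ n * (Y 0 + DD t'))); last first.
    by rewrite ler_pM2l// lerD2l DDle.
  apply: (gronwall (T := T) (g := g)) => //; last exact: gt.
  - by rewrite DD0.
  - move=> t1 t2 h1 h2 h3; apply: le_trans (incr _ _ h1 h2 h3).
    rewrite lerDl mulr_ge0 ?(ltW kap0)//; exact: Rintegral_ge0.
have tI : 0 <= t <= T by rewrite t0.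
have Z0 : 0 <= Y 0 + DD t by rewrite addr_ge0// -DD0 DDle.
have S := sub 0 t (lexx _) tT.
have bYg : \int[mu]_(x in `[0, t]) (Y x * g x) <= 4 ^+ n * (Y 0 + DD t) * (n%:R / 2).
  apply: (@le_trans _ _ (\int[mu]_(x in `[0, t]) (4 ^+ n * (Y 0 + DD t) * g x))).
    apply: le_Rintegral => //; first exact: intbleS iYg.
      by apply: intbleZ => //; exact: intbleS ig.
    by move=> x /=; rewrite in_itv /= => xI; rewrite ler_wpM2r// Yt.
  rewrite RintegralZl//; last exact: intbleS ig.
  by rewrite ler_wpM2l ?gt// mulr_ge0// ltW.
have h1 := incr 0 t (lexx _) t0 tT; rewrite DD0 subr0 in h1.
have h2 := Yt t; rewrite t0 lexx in h2; have {}h2 := h2 isT.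
have eD : DD t = C * \int[mu]_(x in `[0, t]) D x.
  by rewrite /DD RintegralZl//; exact: intbleS iD.
have Dt0 : 0 <= \int[mu]_(x in `[0, t]) D x by exact: Rintegral_ge0.
have h3 : kap * \int[mu]_(x in `[0, t]) A' x <= (1 + n%:R / 2 * 4 ^+ n) * (Y 0 + DD t).
  have := Y0 t; move: h1 bYg; clear.
  by move: (4 ^+ n) (n%:R / 2) => x y *; lra.
have h4 : \int[mu]_(x in `[0, t]) A' x <= kap^-1 * ((1 + n%:R / 2 * 4 ^+ n) * (Y 0 + DD t)).
  by rewrite ler_pdivlMl.
have h5 : Y 0 + DD t <= (1 + C) * (Y 0 + \int[mu]_(x in `[0, t]) D x).
  rewrite eD; have := mulr_ge0 (ltW C0) (Y0 0); move: Dt0 C0; clear.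
  by move: (\int[mu]_(x in _) _) (Y 0) => x y *; lra.
apply: (@le_trans _ _ (c * (Y 0 + DD t))); last first.
  by rewrite -mulrA ler_pM2l.
move: h2 h4; rewrite /c; clear.
move: (4 ^+ n) (n%:R / 2) => x y *; lra.
Qed.

End GronwallEnergy.

(** * The energy bound *)

Section ReducedEnergy.
Context {R : realType}.
Notation mu := (@lebesgue_measure R).
Notation mu2 := (mu \x mu)%E.

Lemma Rint_I01 (f : R -> R) : (forall y, ~ (0 < y < 1) -> f y = 0) ->
  \int[mu]_y f y = I01 f.
Proof.
move=> f0; rewrite /I01 [RHS]Rintegral_mkcond; apply: eq_Rintegral => y _.
rewrite restrE mem_setE in_itv /=; case: ifPn => // y01.
by rewrite f0// => /andP[/ltW y0 /ltW y1]; rewrite y0 y1 in y01.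
Qed.

Lemma slice_meas (P : R * R -> R) t (D : set R) : measurable_fun setT P -> measurable D ->
  measurable_fun D (fun y => P (t, y)).
Proof.
move=> mP mD; apply: (measurable_funS measurableT) => //.
exact: measurableT_comp mP (pair1_measurable t).
Qed.

Lemma slices_intble (g : R * R -> R) : intble mu2 setT g ->
  {ae mu, forall t, intble mu `[0, 1] (fun y => g (t, y))}.
Proof. by move=> gi; apply: ae_imp (ae_integrable1 gi) => t h; apply: intbleS h. Qed.

(** The cut-off state may replace the state wherever the source g does not vanish. *)
Lemma source_slices (T : R) (W WT g : R * R -> R) :
  (forall t, continuous (fun y => W (t, y))) ->
  (forall t y, 0 < t < T -> 0 < y < 1 -> WT (t, y) = W (t, y)) ->
  intble mu2 setT g -> (forall t y, ~ (0 < t < T /\ 0 < y < 1) -> g (t, y) = 0) ->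
  {ae mu, forall t, 0 < t < T ->
    \int[mu]_y (2 * (WT (t, y) * g (t, y))) = 2 * I01 (fun y => W (t, y) * g (t, y))}.
Proof.
move=> cW WTW gi g0; apply: ae_imp (slices_intble gi) => t gt tT.
rewrite Rint_I01; last by move=> y y01; rewrite g0 ?mulr0// => -[].
rewrite /I01 -RintegralZl//; last first.
  by apply: intble_mulc => //; exact: continuous_subspaceT.
apply: eq_Rintegral => y _.
have [y01|y01] := pselect (0 < y < 1); first by rewrite WTW.
by rewrite g0 ?mulr0// => -[].
Qed.

Lemma energies_intble (a b T : R) (P : R * R -> R) : intble mu2 setT (fun p => P p ^+ 2) ->
  (forall t y, ~ (0 < t < T /\ 0 < y < 1) -> P (t, y) = 0) ->
  intble mu `[a, b] (fun t => I01 (fun y => P (t, y) ^+ 2)).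
Proof.
move=> P2 P0.
have h : intble mu `[a, b] (fun t => \int[mu]_y (P (t, y) ^+ 2)).
  by apply: intbleS (fubini_intble1 P2).
apply: intble_eq h => // t _; apply: Rint_I01 => y y01.
by rewrite P0 ?expr0n// => -[].
Qed.

(** Bounds that depend only on the data and not on the particular solution. *)
Record bounded_state (T lam Lam V B : R) (l v : R -> R) (U UT : R * R -> R) : Prop := {
  bnd_l : forall t, 0 <= t <= T -> lam <= l t <= Lam;
  bnd_v : forall t, 0 <= t <= T -> `|v t| <= V;
  bnd_U : forall t y, 0 <= t <= T -> 0 <= y <= 1 -> `|U (t, y)| <= B;
  bnd_UT : forall p, `|UT p| <= B
}.

(** The value obtained from slice_energy with diffusion coefficient at least k / Lam^2, speed of
    convection at most V / lam and initial energy at most B^2. *)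
Definition energy_bound (k T lam Lam V B Kb : R) : R :=
  (B ^+ 2 + 2 * (B ^+ 2 * V / lam + B * Kb / lam +
     (V / lam * B) ^+ 2 / (2 * (k / Lam ^+ 2))) * T) / (k / Lam ^+ 2).

(** This bound on the integral of |U_y|^2 in space and time provides the integrable weight in
    the stability estimate. *)
Lemma reduced_energy (k a0 H T a lam Lam V B Kb : R) (beta phi b l v : R -> R)
    (U UT P N : R * R -> R) : 0 < k -> 0 < T -> 0 < lam ->
  (forall x, `|beta x| <= Kb) -> reduced k a0 H T a beta phi b l v U UT P N ->
  bounded_state T lam Lam V B l v U UT ->
  \int[mu]_(t in `[0, T]) I01 (fun y => P (t, y) ^+ 2) <= energy_bound k T lam Lam V B Kb.
Proof.
move=> k0 T0 lam0 betaK r bs.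
pose g p := k / l p.1 ^+ 2 * N p + p.2 * (v p.1 / l p.1) * P p.
have g0 t y : ~ (0 < t < T /\ 0 < y < 1) -> g (t, y) = 0.
  by move=> h; rewrite /g (red_N_out r h) (red_P_out r h) !mulr0 addr0.
have gi : intble mu2 setT g := red_G_int r.
have EP := energy_prim T0 (red_U_y r) (red_UT_meas r) (bnd_UT bs) (red_UT r) gi g0 (red_t r).
have T00 : 0 <= (0 : R) <= T by rewrite lexx ltW.
have /andP[l0 l1] := bnd_l bs T00.
have Lam0 : 0 < Lam by exact: lt_le_trans lam0 (le_trans l0 l1).
pose kap := k / Lam ^+ 2; have kap0 : 0 < kap by rewrite divr_gt0// exprn_gt0.
pose C1 := B ^+ 2 * V / lam + B * Kb / lam + (V / lam * B) ^+ 2 / (2 * kap).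
pose A t := I01 (fun y => P (t, y) ^+ 2).
have iA : intble mu `[0, T] A by apply: energies_intble (red_P_sq r) (red_P_out r).
have B0 : 0 <= B by apply: le_trans (bnd_UT bs (0, 0)).
have iJ := EP.1.
have bJ : {ae mu, forall t, 0 < t < T ->
    \int[mu]_y (2 * (UT (t, y) * g (t, y))) <= 2 * C1 - kap * A t}.
  have s1 := source_slices (red_U_y r) (red_UT r) gi g0.
  have s2 := slices_intble (red_P_sq r).
  apply: ae_imp (ae_and (ae_and s1 s2) (red_yy r)) => t [[h1 h2] h3] tT.
  rewrite h1//; have [Pc [Pc1 Pc2 Pc3 Pc4]] := h3 tT.
  have tT' : 0 <= t <= T by case/andP: tT => /ltW -> /ltW ->.
  have /andP[ll lL] := bnd_l bs tT'; have lt0 := red_l_gt0 r t.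
  have il : (l t)^-1 <= lam^-1 by rewrite lef_pV2.
  have il0 : 0 <= (l t)^-1 by rewrite invr_ge0 ltW.
  have U0 : `|U (t, 0)| <= B by apply: (bnd_U bs tT'); rewrite lexx ler01.
  have U1 : `|U (t, 1)| <= B by apply: (bnd_U bs tT'); rewrite lexx ler01.
  have vV := bnd_v bs tT'; have V0 := le_trans (normr_ge0 _) vV.
  have b1 := betaK (b t - H * U (t, 0)).
  have kk : kap <= k / l t ^+ 2.
    rewrite /kap ler_pM2l// lef_pV2 ?posrE ?exprn_gt0// ler_sqr ?nnegrE// ltW//.
  have nu : `|v t / l t| <= V / lam by rewrite normrM ler_pM// ger0_norm.
  have bd : U (t, 1) * (k / l t ^+ 2 * Pc 1) - U (t, 0) * (k / l t ^+ 2 * Pc 0) <=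
      B ^+ 2 * V / lam + B * Kb / lam.
    rewrite Pc3 Pc4.
    have -> : U (t, 1) * (k / l t ^+ 2 * (- (l t / k) * (U (t, 1) * v t))) -
        U (t, 0) * (k / l t ^+ 2 * (- (l t / k) * beta (b t - H * U (t, 0)))) =
      - (U (t, 1) ^+ 2 * v t * (l t)^-1) + U (t, 0) * beta (b t - H * U (t, 0)) * (l t)^-1.
      by field; rewrite !gt_eqF.
    apply: lerD; apply: (le_trans (ler_norm _)).
      rewrite normrN !normrM (ger0_norm il0) expr2.
      have p1 : `|U (t, 1)| * `|U (t, 1)| <= B * B by exact: ler_pM.
      have p0 : 0 <= `|U (t, 1)| * `|U (t, 1)| by exact: mulr_ge0.
      by apply: ler_pM => //; exact: ler_pM.
    rewrite !normrM (ger0_norm il0); apply: ler_pM => //.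
    exact: ler_pM.
  have UB y : 0 <= y <= 1 -> `|U (t, y)| <= B by move=> y01; exact: (bnd_U bs tT' y01).
  have := slice_energy kap0 kk nu (red_y r tT) Pc1 h2 Pc2 UB bd.
  rewrite (_ : I01 _ = I01 (fun y => U (t, y) * g (t, y))); last first.
    by apply: eq_Rintegral => y _; rewrite /g /= mulrA.
  by rewrite -/(A t) -/C1; lra.
have ET := primB EP (lexx _) (ltW T0) (lexx _).
have E0 : I01 (fun y => U (0, y) ^+ 2) <= B ^+ 2.
  rewrite -[leRHS]I01_cst; apply: I01_le.
  - rewrite (_ : (fun y => _) = fun y => U (0, y) * U (0, y)); last first.
      by apply/funext => y; rewrite expr2.
    by apply: continuous_intble; apply: continuous_subspaceT => y; apply: cvgM; exact: (red_U_y r).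
  - exact: intble01_cst.
  - move=> y /andP[/ltW y0 /ltW y1]; rewrite -real_normK ?num_real// ler_sqr ?nnegrE//.
    by apply: (bnd_U bs T00); rewrite y0.
have E1 : 0 <= I01 (fun y => U (T, y) ^+ 2) by apply: I01_ge0 => y _; exact: sqr_ge0.
have ic : intble mu `[0, T] (fun=> 2 * C1).
  by apply: continuous_intble; apply: continuous_subspaceT => x; exact: cvg_cst.
have ikA : intble mu `[0, T] (fun t => kap * A t) by exact: intbleZ.
have iR : intble mu `[0, T] (fun t => 2 * C1 - kap * A t) by exact: intbleB.
have S : (`]0, T[%classic : set R) `<=` `[0, T] by exact: subset_itv_oo_cc.
have JI : \int[mu]_(t in `[0, T]) \int[mu]_y (2 * (UT (t, y) * g (t, y))) <=
   2 * C1 * T - kap * \int[mu]_(t in `[0, T]) A t.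
  have -> : 2 * C1 * T - kap * \int[mu]_(t in `[0, T]) A t =
     \int[mu]_(t in `[0, T]) (2 * C1 - kap * A t).
    rewrite RintegralB; [|by []|exact: ic|exact: ikA].
    rewrite (RintegralZl _ _ iA)//; congr (_ - _).
    rewrite Rintegral_cst//= lebesgue_measure_itv /= lte_fin T0.
    by rewrite -EFinB /= subr0.
  rewrite -Rint_oo_cc; last by apply: measurable_funS (intble_meas iJ).
  rewrite -[leRHS]Rint_oo_cc; last by apply: measurable_funS (intble_meas iR).
  apply: ae_le_Rint => //.
  - by apply: intbleS iJ.
  - by apply: intbleS iR.
have fin : \int[mu]_(t in `[0, T]) A t * kap <= B ^+ 2 + 2 * C1 * T.
  by move: ET E0 E1 JI; rewrite /g; lra.
by rewrite /energy_bound -/kap -/C1 ler_pdivlMr.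
Qed.

End ReducedEnergy.

(** * Stability on the fixed interval *)

Section CoefficientBounds.
Context {R : realType}.

(** All differences of coefficients and fluxes that enter slice_stability, bounded with one
    constant. Since x1 and x2 are the states at the front, which drive the speeds v1 and v2,
    each difference is controlled by |x1 - x2| + |l1 - l2|; the states at the other end enter
    through beta only. *)
Lemma coefficient_bounds (k a0 lam Lam V B Lb Kb Lp H : R) : 0 < k -> 0 < a0 -> 0 < lam ->
  lam <= Lam -> 0 <= V -> 0 <= B -> 0 <= Lb -> 0 <= Kb -> 0 <= Lp -> 0 <= H ->
  exists2 M, 0 < M & forall l1 l2 v1 v2 x1 x2 f1 f2 g1 g2 w0 del : R,
    lam <= l1 <= Lam -> lam <= l2 <= Lam -> `|v1| <= V -> `|v2| <= V ->
    `|x2| <= B -> v1 = a0 * (x1 - f1) -> v2 = a0 * (x2 - f2) ->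
    `|f1 - f2| <= Lp * `|l1 - l2| -> `|g2| <= Kb ->
    `|g1 - g2| <= Lb * `|del - H * w0| ->
    [/\ k / Lam ^+ 2 <= k / l1 ^+ 2,
        `|k / l1 ^+ 2 - k / l2 ^+ 2| <= M * `|l1 - l2|,
        `|v1 / l1| <= M & `|v1 / l1 - v2 / l2| <= M * (`|x1 - x2| + `|l1 - l2|)] /\
    [/\ `|x1 * (v1 / l1) - x2 * (v2 / l2)| <= M * (`|x1 - x2| + `|l1 - l2|),
        `|g1 / l1 - g2 / l2| <= M * (`|w0| + `|l1 - l2| + `|del|) &
        (l1 - l2) * (v1 - v2) <= M * `|l1 - l2| * (`|x1 - x2| + `|l1 - l2|)].
Proof.
move=> k0 a00 lam0 lamL V0 B0 Lb0 Kb0 Lp0 H0.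
have il0 : 0 < lam^-1 by rewrite invr_gt0.
(* m1 to m6 are Lipschitz or sup constants of, in order: the diffusion coefficient, v / l,
   the difference of v / l, the flux at 1, the flux at 0, the speed *)
pose m1 := 2 * k / lam ^+ 3; pose m2 := V / lam; pose m6 := a0 * (1 + Lp).
pose m3 := m6 / lam + V / lam ^+ 2; pose m4 := m2 + B * m3.
pose m5 := Lb * (1 + H) / lam + Kb / lam ^+ 2.
have m10 : 0 <= m1 by rewrite divr_ge0 ?exprn_ge0 ?(ltW lam0)//; lra.
have m20 : 0 <= m2 by rewrite divr_ge0 ?(ltW lam0).
have m60 : 0 <= m6 by rewrite mulr_ge0 ?(ltW a00)//; lra.
have m30 : 0 <= m3 by rewrite addr_ge0 ?divr_ge0 ?exprn_ge0 ?(ltW lam0).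
have m40 : 0 <= m4 by rewrite addr_ge0// mulr_ge0.
have m50 : 0 <= m5.
  by rewrite addr_ge0 ?divr_ge0 ?exprn_ge0 ?(ltW lam0)// mulr_ge0//; lra.
pose M := 1 + m1 + m2 + m3 + m4 + m5 + m6.
have [m1M m2M m3M] : [/\ m1 <= M, m2 <= M & m3 <= M] by rewrite /M; split; lra.
have [m4M m5M m6M] : [/\ m4 <= M, m5 <= M & m6 <= M] by rewrite /M; split; lra.
exists M; first by rewrite /M; lra.
have mM m x : 0 <= x -> m <= M -> m * x <= M * x by move=> x0; exact: ler_wpM2r.
move=> l1 l2 v1 v2 x1 x2 f1 f2 g1 g2 w0 del /andP[h1 h1'] /andP[h2 h2'] hv1 hv2 hx2 e1 e2 hf hg hgd.
have l10 : 0 < l1 by lra.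
have l20 : 0 < l2 by lra.
have sig0 := normr_ge0 (l1 - l2); have x0 := normr_ge0 (x1 - x2).
have xs0 := addr_ge0 x0 sig0.
have i1 : `|l1^-1| <= lam^-1 by rewrite gtr0_norm ?invr_gt0// lef_pV2.
have i12 := inv_lipschitz lam0 h1 h2.
have dv : `|v1 - v2| <= m6 * (`|x1 - x2| + `|l1 - l2|).
  rewrite e1 e2; have -> : a0 * (x1 - f1) - a0 * (x2 - f2) = a0 * ((x1 - x2) - (f1 - f2)) by ring.
  rewrite normrM gtr0_norm// /m6 -mulrA ler_pM2l//.
  apply: (le_trans (ler_normB _ _)).
  by have := mulr_ge0 Lp0 x0; move: hf sig0; clear; lra.
have dnu : `|v1 / l1 - v2 / l2| <= m3 * (`|x1 - x2| + `|l1 - l2|).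
  apply: (le_trans (mul_lipschitz _ _ _ _)).
  have t1 := ler_pM (normr_ge0 _) (normr_ge0 _) dv i1.
  have t2 := ler_pM (normr_ge0 _) (normr_ge0 _) hv2 i12.
  have t3 : 0 <= V / lam ^+ 2 * `|x1 - x2|.
    by rewrite mulr_ge0// divr_ge0// exprn_ge0// ltW.
  by rewrite /m3; move: t1 t2 t3; clear; lra.
have nu1 : `|v1 / l1| <= m2 by rewrite normrM ler_pM.
split; split.
- have Lam0 : 0 < Lam := lt_le_trans lam0 lamL.
  by rewrite ler_pM2l// lef_pV2 ?posrE ?exprn_gt0// ler_sqr ?nnegrE// ltW.
- by apply: (le_trans (inv_sq_lipschitz lam0 k0 h1 h2)); exact: mM.
- exact: le_trans nu1 m2M.
- by apply: (le_trans dnu); exact: mM.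
- apply: (@le_trans _ _ (m4 * (`|x1 - x2| + `|l1 - l2|))); last first.
    by exact: mM.
  apply: (le_trans (mul_lipschitz _ _ _ _)).
  have t1 := ler_wpM2l x0 nu1.
  have t2 := ler_pM (normr_ge0 _) (normr_ge0 _) hx2 dnu.
  have t3 := mulr_ge0 m20 sig0.
  by rewrite /m4; move: t1 t2 t3; clear; lra.
- have w00 := normr_ge0 w0; have del0 := normr_ge0 del.
  apply: (@le_trans _ _ (m5 * (`|w0| + `|l1 - l2| + `|del|))); last first.
    by apply: mM => //; rewrite !addr_ge0.
  apply: (le_trans (mul_lipschitz _ _ _ _)).
  have t0 : `|g1 - g2| <= Lb * (1 + H) * (`|w0| + `|l1 - l2| + `|del|).
    apply: (le_trans hgd); rewrite -mulrA ler_wpM2l//.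
    apply: (le_trans (ler_normB _ _)); rewrite normrM (ger0_norm H0).
    by have := mulr_ge0 H0 sig0; have := mulr_ge0 H0 del0; move: sig0 w00; clear; lra.
  have t1 := ler_pM (normr_ge0 _) (normr_ge0 _) t0 i1.
  have t2 := ler_pM (normr_ge0 _) (normr_ge0 _) hg i12.
  have t3 : 0 <= Kb / lam ^+ 2 * (`|w0| + `|del|).
    by rewrite mulr_ge0 ?addr_ge0// divr_ge0// exprn_ge0// ltW.
  by rewrite /m5; move: t1 t2 t3; clear; lra.
- apply: (le_trans (ler_norm _)); rewrite normrM.
  have t1 := ler_wpM2l sig0 dv.
  have t2 : m6 * (`|l1 - l2| * (`|x1 - x2| + `|l1 - l2|)) <=
      M * (`|l1 - l2| * (`|x1 - x2| + `|l1 - l2|)).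
    by apply: mM => //; exact: mulr_ge0.
  by move: t1 t2; clear; lra.
Qed.

End CoefficientBounds.

Section ReducedStability.
Context {R : realType}.
Notation mu := (@lebesgue_measure R).
Notation mu2 := (mu \x mu)%E.

(** The energy Y adds the squared difference of the widths to that of the states;
    slice_stability gives its differential inequality for almost every time. *)
Lemma reduced_stability (k a0 H T a lam Lam V B Lb Kb Lp : R) (beta phi : R -> R) :
  0 < k -> 0 < a0 -> 0 < T -> 0 < lam -> lam <= Lam -> 0 <= V -> 0 <= B -> 0 <= H ->
  0 <= Lb -> 0 <= Lp ->
  (forall x, `|beta x| <= Kb) -> (forall x y, `|beta x - beta y| <= Lb * `|x - y|) ->
  (forall x y, `|phi x - phi y| <= Lp * `|x - y|) ->
  exists2 M, 0 < M & forall (b1 b2 l1 l2 v1 v2 : R -> R) (U1 U2 UT1 UT2 P1 P2 N1 N2 : R * R -> R),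
    reduced k a0 H T a beta phi b1 l1 v1 U1 UT1 P1 N1 ->
    reduced k a0 H T a beta phi b2 l2 v2 U2 UT2 P2 N2 ->
    bounded_state T lam Lam V B l1 v1 U1 UT1 ->
    bounded_state T lam Lam V B l2 v2 U2 UT2 ->
    intble mu `[0, T] (fun t => (b1 t - b2 t) ^+ 2) ->
    forall t, 0 <= t <= T ->
    I01 (fun y => (U1 (t, y) - U2 (t, y)) ^+ 2) + (l1 t - l2 t) ^+ 2 +
    \int[mu]_(x in `[0, t]) I01 (fun y => (P1 (x, y) - P2 (x, y)) ^+ 2) <=
    M * (I01 (fun y => (U1 (0, y) - U2 (0, y)) ^+ 2) + (l1 0 - l2 0) ^+ 2 +
    \int[mu]_(x in `[0, t]) ((b1 x - b2 x) ^+ 2)).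
Proof.
move=> k0 a00 T0 lam0 lamL V0 B0 H0 Lb0 Lp0 betaK betaL phiL.
have Kb0 : 0 <= Kb by apply: le_trans (betaK 0).
have Lam0 : 0 < Lam by exact: lt_le_trans lam0 lamL.
pose kap := k / Lam ^+ 2; have kap0 : 0 < kap by rewrite divr_gt0// exprn_gt0.
have [M0 M00 coeff] := coefficient_bounds k0 a00 lam0 lamL V0 B0 Lb0 Kb0 Lp0 H0.
have [C C0 core] := slice_stability kap0 M00.
pose K := Num.max 0 (energy_bound k T lam Lam V B Kb).
have K0 : 0 <= K by rewrite /K le_max lexx.
have kap2 : 0 < kap / 2 by rewrite divr_gt0.
have C2 : 0 < 2 * C by rewrite mulr_gt0.
have [M M1 gron] := gronwall_energy T0 kap2 C2 K0.
exists M => // b1 b2 l1 l2 v1 v2 U1 U2 UT1 UT2 P1 P2 N1 N2 r1 r2 s1 s2 ib t tT.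
pose W p := U1 p - U2 p; pose WT p := UT1 p - UT2 p; pose p_ p := P1 p - P2 p.
pose G1 p := k / l1 p.1 ^+ 2 * N1 p + p.2 * (v1 p.1 / l1 p.1) * P1 p.
pose G2 p := k / l2 p.1 ^+ 2 * N2 p + p.2 * (v2 p.1 / l2 p.1) * P2 p.
pose g p := G1 p - G2 p.
have p_out x y : ~ (0 < x < T /\ 0 < y < 1) -> p_ (x, y) = 0.
  by move=> h; rewrite /p_ (red_P_out r1 h) (red_P_out r2 h) subrr.
have g_out x y : ~ (0 < x < T /\ 0 < y < 1) -> g (x, y) = 0.
  move=> h; rewrite /g /G1 /G2 (red_N_out r1 h) (red_P_out r1 h).
  by rewrite (red_N_out r2 h) (red_P_out r2 h) !mulr0 !addr0 subrr.
have gi : intble mu2 setT g by exact: intbleB (red_G_int r1) (red_G_int r2).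
have mp : measurable_fun setT p_ by exact: measurable_funB (red_P_meas r1) (red_P_meas r2).
have p2 : intble mu2 setT (fun q => p_ q ^+ 2).
  apply: intble_sqB; [by []|exact: (red_P_meas r1)|exact: (red_P_meas r2)| |].
    exact: (red_P_sq r1).
  exact: (red_P_sq r2).
have cW x : continuous (fun y => W (x, y)).
  by move=> y; apply: cvgB; [exact: (red_U_y r1)|exact: (red_U_y r2)].
have WTW x y : 0 < x < T -> 0 < y < 1 -> WT (x, y) = W (x, y).
  by move=> h1 h2; rewrite /WT /W (red_UT r1)// (red_UT r2).
have mWT : measurable_fun setT WT by exact: measurable_funB (red_UT_meas r1) (red_UT_meas r2).
have WTB q : `|WT q| <= B + B.
  by apply: (le_trans (ler_normB _ _)); rewrite lerD ?(bnd_UT s1) ?(bnd_UT s2).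
have Wt : {ae mu, forall y, 0 < y < 1 -> prim 0 T (fun x => W (x, y)) (fun x => g (x, y))}.
  apply: ae_imp (ae_and (red_t r1) (red_t r2)) => y [h1 h2] y01.
  exact: primB_fun (h1 y01) (h2 y01).
have EP := energy_prim T0 cW mWT WTB WTW gi g_out Wt.
have SP := prim_sq (ltW T0) (primB_fun (red_l r1) (red_l r2)).
have YP := primD_fun EP SP.
have h := gron _ _ _ _ _ YP _ (energies_intble _ _ (red_P_sq r2) (red_P_out r2)) _ _
  (energies_intble _ _ p2 p_out) _ ib _ _ _ tT.
apply: h => [x|x||x|x|].
- by apply: addr_ge0; [apply: I01_ge0 => y _; exact: sqr_ge0|exact: sqr_ge0].
- by apply: I01_ge0 => y _; exact: sqr_ge0.
- by rewrite le_max (reduced_energy k0 T0 lam0 betaK r2 s2) orbT.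
- by apply: I01_ge0 => y _; exact: sqr_ge0.
- exact: sqr_ge0.
have a1 := source_slices cW WTW gi g_out.
have a2 := ae_and (slices_intble p2) (slices_intble (red_P_sq r2)).
have a3 := ae_and (red_yy r1) (red_yy r2).
apply: ae_imp (ae_and a1 (ae_and a2 a3)) => x [h1 [[h2 h3] [h4 h5]]] xT.
rewrite h1//; have [q1 [q1p q1P q10 q11]] := h4 xT; have [q2 [q2p q2P q20 q21]] := h5 xT.
have xT' : 0 <= x <= T by case/andP: xT => /ltW -> /ltW ->.
have lb1 := bnd_l s1 xT'; have lb2 := bnd_l s2 xT'.
have l10 := red_l_gt0 r1 x; have l20 := red_l_gt0 r2 x.
have U21 : `|U2 (x, 1)| <= B by apply: (bnd_U s2 xT'); rewrite lexx ler01.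
have phid : `|phi (a + l1 x) - phi (a + l2 x)| <= Lp * `|l1 x - l2 x|.
  by apply: (le_trans (phiL _ _)); rewrite (_ : a + l1 x - (a + l2 x) = l1 x - l2 x); [|ring].
have betad : `|beta (b1 x - H * U1 (x, 0)) - beta (b2 x - H * U2 (x, 0))| <=
    Lb * `|(b1 x - b2 x) - H * W (x, 0)|.
  apply: (le_trans (betaL _ _)); rewrite le_eqVlt; apply/orP; left; apply/eqP.
  by congr (_ * `|_|); rewrite /W; ring.
have [[c1 c2 c3 c4] [c5 c6 c7]] := coeff _ _ _ _ _ _ _ _ _ _ _ _ lb1 lb2 (bnd_v s1 xT')
  (bnd_v s2 xT') U21 (red_v r1 xT') (red_v r2 xT') phid (betaK _) betad.
pose k1 := k / l1 x ^+ 2; pose k2 := k / l2 x ^+ 2.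
have qp := primB_fun (primZ k1 q1p) (primZ k2 q2p).
have := core (fun y => W (x, y)) (fun y => p_ (x, y)) _ _ (fun y => P2 (x, y)) k1 (k1 - k2)
  (v1 x / l1 x) (v1 x / l1 x - v2 x / l2 x) (l1 x - l2 x) (b1 x - b2 x)
  (primB_fun (red_y r1 xT) (red_y r2 xT)) qp.
have mm : measurable (`[0, 1]%classic : set R) by [].
move=> /(_ (slice_meas _ mp mm) (slice_meas _ (red_P_meas r2) mm) h2 h3).
have qq y : 0 < y < 1 -> k1 * q1 y - k2 * q2 y = k1 * p_ (x, y) + (k1 - k2) * P2 (x, y).
  by move=> y01; rewrite q1P// q2P// /p_; ring.
move=> /(_ qq c1 c2 c3 c4).
have -> : k1 * q1 1 - k2 * q2 1 = - (U1 (x, 1) * (v1 x / l1 x) - U2 (x, 1) * (v2 x / l2 x)).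
  by rewrite q11 q21 /k1 /k2; field; rewrite !gt_eqF.
have -> : k1 * q1 0 - k2 * q2 0 = - (beta (b1 x - H * U1 (x, 0)) / l1 x -
    beta (b2 x - H * U2 (x, 0)) / l2 x).
  by rewrite q10 q20 /k1 /k2; field; rewrite !gt_eqF.
rewrite !normrN => /(_ c5 c6).
have -> : I01 (fun y => W (x, y) * (k1 * N1 (x, y) - k2 * N2 (x, y) +
    y * (v1 x / l1 x * p_ (x, y) + (v1 x / l1 x - v2 x / l2 x) * P2 (x, y)))) =
    I01 (fun y => W (x, y) * g (x, y)).
  by apply: eq_Rintegral => y _; rewrite /g /G1 /G2 /= /p_ /k1 /k2; ring.
by move: c7; rewrite /W /p_; clear; lra.
Qed.

End ReducedStability.

(** * A priori bounds on the front and on its speed *)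

Section Bounds.
Context {R : realType}.
Notation mu := (@lebesgue_measure R).
Notation mu2 := (mu \x mu)%E.

(** A cutoff function is its restriction to [0, r] composed with this projection. *)
Lemma clamp_lipschitz (T x y : R) : 0 <= T -> `|clamp T x - clamp T y| <= `|x - y|.
Proof.
move=> T0; wlog xy : x y / x <= y => [h|].
  have [/h//|/ltW/h] := leP x y; by rewrite distrC (distrC y).
rewrite distrC (distrC x) (ger0_norm (_ : 0 <= y - x)); last by lra.
rewrite /clamp; have [h1|h1] := leP x T; have [h2|h2] := leP y T.
all: have [h3|h3] := leP 0 x; have [h4|h4] := leP 0 y; rewrite ?(max_idPr T0).
all: rewrite ler_norml; apply/andP; split; lra.
Qed.

(** The derivative is continuous on [0, r] and the function is constant on both sides, which
    gives global bounds. *)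
Lemma cutoff_bounds (f : R -> R) (r c : R) : cutoff f r c ->
  exists K L : R, [/\ 0 <= L, forall x, `|f x| <= K & forall x y, `|f x - f y| <= L * `|x - y|].
Proof.
move=> [Cf _ [r0 c0 f0 _ fr]].
have cf := C1_continuous Cf.
have [K fK] := continuous_bounded (ltW r0) (continuous_subspaceT cf).
have [L fL] := continuous_bounded (ltW r0) (continuous_subspaceT Cf.2).
have L0 : 0 <= L by apply: le_trans (fL 0 _); rewrite // lexx ltW.
have fcl x : f x = f (clamp r x).
  rewrite /clamp; have [h1|h1] := leP x r; last by rewrite (max_idPr (ltW r0)) !fr// ltW.
  by have [h2|h2] := leP 0 x => //; rewrite !f0// ltW.
exists K, L; split => // [x|x y]; first by rewrite fcl fK// clamp_in// ltW.
suff H u v : 0 <= u -> u <= v -> v <= r -> `|f v - f u| <= L * (v - u).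
  rewrite (fcl x) (fcl y).
  have /andP[x1 x2] := clamp_in x (ltW r0); have /andP[y1 y2] := clamp_in y (ltW r0).
  apply: (@le_trans _ _ (L * `|clamp r x - clamp r y|)); last first.
    by rewrite ler_wpM2l// clamp_lipschitz// ltW.
  have [h|/ltW h] := leP (clamp r x) (clamp r y).
    by rewrite distrC (distrC (clamp r x)) (ger0_norm (_ : 0 <= clamp r y - _)) ?subr_ge0// H.
  by rewrite (ger0_norm (_ : 0 <= clamp r x - _)) ?subr_ge0// H.
move=> u0; rewrite le_eqVlt => /orP[/eqP <-|uv vr]; first by rewrite !subrr normr0 mulr0.
have [c1 c1I ->] : exists2 c, c \in `]u, v[ & f v - f u = derive1 f c * (v - u).
  apply: MVT => // [z _|]; last exact: continuous_subspaceT.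
  by apply: DeriveDef; [exact: Cf.1|rewrite derive1E].
move: c1I; rewrite in_itv /= => /andP[uc cv].
have vu : 0 <= v - u by lra.
rewrite normrM (ger0_norm vu) ler_wpM2r// fL//; apply/andP; split; lra.
Qed.

(** The bounds on u are given on the open domain; continuity extends them to its boundary, where
    the fluxes are evaluated. *)
Lemma closed_bounds (a b m M : R) (f : R -> R) : a < b -> continuous f ->
  (forall x, a < x < b -> m <= f x <= M) -> forall x, a <= x <= b -> m <= f x <= M.
Proof.
move=> ab cf h x xab.
suff H e : 0 < e -> m <= f x + e /\ f x <= M + e.
  by apply/andP; split; apply/ler_addgt0Pr => e /H[].
move=> e0; have [r r0 hr] := within_ball ab (continuous_subspaceT cf) xab e0.
have I : Num.max a (x - r) < Num.min b (x + r).
  by rewrite lt_min !gt_max; case/andP: xab => *; apply/andP; split; apply/andP; split; lra.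
have [q] := rat_in_itvoo I; rewrite in_itv /= gt_max lt_min => /andP[/andP[h1 h2] /andP[h3 h4]].
have := hr (ratr q); rewrite (ltW h1) (ltW h3) => /(_ isT).
have -> : `|ratr q - x| < r by rewrite ltr_norml; apply/andP; split; lra.
move=> /(_ isT); rewrite ler_norml => /andP[h5 h6].
have := h (ratr q); rewrite h1 h3 => /(_ isT) /andP[h7 h8]; split; lra.
Qed.

Lemma C1_exp (c : R) : C1 (fun t : R => expR (c * t)) /\
  forall t, derive1 (fun t : R => expR (c * t)) t = c * expR (c * t).
Proof.
have d (t : R) : is_derive t (1 : R) (fun t : R => expR (c * t)) (c * expR (c * t)).
  have d1 : is_derive t (1 : R) (fun t : R => c * t) c.
    by apply: is_derive_eq; rewrite /GRing.scale /=; ring.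
  by apply: is_derive_eq; rewrite /GRing.scale /=; ring.
have e (t : R) : derive1 (fun t : R => expR (c * t)) t = c * expR (c * t).
  by rewrite derive1E derive_val.
split => //; split => [t|]; first by case: (d t).
rewrite (_ : derive1 _ = fun t => c * expR (c * t)); last exact/funext.
move=> t; apply: cvgM; first exact: cvg_cst.
apply: continuous_comp; last exact: continuous_expR.
by apply: cvgM; [exact: cvg_cst|exact: cvg_id].
Qed.

(** The function l (t) exp (c t) is nondecreasing. *)
Lemma exp_lower_bound (T c : R) (l v : R -> R) : 0 <= c -> prim 0 T l v ->
  (forall t, 0 <= t <= T -> 0 <= v t + c * l t) -> 0 <= l 0 ->
  forall t, 0 <= t <= T -> l 0 * expR (- (c * T)) <= l t.
Proof.
move=> c0 lv h l00 t /andP[t0 tT].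
have [Ce de] := C1_exp c.
have P1 := primS lv (lexx _) t0 tT.
have := prim_mul t0 P1 (prim_C1 t0 Ce).
have : 0 <= \int[mu]_(x in `[0, t]) (v x * expR (c * x) + l x * derive1 (fun t => expR (c * t)) x).
  apply: Rintegral_ge0 => x /=; rewrite in_itv /= => /andP[x0 xt].
  rewrite de (_ : _ + _ = (v x + c * l x) * expR (c * x)); last by ring.
  by rewrite mulr_ge0 ?expR_ge0// h// x0 (le_trans xt tT).
move=> h1 h2; rewrite -h2 mulr0 expR0 mulr1 subr_ge0 in h1.
rewrite expRN ler_pdivrMr ?expR_gt0//; apply: (le_trans h1).
have lt0 : 0 <= l t by rewrite -(pmulr_lge0 _ (expR_gt0 (c * t))) (le_trans l00).
by rewrite ler_wpM2l// ler_expR ler_wpM2l.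
Qed.

End Bounds.

Section SolutionBounds.
Context {R : realType}.
Notation mu := (@lebesgue_measure R).
Notation mu2 := (mu \x mu)%E.
Variables (a a0 H k T : R) (beta phi b : R -> R) (s0 : R) (u0 : R -> R).
Variables (s st : R -> R) (u ut uz uzz : R * R -> R).
Variables (B K L : R).
Hypothesis T0 : 0 < T.
Hypothesis a00 : 0 < a0.
Hypothesis cphi : continuous phi.
Hypothesis phiK : forall x, `|phi x| <= K.
Hypothesis L0 : 0 <= L.
Hypothesis phiL : forall x y, `|phi x - phi y| <= L * `|x - y|.
Hypothesis phia : 0 < phi a.
Hypothesis sol : solution_with a a0 H k T beta phi b s0 u0 s st u ut uz uzz.
Hypothesis uB : forall p, Q a T s p -> phi a <= u p <= B.

Notation U := (uc a T s u).
Notation v := (vel a a0 T phi s u).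
Notation l := (len a T s).

Lemma state_range (t y : R) : 0 <= t <= T -> 0 <= y <= 1 -> phi a <= U (t, y) <= B.
Proof.
have inner t' y' : 0 < t' < T -> 0 < y' < 1 -> phi a <= U (t', y') <= B.
  move=> t'T y'1; have t'T' : 0 <= t' <= T by case/andP: t'T => /ltW -> /ltW ->.
  have y'1' : 0 <= y' <= 1 by case/andP: y'1 => /ltW -> /ltW ->.
  rewrite uc_in//; apply: uB; split => //=.
  have sa := s_gt sol t'T'; have sa' : 0 < s t' - a by lra.
  case/andP: y'1 => y0 y1; rewrite ltrDl mulr_gt0//= -ltrBrDl.
  by rewrite gtr_pMl.
move=> tT y01; apply: (closed_bounds T0 (uc_t T0 sol (y := y))) tT => t' t'T.
by apply: (closed_bounds ltr01 (uc_y T0 sol (t := t')) _ y01) => y'; exact: inner.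
Qed.

(** At the front the state is at least phi (a), and phi (a + l) exceeds phi (a) by at most L l;
    hence the front recedes at a rate proportional to the width at most. *)
Lemma speed_range (t : R) : 0 <= t <= T -> `|v t| <= a0 * (B + K) /\ 0 <= v t + a0 * L * l t.
Proof.
move=> tT; have /andP[h1 h2] : phi a <= U (t, 1) <= B.
  by apply: state_range => //; rewrite ler01 lexx.
have hK := phiK (a + l t); have l0 := len_gt0 T0 (s_gt sol) t.
split.
  rewrite /vel normrM gtr0_norm// ler_pM2l//; apply: (le_trans (ler_normB _ _)).
  by rewrite lerD// gtr0_norm//; exact: lt_le_trans phia h1.
have := phiL (a + l t) a; have -> : a + l t - a = l t by ring.
rewrite (gtr0_norm l0) ler_norml => /andP[h3 h4].
have -> : v t + a0 * L * l t = a0 * (U (t, 1) - phi (a + l t) + L * l t).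
  by rewrite /vel; ring.
by rewrite mulr_ge0 ?(ltW a00)//; lra.
Qed.

(** The lower bound on the width is uniform because all initial positions are at least sl. *)
Lemma solution_bounded (sl r : R) : a < sl -> sl <= s0 < r ->
  bounded_state T ((sl - a) * expR (- (a0 * L * T))) (Num.max (sl - a) (r - a) + a0 * (B + K) * T)
    (a0 * (B + K)) B l v U (tr a T s u).
Proof.
move=> asl /andP[sls s0r]; have lP := len_prim T0 cphi sol.
have T00 : 0 <= (0 : R) <= T by rewrite lexx ltW.
have l0 : l 0 = s0 - a by rewrite len_id// (s_initial sol).
have i00 : 0 <= (0 : R) <= 1 by rewrite lexx ler01.
have B0 : 0 <= B by have /andP[h1 h2] := state_range T00 i00; exact: le_trans (ltW phia) (le_trans h1 h2).
split.
- move=> t tT; apply/andP; split.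
    have aL : 0 <= a0 * L by rewrite mulr_ge0// ltW.
    apply: le_trans (exp_lower_bound aL lP _ _ tT).
    - by rewrite l0 ler_pM2r ?expR_gt0//; lra.
    - by move=> x /speed_range[].
    - by rewrite l0; lra.
  case/andP: tT => t0 tT.
  have : l t - l 0 <= a0 * (B + K) * t.
    rewrite (primB lP (lexx _) t0 tT).
    have -> : a0 * (B + K) * t = \int[mu]_(x in `[0, t]) (a0 * (B + K)).
      rewrite Rintegral_cst//= lebesgue_measure_itv /= lte_fin.
      case: ltP => [|t0']; first by rewrite -EFinB /= subr0.
      by have -> : t = 0 by apply/eqP; rewrite eq_le t0 t0'.
    apply: le_Rintegral => //.
    - exact: (primS lP (lexx _) t0 tT).1.
    - by apply: continuous_intble; apply: continuous_subspaceT => x; exact: cvg_cst.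
    - move=> x /=; rewrite in_itv /= => /andP[x0 xt].
      apply: (le_trans (ler_norm _)); apply: (speed_range _).1.
      by rewrite x0 (le_trans xt).
  have V0 : 0 <= a0 * (B + K) := le_trans (normr_ge0 _) (speed_range T00).1.
  have := ler_wpM2l V0 tT; rewrite l0 => h1 h2.
  have : s0 - a <= Num.max (sl - a) (r - a) by rewrite le_max; apply/orP; right; lra.
  by move: h1 h2; lra.
- by move=> t /speed_range[].
- move=> t y tT y01; have /andP[h1 h2] := state_range tT y01.
  by rewrite gtr0_norm//; exact: lt_le_trans phia h1.
- move=> p; rewrite trE; case: ifPn => [|_]; last by rewrite normr0.
  by rewrite inE => /uB /andP[h1 h2]; rewrite gtr0_norm//; exact: lt_le_trans phia h1.
Qed.

End SolutionBounds.

(** * Uniqueness of weak derivatives *)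

Section WeakUniqueness.
Context {R : realType}.
Notation mu := (@lebesgue_measure R).
Implicit Types (a b c d : R) (F f g : R -> R).

(** A weak derivative on an open interval is only locally integrable, so the fundamental theorem
    applies on compact subintervals. *)
Lemma weak_deriv_prim_sub a b c d F f : a < c -> c < d -> d < b ->
  {within `[a, b], continuous F} -> weak_deriv `]a, b[ F f -> prim c d F f.
Proof.
move=> ac cd db cF [_ [mf _ fK] W].
have S : `[c, d] `<=` (`]a, b[%classic : set R) by apply: subset_itv; rewrite bnd_simp.
have cF' : {within `[c, d], continuous F}.
  by apply: continuous_subspaceW cF; apply: subset_itv; rewrite bnd_simp ltW.
have fi : intble mu `[c, d] f.
  apply/integrableP; split; first by apply/measurable_EFinP; exact: measurable_funS mf.
  exact: fK S (@segment_compact _ _ _).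
apply: prim_of_weak => // xi Cxi sxi.
have So : (`]c, d[%classic : set R) `<=` `]a, b[.
  by apply: subset_itv; rewrite bnd_simp ltW.
have sxi' : compactly_supported_in `]a, b[ xi.
  by case: sxi => A [cA AD A0]; exists A; split => //; exact: subset_trans So.
have widen (h psi : R -> R) : compactly_supported_in `]c, d[ psi ->
    \int[mu]_(x in `]a, b[) (h x * psi x) = \int[mu]_(x in `]c, d[) (h x * psi x).
  move=> se; rewrite Rintegral_mkcond [RHS]Rintegral_mkcond; apply: eq_Rintegral => x _.
  rewrite !restrE; have [xcd|xcd] := boolP (x \in (`]c, d[%classic : set R)).
    by rewrite ifT//; move: xcd; rewrite !inE => /So.
  move: xcd; rewrite notin_setE => /(compact_support_out se) ->.
  by rewrite mulr0 if_same.
by rewrite -(widen F _ (support_derive Cxi sxi)) -(widen f _ sxi) W.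
Qed.

(** Exhaust (a, b) by countably many compact intervals, those with rational endpoints. *)
Lemma weak_deriv_unique a b F f g : a < b -> {within `[a, b], continuous F} ->
  weak_deriv `]a, b[ F f -> weak_deriv `]a, b[ F g ->
  {ae mu, forall x, a < x < b -> f x = g x}.
Proof.
move=> ab cF Wf Wg.
have H (q : rat * rat) : {ae mu, forall x, a < ratr q.1 -> (ratr q.1 : R) < ratr q.2 ->
    ratr q.2 < b -> ratr q.1 <= x <= ratr q.2 -> f x = g x}.
  have [h1|h1] := pselect (a < ratr q.1); last by apply: aeW => x /h1.
  have [h2|h2] := pselect ((ratr q.1 : R) < ratr q.2); last by apply: aeW => x _ /h2.
  have [h3|h3] := pselect (ratr q.2 < b); last by apply: aeW => x _ _ /h3.
  have := prim_ae_unique (weak_deriv_prim_sub h1 h2 h3 cF Wf) (weak_deriv_prim_sub h1 h2 h3 cF Wg).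
  by apply: ae_imp => x hx _ _ _.
apply: ae_imp (ae_forall_count H) => x hx /andP[ax xb].
have [q] := rat_in_itvoo ax; rewrite in_itv /= => /andP[h1 h2].
have [r] := rat_in_itvoo xb; rewrite in_itv /= => /andP[h3 h4].
by apply: (hx (q, r)) => //=; [exact: lt_trans h3|rewrite !ltW].
Qed.

Lemma wderiv_prim a b F f : a < b -> prim a b F f ->
  measurable_fun `]a, b[ (wderiv `]a, b[ F) /\
  {ae mu, forall x, a < x < b -> wderiv `]a, b[ F x = f x}.
Proof.
move=> ab Ff; have Wf := prim_weak_deriv (ltW ab) Ff.
have W : weak_deriv `]a, b[ F (wderiv `]a, b[ F).
  exact: (xgetPex (fun=> 0) (ex_intro _ f Wf)).
split; first by case: (W) => _ [].
by apply: weak_deriv_unique (prim_continuous (ltW ab) Ff) W Wf.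
Qed.

(** The representative chosen for the weak derivative does not affect the distance. *)
Lemma dist01_wderiv F1 F2 f1 f2 : prim 0 1 F1 f1 -> prim 0 1 F2 f2 ->
  dist01 (wderiv `]0, 1[ F1) (wderiv `]0, 1[ F2) =
  (\int[mu]_(y in `]0%R, 1%R[) ((f1 y - f2 y) ^+ 2)%:E)%E.
Proof.
move=> h1 h2; have [m1 e1] := wderiv_prim ltr01 h1; have [m2 e2] := wderiv_prim ltr01 h2.
have g1 := intble_meas (intble_cc_oo h1.1); have g2 := intble_meas (intble_cc_oo h2.1).
apply: ae_eq_integral => //.
- by apply/measurable_EFinP; apply: measurable_funX; exact: measurable_funB.
- by apply/measurable_EFinP; apply: measurable_funX; exact: measurable_funB.
- apply: ae_imp (ae_and e1 e2) => y [d1 d2] /=; rewrite in_itv /= => y01.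
  by rewrite d1// d2.
Qed.

Lemma dist01_continuous F1 F2 (U1 U2 : R -> R) : continuous U1 -> continuous U2 ->
  (forall y, 0 < y < 1 -> F1 y = U1 y) -> (forall y, 0 < y < 1 -> F2 y = U2 y) ->
  dist01 F1 F2 = (I01 (fun y => (U1 y - U2 y) ^+ 2))%:E.
Proof.
move=> c1 c2 e1 e2.
have i : intble mu `[0, 1] (fun y => (U1 y - U2 y) ^+ 2).
  rewrite (_ : (fun y => _) = fun y => (U1 y - U2 y) * (U1 y - U2 y)); last first.
    by apply/funext => y; rewrite expr2.
  apply: continuous_intble; apply: continuous_subspaceT => y.
  by apply: cvgM; apply: cvgB; [exact: c1|exact: c2|exact: c1|exact: c2].
have io := intble_cc_oo i.
rewrite /I01 -Rint_oo_cc; last exact: intble_meas io.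
rewrite EFin_Rint//; apply: eq_integral => y; rewrite inE /= in_itv /= => y01.
by rewrite e1// e2.
Qed.

End WeakUniqueness.

(** * The stability estimate *)

Section Reassembly.
Context {R : realType}.
Notation mu := (@lebesgue_measure R).
Notation mu2 := (mu \x mu)%E.

Lemma sq_diff_intble (T : R) (b1 b2 : R -> R) : Lp1 2%:E `]0, T[ b1 -> Lp1 2%:E `]0, T[ b2 ->
  intble mu `[0, T] (fun t => (b1 t - b2 t) ^+ 2).
Proof.
have L2 b : Lp1 2%:E `]0, T[ b -> measurable_fun (`]0, T[%classic : set R) b /\
    intble mu `]0, T[ (fun t => b t ^+ 2).
  move=> h; have mb := sub_Lfun_mfun h; rewrite inE in mb.
  have bi := Lfun2_integrable_sqr h.
  split; first by apply/(measurable_restrictT b (measurable_itv `]0, T[)).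
  apply/(intble_mkcond mu _ (measurable_itv `]0, T[)).
  move: bi; apply: eq_integrable => // t _ /=; rewrite !restrE.
  by case: ifP => //; rewrite expr0n.
move=> /L2[m1 i1] /L2[m2 i2]; apply: intble_oo_cc.
exact: intble_sqB.
Qed.

(** The integrand is identified for every time before integrating, as an integral over (0, 1)
    that may be infinite; that function is measurable by Tonelli's theorem, and finite for
    almost every time. *)
Lemma time_integral_energy (T t : R) (p : R * R -> R) (d : R -> \bar R) :
  measurable_fun setT p -> intble mu2 setT (fun q => p q ^+ 2) ->
  (forall x y, ~ (0 < x < T /\ 0 < y < 1) -> p (x, y) = 0) -> t <= T ->
  (forall x, 0 < x < T -> d x = (\int[mu]_(y in `]0%R, 1%R[) (p (x, y) ^+ 2)%:E)%E) ->
  time_integral t d = (\int[mu]_(x in `[0, t]) I01 (fun y => p (x, y) ^+ 2))%:E.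
Proof.
move=> mp p2 p0 tT dE.
have iA : intble mu `[0, t] (fun x => I01 (fun y => p (x, y) ^+ 2)) by exact: energies_intble p2 p0.
have iAo := intble_cc_oo iA.
rewrite -Rint_oo_cc; last exact: intble_meas iAo.
rewrite EFin_Rint//.
transitivity (\int[mu]_(x in [set` `]0%R, t[]) \int[mu]_y (p (x, y) ^+ 2)%:E)%E.
  apply: eq_integral => x; rewrite inE /= in_itv /= => /andP[x0 xt].
  rewrite dE ?x0 ?(lt_le_trans xt)// integral_mkcond; apply: eq_integral => y _.
  rewrite patchE mem_setE in_itv /=; case: ifPn => // y01.
  by rewrite p0 ?expr0n// => -[_ h]; rewrite h in y01.
have mF : measurable_fun setT (EFin \o (fun q : R * R => p q ^+ 2)).
  by apply/measurable_EFinP; exact: measurable_funX.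
apply: ae_eq_integral => //.
- apply: (measurable_funS measurableT) => //.
  apply: (measurable_fun_fubini_tonelli_F (m2 := mu) _ mF) => q.
  by rewrite lee_fin sqr_ge0.
- by apply/measurable_EFinP; exact: intble_meas iAo.
- apply: ae_imp (ae_integrable1 p2) => x hx _.
  rewrite -EFin_Rint// Rint_I01// => y y01.
  by rewrite p0 ?expr0n// => -[].
Qed.

Lemma tilde_state (a T : R) (s : R -> R) (u : R * R -> R) (t y : R) : 0 <= t <= T -> 0 <= y <= 1 ->
  tilde a s u t y = uc a T s u (t, y).
Proof.
by move=> tT y01; rewrite uc_in// /tilde /rescale; congr (u (_, _)); ring.
Qed.

End Reassembly.

Theorem theorem3p4 (R : realType) (a a0 H k T bl bu : R) (beta phi : R -> R)
    (rbeta k0 rphi c0 sl : R)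
    (a_gt0 : 0 < a) (a0_gt0 : 0 < a0) (H_gt0 : 0 < H) (k_gt0 : 0 < k)
    (T_gt0 : 0 < T) (bl_gt0 : 0 < bl) (bu_gt0 : 0 < bu)
    (beta_cutoff : cutoff beta rbeta k0)
    (phi_cutoff : cutoff phi rphi c0)
    (c0_lt : c0 < Num.min (2 * phi a) (bu / H))
    (a_lt_sl : a < sl) :
  exists2 M : R, 0 < M &
    forall (b1 b2 : R -> R) (s01 s02 : R) (u01 u02 : R -> R)
           (s1 s2 : R -> R) (u1 u2 : R * R -> R),
      admissible_b T bl bu b1 -> admissible_b T bl bu b2 ->
      sl <= s01 < rphi -> sl <= s02 < rphi ->
      W1p 2%:E `]a, s01[ u01 -> W1p 2%:E `]a, s02[ u02 ->
      (forall z, a <= z <= s01 -> phi a <= u01 z <= bu / H) ->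
      (forall z, a <= z <= s02 -> phi a <= u02 z <= bu / H) ->
      solution a a0 H k T beta phi b1 s01 u01 s1 u1 ->
      solution a a0 H k T beta phi b2 s02 u02 s2 u2 ->
      (forall p, Q a T s1 p -> phi a <= u1 p <= bu / H) ->
      (forall p, Q a T s2 p -> phi a <= u2 p <= bu / H) ->
      forall t, 0 <= t <= T ->
        (((s1 t - s2 t) ^+ 2)%:E
         + dist01 (tilde a s1 u1 t) (tilde a s2 u2 t)
         + time_integral t (fun tau =>
             dist01 (tilde_y a s1 u1 tau) (tilde_y a s2 u2 tau))
         <= M%:E *
            (((s01 - s02) ^+ 2)%:E
             + dist01 (rescale a s01 u01) (rescale a s02 u02)
             + time_integral t (fun tau => ((b1 tau - b2 tau) ^+ 2)%:E)))%E.
Proof.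
have phia : 0 < phi a.
  have c00 : 0 < c0 by case: phi_cutoff => _ _ [].
  by move: c0_lt; rewrite lt_min => /andP[h _]; lra.
have cphi : continuous phi by case: phi_cutoff => Cphi _ _; exact: C1_continuous.
have [Kb [Lb [Lb0 betaK betaL]]] := cutoff_bounds beta_cutoff.
have [Kp [Lp [Lp0 phiK phiL]]] := cutoff_bounds phi_cutoff.
pose B := bu / H; have B0 : 0 <= B by rewrite ltW// divr_gt0.
have Kp0 : 0 <= Kp := le_trans (normr_ge0 _) (phiK 0).
pose V := a0 * (B + Kp); have V0 : 0 <= V by rewrite mulr_ge0 ?(ltW a0_gt0)// addr_ge0.
pose lam := (sl - a) * expR (- (a0 * Lp * T)).
have lam0 : 0 < lam by rewrite mulr_gt0 ?expR_gt0// subr_gt0.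
(* the maximum with sl - a gives lam <= Lam even when no initial position is admissible *)
pose Lam := Num.max (sl - a) (rphi - a) + V * T.
have lamL : lam <= Lam.
  apply: (@le_trans _ _ (sl - a)).
    rewrite /lam ger_pMr ?subr_gt0// expR_le1 oppr_le0.
    by rewrite !mulr_ge0 ?(ltW a0_gt0) ?(ltW T_gt0).
  by rewrite /Lam ler_wpDr ?le_max ?lexx// mulr_ge0// ltW.
have [M M0 stab] := reduced_stability a k_gt0 a0_gt0 T_gt0 lam0 lamL V0 B0 (ltW H_gt0)
  Lb0 Lp0 betaK betaL phiL.
exists M => // b1 b2 s01 s02 u01 u02 s1 s2 u1 u2 [[b1L _] _ _] [[b2L _] _ _] s01r s02r _ _ _ _
  [st1 [ut1 [uz1 [uzz1 sol1]]]] [st2 [ut2 [uz2 [uzz2 sol2]]]] u1B u2B t tT.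
have absB s u : (forall p, Q a T s p -> phi a <= u p <= B) -> forall p, Q a T s p -> `|u p| <= B.
  by move=> h p /h /andP[h1 h2]; rewrite gtr0_norm//; exact: lt_le_trans phia h1.
have r1 := solution_reduced T_gt0 k_gt0 cphi sol1 (absB _ _ u1B).
have r2 := solution_reduced T_gt0 k_gt0 cphi sol2 (absB _ _ u2B).
have bs1 := solution_bounded T_gt0 a0_gt0 cphi phiK Lp0 phiL phia sol1 u1B a_lt_sl s01r.
have bs2 := solution_bounded T_gt0 a0_gt0 cphi phiK Lp0 phiL phia sol2 u2B a_lt_sl s02r.
have ib := sq_diff_intble b1L b2L.
have := stab _ _ _ _ _ _ _ _ _ _ _ _ _ _ r1 r2 bs1 bs2 ib t tT.
set U1 := uc a T s1 u1; set U2 := uc a T s2 u2.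
set P1 := (fun p => len a T s1 p.1 * tr a T s1 uz1 p).
set P2 := (fun p => len a T s2 p.1 * tr a T s2 uz2 p).
have /andP[t0 tT'] := tT.
have T00 : 0 <= (0 : R) <= T by rewrite lexx ltW.
have oo x y : (x < y < (1 : R)) -> x <= y <= 1 by move=> /andP[/ltW -> /ltW ->].
have cU1 := red_U_y r1; have cU2 := red_U_y r2.
have d_t : dist01 (tilde a s1 u1 t) (tilde a s2 u2 t) =
    (I01 (fun y => (U1 (t, y) - U2 (t, y)) ^+ 2))%:E.
  apply: dist01_continuous; [exact: cU1|exact: cU2| |].
  - by move=> y /oo y01; exact: tilde_state.
  - by move=> y /oo y01; exact: tilde_state.
have init s0 u0 b s st u ut uz uzz : a < sl -> sl <= s0 < rphi ->
    solution_with a a0 H k T beta phi b s0 u0 s st u ut uz uzz ->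
    forall y, 0 < y < 1 -> rescale a s0 u0 y = uc a T s u (0, y).
  move=> asl /andP[sls _] sol y /[dup] y01 /oo y01'.
  rewrite -(tilde_state a s u T00 y01') /tilde /rescale (s_initial sol) (u_initial sol)//.
  move: y01' asl sls; clear => /andP[y0 y1] asl sls; have s0a : 0 <= s0 - a by lra.
  have y1' : 0 <= 1 - y by lra.
  by have := mulr_ge0 y0 s0a; have := mulr_ge0 y1' s0a => *; apply/andP; split; lra.
have d_0 : dist01 (rescale a s01 u01) (rescale a s02 u02) =
    (I01 (fun y => (U1 (0, y) - U2 (0, y)) ^+ 2))%:E.
  by apply: dist01_continuous; [exact: cU1|exact: cU2|exact: init sol1|exact: init sol2].
have d_y : time_integral t (fun tau => dist01 (tilde_y a s1 u1 tau) (tilde_y a s2 u2 tau)) =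
    (\int[lebesgue_measure]_(x in `[0, t]) I01 (fun y => (P1 (x, y) - P2 (x, y)) ^+ 2))%:E.
  apply: (time_integral_energy (T := T) (p := fun q => P1 q - P2 q)) => //.
  - exact: measurable_funB (red_P_meas r1) (red_P_meas r2).
  - apply: intble_sqB; [by []|exact: (red_P_meas r1)|exact: (red_P_meas r2)| |].
      exact: (red_P_sq r1).
    exact: (red_P_sq r2).
  - by move=> x y h; rewrite /P1 /P2 (red_P_out r1 h) (red_P_out r2 h) subrr.
  - move=> x xT; have xT' : 0 <= x <= T by case/andP: xT => /ltW -> /ltW ->.
    apply: dist01_wderiv.
    + by apply: prim_eq (red_y r1 xT) => // y y01; rewrite (tilde_state _ _ _ xT').
    + by apply: prim_eq (red_y r2 xT) => // y y01; rewrite (tilde_state _ _ _ xT').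
have d_b : time_integral t (fun tau => ((b1 tau - b2 tau) ^+ 2)%:E) =
    (\int[lebesgue_measure]_(x in `[0, t]) ((b1 x - b2 x) ^+ 2))%:E.
  have ibt : intble lebesgue_measure `[0, t] (fun x => (b1 x - b2 x) ^+ 2).
    by apply: intbleS ib => //; apply: subset_itvl; rewrite bnd_simp.
  have ibo := intble_cc_oo ibt.
  by rewrite -Rint_oo_cc ?EFin_Rint//; exact: intble_meas ibo.
rewrite d_t d_0 d_y d_b !len_id// (s_initial sol1) (s_initial sol2).
have e (x y : R) : x - a - (y - a) = x - y by ring.
rewrite !e -!EFinD -EFinM lee_fin => h.
rewrite [X in X + _ <= _]addrC [X in _ <= _ * (X + _)]addrC.
exact: h.
Qed.
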